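(* Let $\Gamma$ be a finitely generated group and let $X$ be a finite generating set of $\Gamma$. Then the following are equivalent: (a) $\mathrm{G}_{\Gamma,X}(n)\preceq n^r$ for some $r$; (b) $\Gamma$ is virtually nilpotent.
   Context: For a group $\Gamma$ with finite generating set $X$, $\|\cdot\|_X$ denotes word length with respect to $X$ and $B_{\Gamma,X}(n)=\{\gamma\in\Gamma : \|\gamma\|_X\le n\}$. The residual girth function $\mathrm{G}_{\Gamma,X}(n)$ is the cardinality of the smallest finite group $Q$ for which there exists a surjective homomorphism $\varphi:\Gamma\to Q$ whose restriction to $B_{\Gamma,X}(n)$ is injective (and $\mathrm{G}_{\Gamma,X}(n)=\infty$ if there is no such finite group). For functions $f_1,f_2$ on the positive integers with values in $[0,\infty]$, $f_1\preceq f_2$ means that there is a constant $C$ (a positive integer) such that $f_1(n)\le C f_2(Cn)$ for all $n\geq 1$. *)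

(* Defs.v *)
From HB Require Import structures.
From mathcomp Require Import all_boot all_order all_algebra all_fingroup.
From mathcomp Require Import boolp classical_sets functions cardinality.
From mathcomp Require Import reals ereal exp.

Set Implicit Arguments.
Unset Strict Implicit.
Unset Printing Implicit Defensive.

Import Order.TTheory GRing.Theory Num.Theory.
Local Open Scope classical_set_scope.

Section Subgroups.
Context {G : groupType}.
Local Open Scope group_scope.
Implicit Types (x y : G) (X H K : set G).

Definition is_subgroup H : Prop := group_closed (mem H).

Definition gen_subgroup X : set G := smallest is_subgroup X.

Definition generates X : Prop := gen_subgroup X = [set: G].

Definition left_coset H x : set G := [set x * h | h in H].

Definition finite_index H : Prop := finite_set (range (left_coset H)).

Definition commutator_subgroup H K : set G :=
  gen_subgroup [set z | exists x y, [/\ H x, K y & z = [~ x, y]]].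

(* The index is shifted by one from the usual gamma_1(H) = H. *)
Fixpoint lower_central H (c : nat) : set G :=
  if c is c'.+1 then commutator_subgroup (lower_central H c') H else H.

Definition nilpotent_subgroup H : Prop :=
  exists c : nat, lower_central H c = [set 1].

Definition word_value (X : set G) (w : seq G) (x : G) : Prop :=
  (forall y, y \in w -> X y \/ X y^-1) /\ x = \prod_(y <- w) y.

End Subgroups.

Definition virtually_nilpotent (G : groupType) : Prop :=
  exists H : set G, [/\ is_subgroup H, finite_index H & nilpotent_subgroup H].

Section Growth.
Context {R : realType}.
Local Open Scope ring_scope.
Local Open Scope ereal_scope.

(* The least element of A, and +oo when A is empty. *)
Definition nat_inf (A : set nat) : \bar R :=
  ereal_inf [set (k%:R)%:E | k in A].

Lemma nat_inf_leP (A : set nat) (n : nat) :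
  nat_inf A <= n%:R%:E <-> exists2 k, A k & (k <= n)%N.
Proof.
split=> [|[k Ak kn]]; last first.
  apply: (@le_trans _ _ (k%:R)%:E); last by rewrite lee_fin ler_nat.
  by apply: ereal_inf_lbound; exists k.
move=> infA; apply: contrapT => noA.
suff: n.+1%:R%:E <= n%:R%:E :> \bar R by rewrite lee_fin ler_nat ltnn.
apply: le_trans infA; apply: le_ereal_inf_tmp => _ [k Ak <-].
rewrite lee_fin ler_nat ltnNge; apply/negP => kn.
by apply: noA; exists k.
Qed.

Definition word_length (G : groupType) (X : set G) (x : G) : \bar R :=
  nat_inf [set n | exists2 w, word_value X w x & size w = n].

Definition ball_word (G : groupType) (X : set G) (n : nat) : set G :=
  [set x | word_length X x <= n%:R%:E].

Definition residual_girth (G : groupType) (X : set G) (n : nat) : \bar R :=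
  nat_inf [set k | exists (Q : finGroupType) (phi : {multiplicative G -> Q}),
    [/\ set_surj setT setT phi, set_inj (ball_word X n) phi & #|Q| = k]].

Definition growth_le (f1 f2 : nat -> \bar R) : Prop :=
  exists2 C : nat, (0 < C)%N &
    forall n : nat, (0 < n)%N -> f1 n <= C%:R%:E * f2 (C * n)%N.

End Growth.

Arguments word_length R {G} X x.
Arguments ball_word R {G} X n.
Arguments residual_girth R {G} X n.

(* Main.v *)
(* A nilpotent group H of finite index has a central series with cyclic factors,
   along which one finds for every n an exponent M, polynomial in n, such that the
   subgroup H^M generated by M-th powers misses the ball of radius 2n; its core is
   the kernel of a quotient of polynomial order.

   Conversely, polynomial residual girth gives residual finiteness and polynomial
   growth, and one argues by induction on the growth degree as in Gromov's theorem.
   A homomorphism from a subgroup of finite index onto the integers is obtained from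
   the finite quotients Q of the group.  In the regular representation of Q there are
   vectors v with avg_a (a v) = (1 - lambda) v and lambda small, giving the almost
   harmonic cocycle b(x) = x v - v.  For the random walk x_n the entropy increments
   are O(1/n) along good scales, which forces the normalised covariance of b(x_n)
   to be almost invariant; its spectral projections have bounded rank.  An ultralimit
   yields an orthogonal representation u of bounded dimension with a nonzero harmonic
   cocycle.  Polynomial growth makes u virtually abelian, because iterated commutators
   of almost trivial matrices would produce too many distinct products, and either
   u or the cocycle then has an infinite abelian image.  The kernel of the resulting map
   to the integers is finitely generated of smaller growth degree, hence virtually
   nilpotent; growth also forces the eigenvalues of the integer acting on the layers of
   its central series to be roots of unity (Milnor-Wolf, Kronecker), so that the
   extension is virtually nilpotent. *)
Require Import Defs.
From HB Require Import structures.
From mathcomp Require Import all_boot all_order all_algebra all_fingroup all_field.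
From mathcomp Require Import spectral mxred.
From mathcomp Require complex.
From mathcomp Require Import boolp classical_sets functions cardinality filter.
From mathcomp Require Import reals ereal topology normedtype sequences exp.
From mathcomp Require Import zify ring lra.

Set Implicit Arguments.
Unset Strict Implicit.
Unset Printing Implicit Defensive.

(** * Subgroups and word balls *)

Section GroupBalls.
Local Open Scope classical_set_scope.
Local Open Scope group_scope.

Section SubgroupBasics.
Context {G : groupType}.
Implicit Types (x y z : G) (H K L X : set G) (S : seq G).

(** In a single finite quotient every cocycle is a coboundary, so the nontrivial one can only appear
    in a limit. The normalization [dot v v = (2 * lam)^-1] gives [b] mean squared norm 1 on the
    letters, while its harmonic defect [lam *: v] has squared norm [lam / 2]. A small [lam] exists
    because polynomial growth yields a ball of small boundary filling at most half of a large
    quotient. The regular representations have unbounded dimension, hence the compression to a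
    spectral subspace of the covariance divided by [n]: its trace is at most 1, which bounds the
    rank, and the letters move it by O(n^(-1/2)), which makes the subspace almost invariant. The
    order of choices is delicate: the good scale [n] depends on the quotient, but its upper bound
    does not, and [lam] has to be small against that bound. In the other direction the exponent
    serves two purposes at each entry [t] of infinite order modulo the group [K] of the later
    entries: one factor makes a power of [t] centralize [K] modulo a power subgroup of [K], another
    pushes the powers of [t] that remain out of the ball. *)

Lemma is_subgroupP H :
  is_subgroup H <-> H 1 /\ (forall x y, H x -> H y -> H (x * y^-1)).
Proof.
split=> [[h1 hd]|[h1 hd]]; split.
- by move: h1; rewrite inE.
- by move=> x y Hx Hy; have := hd x y; rewrite !inE => h; exact: h.
- by rewrite inE.
- by move=> x y; rewrite !inE; exact: hd.
Qed.

Lemma sg1 H : is_subgroup H -> H 1.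
Proof. by case/is_subgroupP. Qed.

Lemma sgV H x : is_subgroup H -> H x -> H x^-1.
Proof. by case/is_subgroupP=> h1 hd Hx; rewrite -[x^-1]mul1g; exact: hd. Qed.

Lemma sgM H x y : is_subgroup H -> H x -> H y -> H (x * y).
Proof.
move=> sH Hx Hy; rewrite -[y]invgK.
by case/is_subgroupP: (sH)=> _; apply=> //; exact: sgV.
Qed.

Lemma sgX H x n : is_subgroup H -> H x -> H (x ^+ n).
Proof.
by move=> sH Hx; elim: n => [|n IH]; rewrite ?expgS; [exact: sg1|exact: sgM].
Qed.

Lemma sgJ H x y : is_subgroup H -> H x -> H y -> H (x ^ y).
Proof. by move=> sH Hx Hy; do !apply: sgM => //; exact: sgV. Qed.

Lemma sgR H x y : is_subgroup H -> H x -> H y -> H [~ x, y].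
Proof. by move=> sH Hx Hy; rewrite commgEl; apply: sgM=> //; [exact: sgV|exact: sgJ]. Qed.

Lemma sgVE H x : is_subgroup H -> H x^-1 = H x.
Proof.
by move=> sH; apply/propext; split=> [/(sgV sH)|/(sgV sH) //]; rewrite invgK.
Qed.

Lemma sgMl H x y : is_subgroup H -> H x -> H (x * y) = H y.
Proof.
move=> sH Hx; apply/propext; split=> [h|]; last exact: sgM.
by rewrite -[y](mulKg x); apply: sgM=> //; exact: sgV.
Qed.

Lemma sgMr H x y : is_subgroup H -> H x -> H (y * x) = H y.
Proof.
move=> sH Hx; apply/propext; split=> [h|h]; last exact: sgM.
by rewrite -[y](mulgK x); apply: sgM=> //; exact: sgV.
Qed.

Lemma sg_one : is_subgroup [set (1 : G)].
Proof. by apply/is_subgroupP; split=> // x y -> ->; rewrite mulgV. Qed.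

Lemma sub_gen_subgroup X : X `<=` gen_subgroup X.
Proof. by move=> x Xx H [_]; exact. Qed.

Lemma gen_subgroup_min X H : is_subgroup H -> X `<=` H -> gen_subgroup X `<=` H.
Proof. by move=> sH XH x; apply. Qed.

Lemma sg_gen_subgroup X : is_subgroup (gen_subgroup X).
Proof.
apply/is_subgroupP; split; first by move=> H [sH _]; exact: sg1.
by move=> x y hx hy H hH; apply: sgM (hH.1) (hx H hH) (sgV hH.1 (hy H hH)).
Qed.

Lemma gen_subgroup_mono X1 X2 :
  X1 `<=` X2 -> gen_subgroup X1 `<=` gen_subgroup X2.
Proof.
move=> X12; apply: gen_subgroup_min; first exact: sg_gen_subgroup.
exact: subset_trans X12 (@sub_gen_subgroup _).
Qed.

(** An equivalence, because in an infinite group conjugation can map a subgroup onto a proper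
    subgroup of itself. *)
Definition normalizes (g : G) H := forall x, H x <-> H (x ^ g).

Lemma normalizesV g H : normalizes g H -> normalizes g^-1 H.
Proof. by move=> n x; rewrite -[in X in X <-> _](conjgKV g x); symmetry; exact: n. Qed.

Lemma normalizesM g h H : normalizes g H -> normalizes h H -> normalizes (g * h) H.
Proof. by move=> ng nh x; rewrite (ng x) (nh (x ^ g)) conjgM. Qed.

Lemma normalizes1 H : normalizes 1 H.
Proof. by move=> x; rewrite conjg1. Qed.

Lemma normalizesX g H n : normalizes g H -> normalizes (g ^+ n) H.
Proof.
move=> ng; elim: n => [|n IH]; first exact: normalizes1.
by rewrite expgS; exact: normalizesM.
Qed.

Lemma sg_self_normalizes H g : is_subgroup H -> H g -> normalizes g H.
Proof.
move=> sH Hg x; split=> [Hx|Hx]; first exact: sgJ.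
by rewrite -(conjgK g x); apply: sgJ=> //; exact: sgV.
Qed.

Lemma normalizes_gen X g :
  (forall x, X x -> gen_subgroup X (x ^ g)) ->
  (forall x, X x -> gen_subgroup X (x ^ g^-1)) -> normalizes g (gen_subgroup X).
Proof.
have aux h : (forall x, X x -> gen_subgroup X (x ^ h)) ->
    forall x, gen_subgroup X x -> gen_subgroup X (x ^ h).
  move=> hX; apply: (@gen_subgroup_min X [set x | gen_subgroup X (x ^ h)]) => //.
  apply/is_subgroupP; split; first by rewrite /= conj1g; exact: sg1 (sg_gen_subgroup _).
  move=> x y /= Hx Hy; rewrite conjMg conjVg.
  by apply: (sgM (sg_gen_subgroup _)) => //; exact: (sgV (sg_gen_subgroup _)).
move=> h1 h2 x; split; first exact: aux.
by move/(aux _ h2); rewrite conjgK.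
Qed.

Definition power_subgroup H (m : nat) : set G :=
  gen_subgroup [set x ^+ m | x in H].

Lemma sg_power H m : is_subgroup (power_subgroup H m).
Proof. exact: sg_gen_subgroup. Qed.

Lemma power_mem H m x : H x -> power_subgroup H m (x ^+ m).
Proof. by move=> Hx; apply: sub_gen_subgroup; exists x. Qed.

Lemma power_sub H m : is_subgroup H -> power_subgroup H m `<=` H.
Proof. by move=> sH; apply: gen_subgroup_min => // _ [x Hx <-]; exact: sgX. Qed.

Lemma power_normalizes H m g :
  normalizes g H -> normalizes g (power_subgroup H m).
Proof.
move=> ng; apply: normalizes_gen => _ [x Hx <-]; rewrite conjXg; apply: power_mem.
  exact: (ng x).1.
exact: (normalizesV ng x).1.
Qed.

Lemma power_mono H K m : H `<=` K -> power_subgroup H m `<=` power_subgroup K m.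
Proof. by move=> HK; apply: gen_subgroup_mono => _ [x Hx <-]; exists x=> //; exact: HK. Qed.

End SubgroupBasics.

Lemma leq_expn m n e : (m <= n -> m ^ e <= n ^ e)%N.
Proof. by case: e => // e mn; rewrite leq_exp2r. Qed.

Section Balls.
Context {G : groupType}.
Implicit Types (x y z a : G) (H K X : set G) (S : seq G).

Definition letters S : seq G := 1 :: S ++ [seq x^-1 | x <- S].

Lemma letters1 S : 1 \in letters S.
Proof. by rewrite inE eqxx. Qed.

Lemma mem_letters S a : a \in S -> a \in letters S.
Proof. by move=> aS; rewrite inE mem_cat aS orbT. Qed.

Lemma lettersP S a :
  reflect [\/ a = 1, a \in S | a^-1 \in S] (a \in letters S).
Proof.
apply: (iffP idP).
  rewrite inE mem_cat => /or3P [/eqP ->|aS|/mapP [b bS ->]].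
  - exact: Or31.
  - exact: Or32.
  - by apply: Or33; rewrite invgK.
case=> [->|/mem_letters //|aS]; first exact: letters1.
by rewrite inE mem_cat -[a]invgK map_f ?orbT.
Qed.

Lemma lettersV S a : (a^-1 \in letters S) = (a \in letters S).
Proof.
suff h b : b \in letters S -> b^-1 \in letters S.
  by apply/idP/idP => [/h|/h //]; rewrite invgK.
case/lettersP=> [->|bS|bS]; apply/lettersP; first by rewrite invg1; exact: Or31.
  by apply: Or33; rewrite invgK.
exact: Or32.
Qed.

(* Since 1 is a letter, the products of exactly n letters form the ball. *)
Fixpoint wball S (n : nat) : set G :=
  if n is n'.+1 then [set x | exists2 a, a \in letters S & wball S n' (a^-1 * x)]
  else [set 1].

Definition gen S : set G := [set x | exists n, wball S n x].

Lemma ballS S n x a : a \in letters S -> wball S n x -> wball S n.+1 (a * x).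
Proof. by move=> aS bx; exists a => //; rewrite mulKg. Qed.

Lemma ball_one S n : wball S n 1.
Proof.
elim: n => [|n IH] //; rewrite -[X in wball _ _ X]mulg1.
by apply: ballS=> //; exact: letters1.
Qed.

Lemma ball_mono S m n x : m <= n -> wball S m x -> wball S n x.
Proof.
move=> mn bx; rewrite -(subnK mn); elim: (n - m) => [|k IH] //.
by rewrite addSn -[x]mul1g; apply: ballS => //; exact: letters1.
Qed.

Lemma ballM S m n x y : wball S m x -> wball S n y -> wball S (m + n) (x * y).
Proof.
elim: m x => [x -> hy|m IH x [a aS bx] hy]; first by rewrite mul1g.
rewrite addSn -[x](mulVKg a) -mulgA; apply: ballS => //; exact: IH.
Qed.

Lemma ball_letter S a : a \in letters S -> wball S 1 a.
Proof. by move=> aS; rewrite -[a]mulg1; apply: ballS. Qed.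

Lemma ballV S n x : wball S n x -> wball S n x^-1.
Proof.
elim: n x => [x ->|n IH x [a aS bx]]; first by rewrite invg1.
rewrite -[x](mulVKg a) invgM -addn1; apply: ballM; first exact: IH.
by apply: ball_letter; rewrite lettersV.
Qed.

Lemma ballX S n x k : wball S n x -> wball S (n * k) (x ^+ k).
Proof.
move=> bx; elim: k => [|k IH]; first by rewrite muln0.
by rewrite expgS mulnS; exact: ballM.
Qed.

Lemma sg_gen S : is_subgroup (gen S).
Proof.
apply/is_subgroupP; split; first by exists 0%N.
by move=> x y [m bx] [n /ballV yb]; exists (m + n)%N; exact: ballM.
Qed.

Lemma gen_mem S x : x \in S -> gen S x.
Proof. by move=> /mem_letters /ball_letter; exists 1%N. Qed.

Lemma gen_letter S x : x \in letters S -> gen S x.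
Proof. by move=> /ball_letter; exists 1%N. Qed.

Lemma ball_gen S n : wball S n `<=` gen S.
Proof. by move=> x bx; exists n. Qed.

Lemma gen_min S H : is_subgroup H -> (forall x, x \in S -> H x) -> gen S `<=` H.
Proof.
move=> sH SH x [n]; elim: n x => [x ->|n IH x [a aS bx]]; first exact: sg1.
rewrite -[x](mulVKg a); apply: sgM (IH _ bx) => //.
case/lettersP: aS => [->|/SH //|/SH]; first exact: sg1.
by rewrite sgVE.
Qed.

Lemma gen_subgroup_seq S : gen_subgroup [set` S] = gen S.
Proof.
apply/seteqP; split.
  by apply: gen_subgroup_min; [exact: sg_gen|move=> x; exact: gen_mem].
by apply: gen_min; [exact: sg_gen_subgroup|move=> x; exact: sub_gen_subgroup].
Qed.

Lemma ball_sub S S' (L : nat) n x :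
  (forall s, s \in S' -> wball S L s) -> wball S' n x -> wball S (L * n) x.
Proof.
move=> h; elim: n x => [x ->|n IH x [a aS bx]]; first exact: ball_one.
rewrite -[x](mulVKg a) mulnS; apply: ballM (IH _ bx).
case/lettersP: aS => [->|/h //|/h /ballV]; first exact: ball_one.
by rewrite invgK.
Qed.

Lemma ball_bound S (s : seq G) : (forall x, x \in s -> gen S x) ->
  exists n, forall x, x \in s -> wball S n x.
Proof.
elim: s => [|a s IH] h; first by exists 0%N.
have [|n hn] := IH; first by move=> x xs; apply: h; rewrite inE xs orbT.
have [m hm] := h a (mem_head _ _).
exists (m + n)%N => x; rewrite inE => /orP [/eqP ->|/hn].
  by apply: ball_mono hm; lia.
by apply: ball_mono; lia.
Qed.

(** Cardinality is expressed by duplicate-free lists, so that balls need no finite type; [n.+1]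
    keeps the bound meaningful at radius 0. *)
Definition growth S (d : nat) := exists C : nat, forall n (s : seq G),
  uniq s -> (forall x, x \in s -> wball S n x) -> (size s <= C * n.+1 ^ d)%N.

Lemma growth_sub S S' d :
  (forall x, x \in S' -> gen S x) -> growth S d -> growth S' d.
Proof.
move=> /ball_bound [L hL] [C hC]; exists (C * L.+1 ^ d)%N => n s us hs.
have := hC (L * n)%N s us (fun x xs => ball_sub hL (hs x xs)).
move/leq_trans; apply; by rewrite -mulnA leq_mul2l -expnMn leq_expn ?orbT //; lia.
Qed.

End Balls.

Arguments letters : simpl never.

End GroupBalls.

(** * Finite index *)

Section GroupIndex.
Local Open Scope classical_set_scope.
Local Open Scope group_scope.

Section FiniteIndex.
Context {G : groupType}.
Implicit Types (x y z : G) (H K L X : set G) (S : seq G).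

(* Relative finiteness of the index; K need not be contained in H. *)
Definition fidx K H := exists r : seq G,
  forall x, H x -> exists2 y, y \in r & K (y^-1 * x).

Lemma fidx_in K H : is_subgroup K -> is_subgroup H -> fidx K H ->
  exists2 r : seq G, (forall y, y \in r -> H y) &
    forall x, H x -> exists2 y, y \in r & K (y^-1 * x).
Proof.
(* A representative whose coset misses [H] is replaced by the default value 1. *)
move=> sK sH [r hr]; pose f y := xget 1 [set x | H x /\ K (y^-1 * x)].
exists (map f r) => [_ /mapP [y _ ->]|x Hx].
  by rewrite /f; case: xgetP => [? -> []|_] //; exact: sg1.
have [y yr Kyx] := hr x Hx; exists (f y); first exact: map_f.
have [Hf Kf] : H (f y) /\ K (y^-1 * f y).
  by apply: (@xgetPex _ 1 [set x | H x /\ K (y^-1 * x)]); exists x.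
have -> : (f y)^-1 * x = (y^-1 * f y)^-1 * (y^-1 * x).
  by rewrite invgM invgK mulgA mulgK.
by apply: sgM => //; exact: sgV.
Qed.

Lemma fidx_trans K L H : is_subgroup L -> is_subgroup H ->
  fidx K L -> fidx L H -> fidx K H.
Proof.
move=> sL sH [r hr] [q hq]; exists [seq y * z | y <- q, z <- r] => x Hx.
have [y yq Lyx] := hq x Hx; have [z zr Kz] := hr _ Lyx.
by exists (y * z); [exact: allpairs_f|rewrite invgM -mulgA].
Qed.

Lemma fidx_subl K L H : K `<=` L -> fidx K H -> fidx L H.
Proof. by move=> KL [r hr]; exists r => x /hr [y yr /KL]; exists y. Qed.

Lemma fidx_subr K H L : H `<=` L -> fidx K L -> fidx K H.
Proof. by move=> HL [r hr]; exists r => x /HL /hr. Qed.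

Lemma fidx_refl K : fidx K K.
Proof. by exists [:: 1] => x Kx; exists 1; rewrite ?mem_head // invg1 mul1g. Qed.

(** Greedy choice: a list that cannot be prolonged is a finite system of representatives. *)
Lemma not_fidx_free K H n : is_subgroup K -> ~ fidx K H ->
  exists s : seq G, [/\ size s = n, forall x, x \in s -> H x &
    pairwise (fun x y => `[< ~ K (x^-1 * y) >]) s].
Proof.
move=> sK nf; elim: n => [|n [s [ss sH sf]]]; first by exists [::].
have [x [Hx hx]] : exists x, H x /\ forall y, y \in s -> ~ K (y^-1 * x).
  apply: contrapT => h; apply: nf; exists s => x Hx.
  by apply: contrapT => h2; apply: h; exists x; split=> // y ys Ky; apply: h2; exists y.
exists (rcons s x); split; first by rewrite size_rcons ss.
  by move=> y; rewrite mem_rcons inE => /orP [/eqP ->|/sH].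
rewrite pairwise_rcons sf andbT; apply/allP => y ys /=.
by apply/asboolP; exact: hx.
Qed.

Lemma coset_free_uniq K (s : seq G) : is_subgroup K ->
  pairwise (fun x y => `[< ~ K (x^-1 * y) >]) s -> uniq s.
Proof.
move=> sK; elim: s => //= x s IH /andP [/allP h /IH ->]; rewrite andbT.
by apply/negP => /h /asboolP; apply; rewrite mulVg; exact: sg1.
Qed.

Lemma finite_indexP K : is_subgroup K -> finite_index K <-> fidx K [set: G].
Proof.
move=> sK; have cosE x y : left_coset K x = left_coset K y <-> K (y^-1 * x).
  split=> [e|Kyx].
    have : left_coset K x x by exists 1; [exact: sg1|rewrite mulg1].
    by rewrite e => -[h Kh <-]; rewrite mulKg.
  apply/seteqP; split=> _ [h Kh <-].
    by exists (y^-1 * x * h); [exact: sgM|rewrite !mulgA mulgV mul1g].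
  exists ((y^-1 * x)^-1 * h); first by apply: sgM => //; exact: sgV.
  by rewrite invgM invgK !mulgA mulgV mul1g.
split=> [/finite_seqP [s hs]|[r hr]].
  pose f (A : set G) := xget 1 [set x | left_coset K x = A].
  exists (map f s) => x _; have : [set` s] (left_coset K x) by rewrite -hs; exists x.
  move=> xs; exists (f (left_coset K x)); first exact: (map_f f).
  apply/cosE; symmetry.
  by apply: (@xgetPex _ 1 [set y | left_coset K y = left_coset K x]); exists x.
apply: (@sub_finite_set _ _ (left_coset K @` [set` r])).
  by move=> _ [x _ <-]; have [y yr /cosE e] := hr x I; exists y.
by apply: finite_image; exact: finite_seq.
Qed.

(* Schreier: [K] is generated by its elements of the form [y^-1 * a * z] with [a] a
   letter and [y], [z] representatives. *)
Lemma fidx_fg K S : is_subgroup K -> K `<=` gen S -> fidx K (gen S) ->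
  exists S', K = gen S'.
Proof.
move=> sK KS /(fidx_in sK (sg_gen S)) [r rS hr].
pose r1 := 1 :: r.
pose T := [seq y^-1 * a.1 * a.2 | y <- r1, a <- [seq (b, c) | b <- letters S, c <- r1]].
exists [seq z <- T | `[< K z >]]; apply/seteqP; split; last first.
  by apply: gen_min => // x; rewrite mem_filter => /andP [/asboolP].
have memT y a y' : y \in r1 -> a \in letters S -> y' \in r1 ->
    K (y^-1 * a * y') -> gen [seq z <- T | `[< K z >]] (y^-1 * a * y').
  move=> hy ha hy' hK; apply: gen_mem; rewrite mem_filter; apply/andP; split.
    exact/asboolP.
  apply: (allpairs_f (fun y a => y^-1 * a.1 * a.2) hy (_ : (a, y') \in _)).
  exact: (allpairs_f (fun b c => (b, c))).
have key n x y y' : wball S n x -> y \in r1 -> y' \in r1 -> K (y^-1 * x * y') ->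
    gen [seq z <- T | `[< K z >]] (y^-1 * x * y').
  elim: n x y y' => [x y y' -> hy hy'|n IH x y y' [a aS bx] hy hy' hK].
    by move=> hK; apply: memT => //; exact: letters1.
  have Sy' : gen S y'.
    by move: hy'; rewrite inE => /orP [/eqP ->|/rS //]; exact: sg1 (sg_gen _).
  have [z zr Kz] := hr (a^-1 * x * y') (sgM (sg_gen _) (ball_gen bx) Sy').
  have zr1 : z \in r1 by rewrite inE zr orbT.
  rewrite mulgA in Kz; have e : y^-1 * x * y' = (y^-1 * a * z) * (z^-1 * (a^-1 * x) * y').
    by rewrite !mulgA mulgK mulgK.
  rewrite mulgA in Kz; rewrite -(mulgA z^-1) in Kz.
  rewrite e; apply: sgM (sg_gen _) _ _; last exact: IH.
  by apply: memT => //; move: hK; rewrite e sgMr.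
move=> x Kx; have [n bx] := KS x Kx.
by have := @key n x 1 1 bx (mem_head _ _) (mem_head _ _); rewrite invg1 mul1g mulg1; apply.
Qed.

End FiniteIndex.

Section IntegerPowers.
Context {G : groupType}.
Implicit Types (t x : G) (i j : int).

Definition expz t i : G := match i with Posz n => t ^+ n | Negz n => t ^- n.+1 end.

Lemma expz_opp t (n : nat) : expz t (- n%:Z)%R = t ^- n.
Proof. by case: n => [|n]; rewrite ?invg1. Qed.

Lemma expzS t i : expz t (i + 1)%R = expz t i * t.
Proof.
case: i => [n|[|n]]; first by rewrite -[(_ + 1)%R]/(Posz (n + 1)%N) addn1 /= expgSr.
  by rewrite /= mulVg.
have -> : (Negz n.+1 + 1)%R = (- n.+1%:Z)%R by lia.
by rewrite expz_opp /= [t ^+ n.+2]expgS invgM mulgVK.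
Qed.

Lemma expzP t i : expz t (i - 1)%R = expz t i * t^-1.
Proof. by rewrite -[in RHS](GRing.subrK 1%R i) expzS mulgK. Qed.

Lemma expzD t i j : expz t (i + j)%R = expz t i * expz t j.
Proof.
elim: j => [|n IH|n IH]; first by rewrite GRing.addr0 mulg1.
  by rewrite -addn1 PoszD GRing.addrA !expzS IH mulgA.
rewrite -addn1 PoszD GRing.opprD GRing.addrA !expzP IH mulgA //.
Qed.

Lemma expzN t i : expz t (- i)%R = (expz t i)^-1.
Proof. by apply/esym/mulg1_eq; rewrite -expzD GRing.subrr. Qed.

Lemma expzC t i j : expz t i * expz t j = expz t j * expz t i.
Proof. by rewrite -!expzD GRing.addrC. Qed.

Lemma expz_mul t (i : int) (n : nat) : expz t (i * n%:Z)%R = expz t i ^+ n.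
Proof.
elim: n => [|n IH]; first by rewrite GRing.mulr0.
by rewrite -addn1 PoszD GRing.mulrDr GRing.mulr1 expzD IH addn1 expgSr.
Qed.

Lemma normalizes_expz t i (H : set G) : normalizes t H -> normalizes (expz t i) H.
Proof.
move=> nt; case: i => n; first exact: normalizesX.
by apply: normalizesV; exact: normalizesX.
Qed.

Lemma sg_expz t i (H : set G) : is_subgroup H -> H t -> H (expz t i).
Proof. by move=> sH Ht; case: i => n; [|apply: sgV => //]; exact: sgX. Qed.

(* The subgroup generated by L and t when t normalizes L. *)
Definition ext (L : set G) t : set G := [set x | exists j : int, L (x * expz t j)].

Variables (L : set G) (t : G).
Hypotheses (sL : is_subgroup L) (nt : normalizes t L).

Lemma sg_ext : is_subgroup (ext L t).
Proof.
apply/is_subgroupP; split; first by exists 0%R; rewrite mulg1; exact: sg1.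
move=> x y [i Lx] [j Ly]; exists (i - j)%R.
have -> : x * y^-1 * expz t (i - j)%R =
    (x * expz t i) * ((y * expz t j)^-1 ^ expz t (i - j)%R).
  rewrite expzD expzN conjgE !invgM invgK !mulgA.
  by rewrite -(mulgA x _ (expz t j)) expzC mulgA !mulgK.
apply: sgM => //; apply: (normalizes_expz _ nt _).1; exact: sgV.
Qed.

Lemma ext_sub : L `<=` ext L t.
Proof. by move=> x Lx; exists 0%R; rewrite mulg1. Qed.

Lemma ext_mem : ext L t t.
Proof. by exists (-1)%R; rewrite expzN mulgV; exact: sg1. Qed.

Lemma ext_min (H : set G) : is_subgroup H -> L `<=` H -> H t -> ext L t `<=` H.
Proof.
move=> sH LH Ht x [j /LH]; rewrite sgMr //; exact: sg_expz.
Qed.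

Lemma ext_fidx n : 0 < n -> L (t ^+ n) -> fidx L (ext L t).
Proof.
move=> n0 Ltn; exists [seq t ^- k | k <- iota 0 n] => x [j Lx].
pose r := `|(j %% n%:Z)%Z|%N; have rE : (r%:Z = j %% n%:Z)%Z by rewrite /r; lia.
exists (t ^- r); first by apply: map_f; rewrite mem_iota; lia.
have Lr : L (x * t ^+ r).
  have e : j = (r%:Z + (j %/ n%:Z)%Z * n%:Z)%R by rewrite rE; lia.
  have Lq : L (expz t ((j %/ n%:Z)%Z * n%:Z)%R).
    rewrite GRing.mulrC; case: (j %/ n%:Z)%Z => k; first by rewrite expz_mul; exact: sgX.
    by rewrite NegzE GRing.mulrN expzN expz_mul; apply: sgV => //; exact: sgX.
  by move: Lx; rewrite {1}e expzD mulgA (sgMr _ sL Lq).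
have := (normalizesV (normalizesX r nt) _).1 Lr.
by rewrite conjgE mulgK.
Qed.

End IntegerPowers.

End GroupIndex.

(** * Collisions in groups of polynomial growth *)

Section PolynomialGrowth.
Local Open Scope classical_set_scope.
Local Open Scope group_scope.

Lemma exp_beats_poly (C L d : nat) : exists n, (C * (L * n).+1 ^ d < 2 ^ n)%N.
Proof.
(* At [n = 2 ^ m] it suffices that [C + (L + m) * d <= 2 ^ m]. With [m = p + p] the left side is at
   most [p + p * p], while [2 ^ m] is the product of two factors larger than [p]. *)
pose p := (2 * d + C + L.+1 * d)%N; pose m := (p + p)%N.
exists (2 ^ m)%N.
have two k : (k < 2 ^ k)%N by exact: ltn_expl.
have pos k : (0 < 2 ^ k)%N by rewrite expn_gt0.
have hL : ((L * 2 ^ m).+1 <= 2 ^ (L + m))%N.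
  rewrite expnD; have := two L; have := pos m; move: (2 ^ m)%N (2 ^ L)%N => a b.
  by nia.
have h1 : (C * (L * 2 ^ m).+1 ^ d < 2 ^ (C + (L + m) * d))%N.
  rewrite expnD expnM; have := two C; have := leq_expn d hL.
  have : (0 < (2 ^ (L + m)) ^ d)%N by rewrite expn_gt0 pos.
  move: ((_ * _).+1 ^ d)%N ((2 ^ (L + m)) ^ d)%N (2 ^ C)%N => a b c; nia.
apply: (leq_trans h1); rewrite leq_exp2l // {2}/m expnD.
have := two p; have : (2 * d + C + L.+1 * d = p)%N by [].
have -> : (m = p + p)%N by [].
by move: (2 ^ p)%N => q; nia.
Qed.

Section Collisions.
Context {G : groupType}.
Implicit Types (x y z l t : G) (H K L X : set G) (S : seq G) (bs : seq bool).

(* The product of the conjugates (l ^ b_i) ^ (t ^ i). *)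
Fixpoint twist l t bs : G :=
  if bs is b :: bs' then l ^+ b * (twist l t bs') ^ t else 1.

(** After multiplication by [t ^- size bs] the conjugations telescope to a product of factors
    [l ^+ b * t^-1], so the length is linear in [size bs]. *)
Lemma twist_ball S a c l t bs : wball S a l -> wball S c t ->
  wball S (size bs * (a + c)) (twist l t bs * t ^- size bs).
Proof.
move=> bl bt; elim: bs => [|b bs IH] /=; first by rewrite mul1g invg1.
have -> : l ^+ b * twist l t bs ^ t * t ^- (size bs).+1 =
    (l ^+ b * t^-1) * (twist l t bs * t ^- size bs).
  by rewrite conjgE expgSr invgM -!mulgA mulVKg.
rewrite mulSn; apply: ballM IH; apply: ballM; last exact: ballV.
by case: b => //; exact: ball_one.
Qed.

(** There are [2 ^ n] bit strings but only polynomially many elements of length linear in [n]. *)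
Lemma twist_collision S d l t : growth S d -> gen S l -> gen S t ->
  exists bs bs', [/\ bs != bs', size bs = size bs' & twist l t bs = twist l t bs'].
Proof.
move=> [C hC] [a bl] [c bt]; apply: contrapT => hno.
have [n hn] := exp_beats_poly C (a + c) d.
pose f (u : n.-tuple bool) := twist l t u * t ^- size u.
have := hC (n * (a + c))%N (map f (enum {: n.-tuple bool})) _ _.
rewrite size_map -cardE card_tuple card_bool => h.
have : (2 ^ n <= C * (n * (a + c)).+1 ^ d)%N.
  apply: h; last first.
    by move=> _ /mapP [u _ ->]; rewrite -{1}(size_tuple u); exact: twist_ball.
  rewrite map_inj_uniq ?enum_uniq // => u v; rewrite /f !size_tuple => /mulIg e.
  apply: contrapT => /eqP uv; apply: hno; exists u, v; split=> //.
  by rewrite !size_tuple.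
by move: hn; rewrite (mulnC n); lia.
Qed.

Fixpoint conj_list l t n : seq G :=
  if n is n'.+1 then l ^ (t ^+ n') :: conj_list l t n' else [::].

Lemma conj_listP l t n x :
  reflect (exists2 i, (i < n)%N & x = l ^ (t ^+ i)) (x \in conj_list l t n).
Proof.
elim: n => [|n IH]; first by apply: (iffP idP) => // -[].
rewrite inE; apply: (iffP orP) => [[/eqP ->|/IH [i lin ->]]|[i]].
- by exists n.
- by exists i => //; lia.
- rewrite ltnS leq_eqVlt => /orP [/eqP -> ->|lin]; first by left.
  by move=> xE; right; apply/IH; exists i.
Qed.

Lemma twist_rcons l t bs b :
  twist l t (rcons bs b) = twist l t bs * (l ^+ b) ^ (t ^+ size bs).
Proof.
elim: bs => [|c bs IH] /=; first by rewrite conj1g conjg1 mulg1 mul1g.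
by rewrite IH conjMg -conjgM -expgSr mulgA.
Qed.

Lemma twist_gen l t bs : gen (conj_list l t (size bs)) (twist l t bs).
Proof.
elim/last_ind: bs => [|bs b IH]; first exact: sg1 (sg_gen _).
rewrite twist_rcons size_rcons; apply: (sgM (sg_gen _)).
  apply: gen_min IH; first exact: sg_gen.
  by move=> x xs; apply: gen_mem; rewrite inE xs orbT.
by case: b; [apply: gen_mem; exact: mem_head|rewrite conj1g; exact: sg1 (sg_gen _)].
Qed.

(** Strip equal last bits from a colliding pair; at the last place where the strings differ, the
    collision expresses one conjugate of [l] by the earlier ones. *)
Lemma conj_stable S d l t : growth S d -> gen S l -> gen S t ->
  exists n, gen (conj_list l t n) (l ^ (t ^+ n)).
Proof.
move=> gS Sl St; have [bs [bs' [ne es et]]] := twist_collision gS Sl St.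
elim/last_ind: bs bs' ne es et => [|bs b IH] bs'.
  by case: bs' => // _ _.
case/lastP: bs' => [|bs' b']; first by rewrite size_rcons.
rewrite !size_rcons => ne [es]; rewrite !twist_rcons -es.
have [ebb|nbb] := eqVneq b b'.
  rewrite -ebb => /mulIg; apply: IH => //; apply: contraNneq ne => ->.
  by rewrite ebb.
move=> e; exists (size bs).
have s1 := twist_gen l t bs; have := twist_gen l t bs'; rewrite -es => s2.
have sG := sg_gen (conj_list l t (size bs)).
case: b b' nbb e {ne} => [] [] // _; rewrite /= expg0 conj1g mulg1 => e.
  by rewrite -(sgMl _ sG s1) e.
by rewrite -(sgMl _ sG s2) -e.
Qed.

Lemma conj_list_shift l t n u : gen (conj_list l t n) (l ^ (t ^+ n)) ->
  (forall i, (i <= n)%N -> gen u (l ^ (t ^+ i))) ->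
  forall i, (i <= n)%N -> gen u (l ^ (t ^+ i.+1)).
Proof.
move=> hn hu i; rewrite leq_eqVlt => /orP [/eqP ->|]; last exact: hu.
rewrite expgSr conjgM; move: (_ ^ _) hn => x.
have : gen (conj_list l t n) `<=` [set x | gen u (x ^ t)].
  apply: gen_min => [|x' /conj_listP [j jn ->]] /=.
    apply/is_subgroupP; split; first by rewrite /= conj1g; exact: sg1 (sg_gen _).
    move=> y z /= hy hz; rewrite conjMg conjVg; apply: sgM (sg_gen _) hy _.
    exact: sgV (sg_gen _) hz.
  by rewrite -conjgM -expgSr; exact: hu.
by apply.
Qed.

(** [conj_stable] gives stability in one direction only; it is applied to [t] and to [t^-1], and the
    two finite lists are joined. *)
Lemma conj_stable_fg S d l t : growth S d -> gen S l -> gen S t ->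
  exists T : seq G, [/\ normalizes t (gen T), l \in T &
    forall x, x \in T -> exists i : int, x = l ^ expz t i].
Proof.
move=> gS Sl St; have [n hn] := conj_stable gS Sl St.
have [m hm] := conj_stable gS Sl (sgV (sg_gen S) St).
pose T := conj_list l t n.+1 ++ conj_list l t^-1 m.+1.
have g1 i : (i <= n)%N -> gen T (l ^ (t ^+ i)).
  by move=> lin; apply: gen_mem; rewrite mem_cat; apply/orP; left; apply/conj_listP; exists i.
have g2 i : (i <= m)%N -> gen T (l ^ (t^-1 ^+ i)).
  by move=> lin; apply: gen_mem; rewrite mem_cat; apply/orP; right; apply/conj_listP; exists i.
have TP x : x \in T -> (exists2 i, (i <= n)%N & x = l ^ (t ^+ i)) \/
    (exists2 i, (i <= m)%N & x = l ^ (t^-1 ^+ i)).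
  by rewrite mem_cat => /orP [/conj_listP|/conj_listP]; auto.
exists T; split.
- rewrite -gen_subgroup_seq; apply: normalizes_gen => x /= /TP; rewrite gen_subgroup_seq.
    move=> [[i lin ->]|[[|i] lin ->]].
    + by rewrite -conjgM -expgSr; exact: conj_list_shift hn g1 i lin.
    + by rewrite conjg1; exact: (conj_list_shift hn g1 (leq0n _)).
    + by rewrite -conjgM expgSr mulgVK; apply: g2; lia.
  move=> [[[|i] lin ->]|[i lin ->]].
  + by rewrite conjg1; exact: (conj_list_shift hm g2 (leq0n _)).
  + by rewrite -conjgM expgSr mulgK; apply: g1; lia.
  + by rewrite -conjgM -expgSr; exact: conj_list_shift hm g2 i lin.
- by rewrite mem_cat; apply/orP; left; apply/conj_listP; exists 0%N => //; rewrite conjg1.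
- move=> x /TP [[i _ ->]|[i _ ->]]; first by exists (Posz i).
  by exists (- Posz i)%R; rewrite expz_opp expVgn.
Qed.

(* The kernel of a map onto the integers is generated by the t-conjugates of
   finitely many elements, and each orbit is captured by finitely many of them. *)
Lemma ext_kernel_fg S d L t : growth S d -> is_subgroup L -> normalizes t L ->
  gen S = ext L t -> (forall i : int, L (expz t i) -> i = 0%R) ->
  exists T : seq G, L = gen T.
Proof.
move=> gS sL nt eS inj.
have St : gen S t by rewrite eS; exact: ext_mem.
have [T [nT TL hT]] : exists T : seq G, [/\ normalizes t (gen T),
    gen T `<=` L & forall s, s \in S -> ext (gen T) t s].
  have : forall s, s \in S -> gen S s by move=> s; exact: gen_mem.
  elim: {-2}S => [|s r IH] hr.
    exists [::]; split=> //; last exact: gen_min.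
    by rewrite -gen_subgroup_seq; exact: normalizes_gen.
  have [|T [nT TL hT]] := IH; first by move=> x xr; apply: hr; rewrite inE xr orbT.
  have := hr s (mem_head _ _); rewrite eS => -[j Lj].
  have Sj : gen S (s * expz t j).
    by apply: (sgM (sg_gen _)); [exact/hr/mem_head|apply: sg_expz=> //; exact: sg_gen].
  (* The generator [s] differs by a power of [t] from an element of [L]; a finite part of the
     [t]-orbit of that element is adjoined. *)
  have [U [nU lU hU]] := conj_stable_fg gS Sj St.
  have sub1 : gen T `<=` gen (T ++ U).
    by apply: gen_min (sg_gen _) _ => x xT; apply: gen_mem; rewrite mem_cat xT.
  have sub2 : gen U `<=` gen (T ++ U).
    by apply: gen_min (sg_gen _) _ => x xT; apply: gen_mem; rewrite mem_cat xT orbT.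
  exists (T ++ U); split.
  - rewrite -gen_subgroup_seq; apply: normalizes_gen => x;
      rewrite /= mem_cat gen_subgroup_seq => /orP [/gen_mem h|/gen_mem h].
    + by apply: sub1; apply: (nT _).1.
    + by apply: sub2; apply: (nU _).1.
    + by apply: sub1; apply: (normalizesV nT _).1.
    + by apply: sub2; apply: (normalizesV nU _).1.
  - apply: gen_min => // x; rewrite mem_cat => /orP [/gen_mem /TL //|/hU [i ->]].
    exact: (normalizes_expz _ nt _).1.
  - move=> x; rewrite inE => /orP [/eqP ->|/hT [i hi]].
      by exists j; apply: sub2; exact: gen_mem.
    by exists i; exact: sub1.
exists T; apply/seteqP; split=> // x Lx.
have sub : ext L t `<=` ext (gen T) t.
  by rewrite -eS; apply: gen_min => //; exact: sg_ext (sg_gen _) nT.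
have [j hj] := sub x (ext_sub t Lx).
have : L (expz t j) by rewrite -(sgMl _ sL Lx); exact: TL.
by move/inj=> j0; move: hj; rewrite j0 mulg1.
Qed.

(** The products [t ^+ i * y] with [i <= n] and [y] in the [n]-ball of [T] are distinct and of
    length O(n) in [S]; the [n.+1] choices of [i] account for the lost degree. *)
Lemma ext_kernel_growth S T d L t : growth S d.+1 -> is_subgroup L ->
  gen S = ext L t -> (forall i : int, L (expz t i) -> i = 0%R) ->
  L = gen T -> normalizes t L -> growth T d.
Proof.
move=> [C hC] sL eS inj eT nt.
have [a ha] : exists a, wball S a t by rewrite -[exists _, _]/(gen S t) eS; exact: ext_mem.
have [|b hb] := @ball_bound _ S T.
  by move=> x xT; rewrite eS; apply: ext_sub; rewrite eT; exact: gen_mem.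
exists (C * (a + b).+1 ^ d.+1)%N => n s us hs.
have := hC (a * n + b * n)%N [seq t ^+ i * y | i <- iota 0 n.+1, y <- s] _ _.
rewrite size_allpairs size_iota => h.
have {}h : (n.+1 * size s <= C * (a * n + b * n).+1 ^ d.+1)%N.
  apply: h; last first.
    move=> z /allpairsP [[i y] []]; rewrite mem_iota => hi /= ys ->; apply: ballM.
      by apply: ball_mono (ballX i ha); rewrite leq_mul2l; move: hi => /=; lia.
    exact: ball_sub hb (hs _ ys).
  apply: allpairs_uniq => //; first exact: iota_uniq.
  move=> p1 p2 /allpairsP h1 /allpairsP h2 e.
  move: h1 h2 e => [[i1 y1] /= [_ ys ->]] [[j1 z1] /= [_ zs ->]] /= e.
  have Lyz : L (expz t (Posz j1 - Posz i1)%R).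
    rewrite GRing.addrC expzD expzN /= -(mulgK z1 (t ^+ j1)) -e -!mulgA mulKg.
    by rewrite eT; apply: (sgM (sg_gen _)) (ball_gen (hs _ ys)) (sgV (sg_gen _) (ball_gen (hs _ zs))).
  have ij : i1 = j1 by have := inj _ Lyz; lia.
  by move: e; rewrite ij => /mulgI ->.
have : (n.+1 * size s <= n.+1 * (C * (a + b).+1 ^ d.+1 * n.+1 ^ d))%N.
  apply: (leq_trans h); rewrite mulnCA -mulnA leq_mul2l; apply/orP; right.
  apply: (@leq_trans (((a + b).+1 * n.+1) ^ d.+1)%N); first by apply: leq_expn; nia.
  by rewrite expnMn [(n.+1 ^ d.+1)%N]expnS; lia.
by rewrite leq_pmul2l.
Qed.

Lemma growth0_finite S : growth S 0 -> fidx [set (1 : G)] (gen S).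
Proof.
move=> [C hC]; apply: contrapT => /(not_fidx_free C.+1 (@sg_one G)) [s [ss sS sf]].
have [n hn] := ball_bound sS.
have := hC n s (coset_free_uniq (@sg_one G) sf) hn.
by rewrite ss muln1 ltnn.
Qed.

End Collisions.

End PolynomialGrowth.

(** * Infinite abelian sections *)

Section AbelianSections.
Local Open Scope classical_set_scope.
Local Open Scope group_scope.

Section AbelianChain.
Context {G : groupType}.
Variables (K H : set G).
Hypotheses (sK : is_subgroup K) (sH : is_subgroup H) (KH : K `<=` H).
Hypothesis (HK : forall x y, H x -> H y -> K [~ x, y]).

Fixpoint chain (s : seq G) : set G := if s is a :: s' then ext (chain s') a else K.

Lemma between_normalizes (L : set G) t : is_subgroup L -> K `<=` L -> L `<=` H -> H t ->
  normalizes t L.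
Proof.
move=> sL KL LH Ht x.
have aux u y : H u -> L y -> L (y ^ u).
  move=> Hu Ly; rewrite -[y ^ u](mulVKg y) -commgEl; apply: sgM => //.
  by apply: KL; apply: HK => //; exact: LH.
split; first exact: aux.
by move/(aux t^-1 _ (sgV sH Ht)); rewrite conjgK.
Qed.

Lemma chainP s : (forall x, x \in s -> H x) ->
  [/\ is_subgroup (chain s), K `<=` chain s, chain s `<=` H &
    forall x, x \in s -> chain s x].
Proof.
elim: s => [|a s IH] hs; first by split.
have [|s1 s2 s3 s4] := IH; first by move=> x xs; apply: hs; rewrite inE xs orbT.
have Ha : H a := hs a (mem_head _ _).
have na := between_normalizes s1 s2 s3 Ha.
split => /=; first exact: sg_ext.
- by move=> x /s2; exact: ext_sub.
- exact: ext_min.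
- by move=> x; rewrite inE => /orP [/eqP ->|/s4]; [exact: ext_mem|exact: ext_sub].
Qed.

(** Take the outermost step of infinite index in the chain: the steps above it have finite index,
    and at that step no nontrivial power of the adjoined element lies in the previous term. *)
Lemma chain_infinite s : (forall x, x \in s -> H x) -> ~ fidx K (chain s) ->
  exists L t, [/\ is_subgroup L, K `<=` L, L `<=` H, H t &
    (forall i : int, L (expz t i) -> i = 0%R) /\ fidx (ext L t) (chain s)].
Proof.
elim: s => [|a s IH] hs nf; first by case: nf; exact: fidx_refl.
have hs' x : x \in s -> H x by move=> xs; apply: hs; rewrite inE xs orbT.
have [s1 s2 s3 s4] := chainP hs'.
have Ha : H a := hs a (mem_head _ _).
have na := between_normalizes s1 s2 s3 Ha.
have [fi|nfi] := pselect (fidx (chain s) (chain (a :: s))).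
  have sc : is_subgroup (chain (a :: s)) by case: (chainP hs).
  have [|L [t [sL KL LH Ht [inj ft]]]] := IH hs'.
    by move=> f; apply: nf; exact: fidx_trans f fi.
  exists L, t; split=> //; split=> //; apply: fidx_trans ft fi => //.
exists (chain s), a; split=> //; split; last exact: fidx_refl.
move=> i Li; apply: contrapT => i0; apply: nfi => /=.
apply: (@ext_fidx _ _ _ s1 na `|i|%N); first by lia.
by case: i Li {i0} => n // /(sgV s1); rewrite invgK.
Qed.

Lemma abelian_infinite S : H = gen S -> ~ fidx K H ->
  exists L t, [/\ is_subgroup L, K `<=` L, L `<=` H, H t &
    [/\ (forall i : int, L (expz t i) -> i = 0%R), normalizes t L & fidx (ext L t) H]].
Proof.
move=> eS nf; have hS x : x \in S -> H x by rewrite eS; exact: gen_mem.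
have [s1 s2 s3 s4] := chainP hS.
have e : chain S = H.
  by apply/seteqP; split=> //; rewrite eS; exact: gen_min.
have [|L [t [sL KL LH Ht [inj]]]] := chain_infinite hS; first by rewrite e.
rewrite e => ft; exists L, t; split=> //; split=> //.
exact: between_normalizes.
Qed.

End AbelianChain.

End AbelianSections.

(** * Real spectral theorem *)

Section RealSpectral.
Import complex.
Import Order.TTheory GRing.Theory Num.Theory.
Local Open Scope ring_scope.

Section Dot.
Variable R : rcfType.

Definition dot m n (A B : 'M[R]_(m, n)) : R := \sum_i \sum_j A i j * B i j.

Lemma dot_tr m n (A B : 'M[R]_(m, n)) : dot A B = \tr (A *m B^T).
Proof.
rewrite /dot /mxtrace; apply: eq_bigr => i _; rewrite !mxE.
by apply: eq_bigr => j _; rewrite mxE.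
Qed.

Lemma dotC m n (A B : 'M[R]_(m, n)) : dot A B = dot B A.
Proof. by apply: eq_bigr => i _; apply: eq_bigr => j _; rewrite mulrC. Qed.

Lemma dotDl m n (A B C : 'M[R]_(m, n)) : dot (A + B) C = dot A C + dot B C.
Proof.
rewrite -big_split; apply: eq_bigr => i _; rewrite -big_split.
by apply: eq_bigr => j _; rewrite mxE mulrDl.
Qed.

Lemma dotZl m n a (A C : 'M[R]_(m, n)) : dot (a *: A) C = a * dot A C.
Proof.
rewrite /dot mulr_sumr; apply: eq_bigr => i _; rewrite mulr_sumr.
by apply: eq_bigr => j _; rewrite mxE mulrA.
Qed.

Lemma dotNl m n (A C : 'M[R]_(m, n)) : dot (- A) C = - dot A C.
Proof. by rewrite -scaleN1r dotZl mulN1r. Qed.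

Lemma dotBl m n (A B C : 'M[R]_(m, n)) : dot (A - B) C = dot A C - dot B C.
Proof. by rewrite dotDl dotNl. Qed.

Lemma dotDr m n (A B C : 'M[R]_(m, n)) : dot C (A + B) = dot C A + dot C B.
Proof. by rewrite dotC dotDl !(dotC C). Qed.

Lemma dotZr m n a (A C : 'M[R]_(m, n)) : dot C (a *: A) = a * dot C A.
Proof. by rewrite dotC dotZl dotC. Qed.

Lemma dotBr m n (A B C : 'M[R]_(m, n)) : dot C (A - B) = dot C A - dot C B.
Proof. by rewrite dotC dotBl !(dotC C). Qed.

Lemma dot0l m n (A : 'M[R]_(m, n)) : dot 0 A = 0.
Proof. by rewrite -(scale0r A) dotZl mul0r. Qed.

Lemma dot_suml m n I (r : seq I) (P : pred I) (F : I -> 'M[R]_(m, n)) A :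
  dot (\sum_(i <- r | P i) F i) A = \sum_(i <- r | P i) dot (F i) A.
Proof.
by elim/big_rec2: _ => [|i x y _ <-]; [exact: dot0l|rewrite dotDl].
Qed.

Lemma dot_sumr m n I (r : seq I) (P : pred I) (F : I -> 'M[R]_(m, n)) A :
  dot A (\sum_(i <- r | P i) F i) = \sum_(i <- r | P i) dot A (F i).
Proof. by rewrite dotC dot_suml; apply: eq_bigr => i _; rewrite dotC. Qed.

Lemma dot_ge0 m n (A : 'M[R]_(m, n)) : 0 <= dot A A.
Proof. by apply: sumr_ge0 => i _; apply: sumr_ge0 => j _; rewrite -expr2 sqr_ge0. Qed.

Lemma dot_eq0 m n (A : 'M[R]_(m, n)) : (dot A A == 0) = (A == 0).
Proof.
apply/eqP/eqP => [h|->]; last exact: dot0l.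
apply/matrixP => i j; rewrite mxE; apply/eqP; rewrite -sqrf_eq0 expr2.
have sq0 k l : 0 <= A k l * A k l by rewrite -expr2 sqr_ge0.
have h1 : \sum_j A i j * A i j = 0.
  by apply: (psumr_eq0P _ h) => // k _; apply: sumr_ge0.
by apply/eqP; apply: (psumr_eq0P _ h1).
Qed.

Lemma dot_gt0 m n (A : 'M[R]_(m, n)) : A != 0 -> 0 < dot A A.
Proof. by move=> A0; rewrite lt_neqAle dot_ge0 eq_sym dot_eq0 A0. Qed.

Lemma dot_trmx m n (A B : 'M[R]_(m, n)) : dot A^T B^T = dot A B.
Proof.
rewrite /dot exchange_big; apply: eq_bigr => i _; apply: eq_bigr => j _.
by rewrite !mxE.
Qed.

Lemma dot_mulmxl m n p (U : 'M[R]_(m, n)) (A : 'M[R]_(n, p)) (B : 'M[R]_(m, p)) :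
  dot (U *m A) B = dot A (U^T *m B).
Proof. by rewrite !dot_tr -mulmxA mxtrace_mulC trmx_mul trmxK mulmxA. Qed.

Lemma dot_mulmxr m n p (U : 'M[R]_(n, p)) (A : 'M[R]_(m, n)) (B : 'M[R]_(m, p)) :
  dot (A *m U) B = dot A (B *m U^T).
Proof. by rewrite -dot_trmx trmx_mul dot_mulmxl -dot_trmx !trmxK trmx_mul trmxK. Qed.

Lemma dot_cauchy m n (A B : 'M[R]_(m, n)) : dot A B ^+ 2 <= dot A A * dot B B.
Proof.
have [->|B0] := eqVneq B 0; first by rewrite dotC !dot0l expr0n mulr0.
have b0 := dot_gt0 B0; have := dot_ge0 (dot B B *: A - dot A B *: B).
rewrite !(dotBl, dotBr, dotZl, dotZr) [dot B A]dotC.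
set p := dot A A; set q := dot B B; set s := dot A B => h.
rewrite -subr_ge0 -(pmulr_rge0 _ b0); apply: (le_trans h).
by rewrite le_eqVlt; apply/orP; left; apply/eqP; rewrite -/q; ring.
Qed.

End Dot.

Section Spectral.
Variable R : rcfType.

(* Splitting a complex eigenvector into real and imaginary parts. *)
Lemma symmetric_eigenvalue n (A : 'M[R]_n.+1) : A^T = A ->
  exists a (v : 'rV[R]_n.+1), v != 0 /\ v *m A = a *: v.
Proof.
move=> sA; pose B : 'M[R[i]]_n.+1 := map_mx (real_complex R) A.
have [z /eigenvalueP [v vB v0]] := eigenvalue_closed B (ltn0Sn n).
pose x := map_mx (@complex.Re R) v; pose y := map_mx (@complex.Im R) v.
pose a := complex.Re z; pose b := complex.Im z.
have xA : x *m A = a *: x - b *: y.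
  apply/rowP => j; have := congr1 (fun u : 'rV[R[i]]_n.+1 => complex.Re (u 0 j)) vB.
  rewrite !mxE raddf_sum /= => h.
  have <- : complex.Re (z * v 0 j) = a * complex.Re (v 0 j) - b * complex.Im (v 0 j).
    by rewrite /a /b; case: (z) => ? ?; case: (v 0 j) => ? ?.
  rewrite -h; apply: eq_bigr => k _; rewrite !mxE.
  by case: (v 0 k) => p q; simpc.
have yA : y *m A = b *: x + a *: y.
  apply/rowP => j; have := congr1 (fun u : 'rV[R[i]]_n.+1 => complex.Im (u 0 j)) vB.
  rewrite !mxE raddf_sum /= => h.
  have <- : complex.Im (z * v 0 j) = b * complex.Re (v 0 j) + a * complex.Im (v 0 j).
    rewrite /a /b; case: (z) => ? ?; case: (v 0 j) => ? ? /=; ring.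
  rewrite -h; apply: eq_bigr => k _; rewrite !mxE.
  by case: (v 0 k) => p q; simpc.
have b0 : b = 0.
  have : dot (x *m A) y = dot x (y *m A) by rewrite dot_mulmxr sA.
  rewrite xA yA !(dotBl, dotDr, dotZl, dotZr) => h.
  have {}h : b * (dot x x + dot y y) = 0.
    have := h; lra.
  move/eqP: h; rewrite mulf_eq0 => /orP [/eqP //|].
  rewrite paddr_eq0 ?dot_ge0 // !dot_eq0 => /andP [/eqP x0 /eqP y0].
  case/negP: v0; apply/eqP/rowP => j.
  have := congr1 (fun u : 'rV_n.+1 => u 0 j) x0.
  have := congr1 (fun u : 'rV_n.+1 => u 0 j) y0; rewrite !mxE.
  by case: (v 0 j) => p q /= -> ->.
rewrite b0 scale0r subr0 in xA; rewrite b0 scale0r add0r in yA.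
have [x0|x0] := eqVneq x 0; last by exists a, x.
exists a, y; split=> //; apply: contra v0 => /eqP y0; apply/eqP/rowP => j.
have := congr1 (fun u : 'rV_n.+1 => u 0 j) x0.
have := congr1 (fun u : 'rV_n.+1 => u 0 j) y0; rewrite !mxE.
by case: (v 0 j) => p q /= -> ->.
Qed.

Lemma dot_row n (u v : 'rV[R]_n) : u *m v^T = (dot u v)%:M.
Proof.
apply/matrixP => i j; rewrite !ord1 !mxE eqxx mulr1n /dot big_ord1.
by apply: eq_bigr => k _; rewrite mxE.
Qed.

(** The reflection in the hyperplane orthogonal to [e - e0]; a symmetric involution is its own
    transpose and inverse, so conjugation by it preserves symmetry. *)
Lemma householder n (e0 e : 'rV[R]_n) : dot e0 e0 = 1 -> dot e e = 1 ->
  exists H : 'M[R]_n, [/\ H^T = H, H *m H = 1%:M & e0 *m H = e].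
Proof.
move=> n0 n1; have [<-|ne] := eqVneq e0 e.
  by exists 1%:M; rewrite trmx1 !mulmx1.
pose w := e - e0; pose c := 2 / dot w w.
have w0 : w != 0 by rewrite subr_eq0 eq_sym.
have dw : dot w w != 0 by rewrite dot_eq0.
exists (1%:M - c *: (w^T *m w)); split.
- by rewrite linearB /= trmx1 linearZ /= trmx_mul trmxK.
- rewrite mulmxBr mulmx1 -scalemxAr mulmxBl mul1mx -scalemxAl.
  rewrite -mulmxA (mulmxA w) dot_row mul_scalar_mx -scalemxAr.
  set X := w^T *m w; rewrite scalerBr !scalerA opprB addrA.
  have -> : c * c * dot w w = c + c by rewrite -mulrA /c mulfVK // mulr_natr mulr2n.
  by rewrite scalerDl addrA subrK addrK.
- rewrite mulmxBr mulmx1 -scalemxAr mulmxA dot_row mul_scalar_mx scalerA.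
  have -> : c * dot e0 w = -1.
    have e1 : dot w w = 2 - 2 * dot e0 e.
      by rewrite /w !(dotBl, dotBr) n0 n1 (dotC e); ring.
    have e2 : dot e0 w = - (dot w w / 2).
      by rewrite e1 /w dotBr n0; field.
    by rewrite e2 /c; field.
  by rewrite scaleN1r opprK addrC subrK.
Qed.

Theorem symmetric_spectral n (A : 'M[R]_n) : A^T = A ->
  exists (O : 'M[R]_n) (d : 'rV[R]_n), O *m O^T = 1%:M /\ A = O^T *m diag_mx d *m O.
Proof.
elim: n A => [|n IH] A sA.
  by exists 1%:M, 0; split; apply/matrixP => -[].
have [a [v [v0 vA]]] := symmetric_eigenvalue sA.
pose e : 'rV_n.+1 := (Num.sqrt (dot v v))^-1 *: v.
have ee : dot e e = 1.
  rewrite dotZl dotZr mulrA -expr2 exprVn sqr_sqrtr ?dot_ge0 // mulVf //.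
  by rewrite dot_eq0.
have eA : e *m A = a *: e by rewrite -scalemxAl vA !scalerA mulrC.
(* Reflecting the eigenvector to the first basis row makes the first row of the conjugate a multiple
   of [e0]; by symmetry the conjugate is block diagonal. *)
pose e0 : 'rV[R]_(1 + n) := row_mx 1%:M 0.
have e00 : dot e0 e0 = 1.
  by rewrite dot_tr tr_row_mx mul_row_col trmx0 mulmx0 addr0 trmx1 mulmx1 mxtrace1.
have [H [sH HH e0H]] := householder e00 ee.
pose B : 'M[R]_(1 + n) := H *m A *m H.
have sB : B^T = B by rewrite !trmx_mul sH sA mulmxA.
have e0B : e0 *m B = a *: e0.
  by rewrite !mulmxA e0H eA -scalemxAl -e0H -mulmxA HH mulmx1.
have BE : B = block_mx a%:M 0 0 (drsubmx B).
  move: e0B; rewrite -{1 2}[B]submxK mul_row_block !mul1mx !mul0mx !addr0.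
  rewrite scale_row_mx scaler0 scalemx1 => /eq_row_mx [-> u0].
  rewrite u0; congr (block_mx _ _ _ _).
  by rewrite -[dlsubmx B]trmxK trmx_dlsub sB u0 trmx0.
have sD : (drsubmx B)^T = drsubmx B by rewrite trmx_drsub sB.
have [O [d [OO OD]]] := IH _ sD.
pose P : 'M[R]_(1 + n) := block_mx 1%:M 0 0 O.
have PP : P *m P^T = 1%:M.
  rewrite tr_block_mx mulmx_block !trmx0 !trmx1 !mulmx0 !mul0mx !mulmx1 !addr0 !add0r OO.
  by rewrite -scalar_mx_block.
exists (P *m H), (row_mx a%:M d); split.
  by rewrite trmx_mul mulmxA -(mulmxA P) sH HH mulmx1 PP.
have -> : A = H *m B *m H.
  by rewrite /B !mulmxA HH mul1mx -mulmxA HH mulmx1.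
suff -> : B = P^T *m diag_mx (row_mx a%:M d) *m P by rewrite trmx_mul sH !mulmxA.
rewrite {1}BE diag_mx_row tr_block_mx !mulmx_block !trmx0 !trmx1.
rewrite !(mulmx0, mul0mx, mulmx1, mul1mx, addr0, add0r) -OD.
congr (block_mx _ _ _ _).
by apply/matrixP => i j; rewrite !ord1 !mxE eqxx.
Qed.

End Spectral.

End RealSpectral.

(** * Entropy of random walks *)

Section RandomWalk.
Import Order.TTheory GRing.Theory Num.Theory.
Local Open Scope ring_scope.

Section SumCauchy.
Variables (R : realFieldType) (T : finType).

Lemma sum_cauchy (f g : T -> R) :
  (\sum_x f x * g x) ^+ 2 <= (\sum_x f x ^+ 2) * (\sum_x g x ^+ 2).
Proof.
set p := \sum_x f x ^+ 2; set q := \sum_x g x ^+ 2; set s := \sum_x f x * g x.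
have q0 : 0 <= q by apply: sumr_ge0 => x _; rewrite sqr_ge0.
have [q1|q1] := ltP 0 q; last first.
  have {q1}q1 : q = 0 by apply/eqP; rewrite eq_le q1.
  have gx x : g x = 0.
    apply/eqP; rewrite -sqrf_eq0; apply/eqP.
    apply: (psumr_eq0P _ q1) => // y _; exact: sqr_ge0.
  rewrite /s big1 ?expr0n ?mulr_ge0 // => [|x _]; last by rewrite gx mulr0.
  by apply: sumr_ge0 => x _; rewrite sqr_ge0.
rewrite -subr_ge0 -(pmulr_rge0 _ q1).
have : 0 <= \sum_x (q * f x - s * g x) ^+ 2 by apply: sumr_ge0 => x _; rewrite sqr_ge0.
have e c d : \sum_x (c * f x - d * g x) ^+ 2 = c ^+ 2 * p - 2 * c * d * s + d ^+ 2 * q.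
  rewrite /p /q /s !mulr_sumr -sumrB -big_split /=; apply: eq_bigr => x _; ring.
rewrite e.
by move=> h; apply: (le_trans h); rewrite le_eqVlt; apply/orP; left; apply/eqP; ring.
Qed.

End SumCauchy.

Section Walk.
Variables (R : realType) (Q : finGroupType) (A : seq Q).
Hypotheses (A1 : (1%g : Q) \in A) (AV : perm_eq [seq a^-1%g | a <- A] A).

(** The law of a product of [n] uniform steps. [A] is a list with multiplicities, since distinct
    letters of the group may coincide in the quotient. *)
Fixpoint walk (n : nat) : Q -> R :=
  if n is n'.+1 then fun x => (size A)%:R^-1 * \sum_(a <- A) walk n' (a^-1 * x)%g
  else fun x => (x == 1%g)%:R.

Lemma sizeA_gt0 : 0 < (size A)%:R :> R.
Proof. by rewrite ltr0n; case: (A) A1. Qed.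

Lemma sizeA_neq0 : (size A)%:R != 0 :> R.
Proof. by rewrite gt_eqF ?sizeA_gt0. Qed.

Lemma avg_const (c : R) : (size A)%:R^-1 * \sum_(a <- A) c = c.
Proof. by rewrite big_const_seq count_predT iter_addr_0 -[c *+ _]mulr_natl mulKf ?sizeA_neq0. Qed.

Lemma avg_constv (V : lmodType R) (c : V) : (size A)%:R^-1 *: \sum_(a <- A) c = c.
Proof.
by rewrite big_const_seq count_predT iter_addr_0 -[c *+ _]scaler_nat scalerA mulVf ?scale1r ?sizeA_neq0.
Qed.

Lemma sumA_inv (V : nmodType) (F : Q -> V) :
  \sum_(a <- A) F (a^-1)%g = \sum_(a <- A) F a.
Proof. by rewrite -[RHS](perm_big _ AV) big_map. Qed.

Lemma walk_ge0 n x : 0 <= walk n x.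
Proof.
elim: n x => [|n IH] x /=; first by rewrite ler0n.
by rewrite mulr_ge0 ?invr_ge0 ?ler0n // sumr_ge0.
Qed.

Lemma sum_shift (V : nmodType) (a : Q) (F : Q -> V) : \sum_x F (a * x)%g = \sum_x F x.
Proof. by rewrite [RHS](reindex_inj (mulgI a)). Qed.

Lemma walk_sum n : \sum_x walk n x = 1.
Proof.
elim: n => [|n IH] /=.
  by rewrite (bigD1 1%g) //= eqxx big1 ?addr0 // => x /negbTE ->.
rewrite -mulr_sumr exchange_big /=.
rewrite (eq_bigr (fun=> 1)) ?avg_const // => a _.
by rewrite (sum_shift a^-1%g (walk n)).
Qed.

Lemma walk_le n a x : a \in A -> walk n (a^-1 * x)%g <= (size A)%:R * walk n.+1 x.
Proof.
move=> aA /=; rewrite mulVKf ?sizeA_neq0 // (big_rem a aA) /= lerDl.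
by apply: sumr_ge0 => b _; exact: walk_ge0.
Qed.

Definition entropy n : R := \sum_x - (walk n x * ln (walk n x)).

Lemma ln_sqrt (x : R) : ln (Num.sqrt x) = ln x / 2.
Proof.
have [x0|x0] := leP x 0; first by rewrite (ler0_sqrtr x0) !ln0 // mul0r.
rewrite -[in RHS](sqr_sqrtr (ltW x0)) expr2 lnM ?posrE ?sqrtr_gt0 //.
by field.
Qed.

(** This is [ln x <= x - 1] at [x = sqrt q / sqrt p]. Summed over two probability densities, the
    lower bound becomes the squared Hellinger distance. *)
Lemma relative_entropy_hellinger (p q : R) : 0 <= p -> 0 <= q -> (q = 0 -> p = 0) ->
  p * (ln p - ln q) >= 2 * p - 2 * (Num.sqrt p * Num.sqrt q).
Proof.
move=> p0 q0 qp; have [->|pn] := eqVneq p 0.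
  by rewrite sqrtr0 !(mul0r, mulr0) subr0.
have pp : 0 < p by rewrite lt_neqAle eq_sym pn.
have pq : 0 < q by rewrite lt_neqAle q0 andbT eq_sym; apply: contraNneq pn => /qp /eqP.
set a := Num.sqrt p; set b := Num.sqrt q.
have a0 : 0 < a by rewrite sqrtr_gt0.
have b0 : 0 < b by rewrite sqrtr_gt0.
have pE : p = a ^+ 2 by rewrite sqr_sqrtr.
have h : ln b - ln a <= b / a - 1.
  rewrite -ln_div ?posrE // -[X in ln X](subrK 1) addrC.
  by apply: le_ln1Dx; rewrite ltrBDr addNr divr_gt0.
have e : ln p - ln q = - 2 * (ln b - ln a) by rewrite !ln_sqrt; field.
rewrite e; have : 2 * p * (ln b - ln a) <= 2 * p * (b / a - 1).
  by rewrite ler_wpM2l // mulr_ge0.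
have -> : 2 * p * (b / a - 1) = 2 * (a * b) - 2 * p.
  by rewrite pE; field; rewrite gt_eqF.
move=> h2; lra.
Qed.

(** [walk n.+1] is the average of the translates of [walk n], which all have the same entropy; the
    increment is therefore the mean relative entropy of the translates with respect to their
    average. *)
Lemma entropy_incr n :
  (size A)%:R^-1 * (\sum_(a <- A) \sum_x
    (Num.sqrt (walk n (a^-1 * x)%g) - Num.sqrt (walk n.+1 x)) ^+ 2)
  <= entropy n.+1 - entropy n.
Proof.
have -> : entropy n.+1 - entropy n = (size A)%:R^-1 * \sum_(a <- A) \sum_x
    walk n (a^-1 * x)%g * (ln (walk n (a^-1 * x)%g) - ln (walk n.+1 x)).
  have e1 : entropy n.+1 = - ((size A)%:R^-1 * \sum_(a <- A) \sum_x
      walk n (a^-1 * x)%g * ln (walk n.+1 x)).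
    rewrite exchange_big mulr_sumr -sumrN; apply: eq_bigr => x _.
    by rewrite -mulr_suml mulrA.
  have e2 : entropy n = - ((size A)%:R^-1 * \sum_(a <- A) \sum_x
      walk n (a^-1 * x)%g * ln (walk n (a^-1 * x)%g)).
    rewrite (eq_bigr (fun=> - entropy n)).
      by rewrite avg_const opprK.
    move=> a _; rewrite (sum_shift a^-1%g (fun x => walk n x * ln (walk n x))).
    by rewrite /entropy sumrN opprK.
  rewrite e1 e2 opprK addrC -mulrBr -sumrB; congr (_ * _).
  apply: eq_bigr => a _; rewrite -sumrB; apply: eq_bigr => x _.
  by rewrite mulrBr.
rewrite ler_wpM2l ?invr_ge0 ?ler0n // !big_seq; apply: ler_sum => a aA.
pose p x := walk n (a^-1 * x)%g; pose q x := walk n.+1 x.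
have -> : \sum_x (Num.sqrt (p x) - Num.sqrt (q x)) ^+ 2 =
    \sum_x (2 * p x - 2 * (Num.sqrt (p x) * Num.sqrt (q x))).
  have sp : \sum_x p x = 1 by rewrite (sum_shift a^-1%g (walk n)) walk_sum.
  have sq : \sum_x q x = 1 by rewrite walk_sum.
  have : \sum_x (p x + q x - 2 * (Num.sqrt (p x) * Num.sqrt (q x))) =
     \sum_x (2 * p x - 2 * (Num.sqrt (p x) * Num.sqrt (q x))).
    have s2 : \sum_x 2 * p x = 2 by rewrite -mulr_sumr sp mulr1.
    by rewrite !sumrB big_split /= s2 sp sq.
  move=> <-; apply: eq_bigr => x _; rewrite sqrrB !sqr_sqrtr ?walk_ge0 //.
  rewrite -mulr_natl; ring.
apply: ler_sum => x _; apply: relative_entropy_hellinger; rewrite ?walk_ge0 //.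
move=> q0; apply/eqP; rewrite eq_le walk_ge0 andbT.
by apply: (le_trans (walk_le n x aA)); rewrite -/(q x) q0 mulr0.
Qed.

(** Gibbs' inequality against the uniform distribution on [T]. *)
Lemma entropy_le n (T : {set Q}) : (forall x, walk n x != 0 -> x \in T) ->
  entropy n <= ln (#|T|%:R : R).
Proof.
move=> hT; have T0 : (0 < #|T|)%N.
  rewrite card_gt0; apply/set0Pn.
  have [x xn] : exists x, walk n x != 0.
    apply: contrapT => h; have := walk_sum n; rewrite big1 => [/eqP|x _].
      by rewrite eq_sym oner_eq0.
    by apply: contrapT => /eqP hx; apply: h; exists x.
  by exists x; exact: hT.
have N0 : 0 < #|T|%:R :> R by rewrite ltr0n.
have h x : - (walk n x * ln (walk n x)) - walk n x * ln (#|T|%:R) <=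
    (x \in T)%:R / #|T|%:R - walk n x.
  have [->|wn] := eqVneq (walk n x) 0.
    by rewrite !(mul0r, oppr0, addr0) divr_ge0 ?ler0n.
  have w0 : 0 < walk n x by rewrite lt_neqAle eq_sym wn walk_ge0.
  rewrite hT // mul1r.
  have : ln ((walk n x * #|T|%:R)^-1) <= (walk n x * #|T|%:R)^-1 - 1.
    rewrite -[X in ln X](subrK 1) addrC.
    by apply: le_ln1Dx; rewrite ltrBDr addNr invr_gt0 mulr_gt0.
  rewrite lnV ?posrE ?mulr_gt0 // lnM ?posrE // => h.
  have := ler_wpM2l (ltW w0) h.
  have -> : walk n x * ((walk n x * #|T|%:R)^-1 - 1) = #|T|%:R^-1 - walk n x.
    by field; rewrite !gt_eqF.
  move=> h2; lra.
have := ler_sum (index_enum Q) (fun x (_ : true) => h x).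
rewrite !sumrB -!mulr_suml walk_sum mul1r -/(entropy n).
have -> : \sum_(x : Q) (x \in T)%:R = #|T|%:R :> R.
  by rewrite -natr_sum -sum1_card [in RHS]big_mkcond /=; congr (_%:R); apply: eq_bigr => x _; case: (x \in T).
by rewrite divff ?gt_eqF // subrr subr_le0.
Qed.

Lemma entropy0 : entropy 0 = 0.
Proof.
rewrite /entropy big1 // => x _ /=; case: eqP => _; rewrite ?mul0r ?oppr0 //.
by rewrite ln1 mulr0 oppr0.
Qed.

Lemma entropy_mono n : entropy n <= entropy n.+1.
Proof.
rewrite -subr_ge0; apply: le_trans (entropy_incr n).
rewrite mulr_ge0 ?invr_ge0 ?ler0n // sumr_ge0 // => a _.
by rewrite sumr_ge0 // => x _; rewrite sqr_ge0.
Qed.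

(* By concavity the entropy increment dominates the squared Hellinger distances
   between [walk n.+1] and the translates of [walk n]; Cauchy-Schwarz against h. *)
Lemma walk_difference n a (h : Q -> R) : a \in A ->
  (\sum_x (walk n (a^-1 * x)%g - walk n x) * h x) ^+ 2 <=
  16 * (size A)%:R ^+ 2 * (entropy n.+1 - entropy n) * \sum_x walk n.+1 x * h x ^+ 2.
Proof.
move=> aA; set k := (size A)%:R : R; set eta := entropy n.+1 - entropy n.
pose p b x := walk n (b^-1 * x)%g; pose q := walk n.+1.
have k0 : 0 < k := sizeA_gt0.
have hell b : b \in A -> \sum_x (Num.sqrt (p b x) - Num.sqrt (q x)) ^+ 2 <= k * eta.
  move=> bA; rewrite -ler_pdivrMl //; apply: le_trans (entropy_incr n).
  rewrite ler_wpM2l ?invr_ge0 ?ler0n // (big_rem b bA) /= lerDl.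
  by apply: sumr_ge0 => c _; apply: sumr_ge0 => x _; rewrite sqr_ge0.
have p1E x : p 1%g x = walk n x by rewrite /p invg1 mul1g.
(* The difference of two densities factors as difference times sum of their square roots. Both the
   translate by [a] and the one by 1 are close to [walk n.+1]; each factor contributes one 4 to the
   constant 16. *)
pose u x := Num.sqrt (p a x) - Num.sqrt (p 1%g x).
pose w x := (Num.sqrt (p a x) + Num.sqrt (p 1%g x)) * h x.
have -> : \sum_x (walk n (a^-1 * x)%g - walk n x) * h x = \sum_x u x * w x.
  apply: eq_bigr => x _; rewrite /u /w mulrA -subr_sqr !sqr_sqrtr ?walk_ge0 //.
  by rewrite p1E.
apply: (le_trans (sum_cauchy u w)).
have hu : \sum_x u x ^+ 2 <= 4 * k * eta.
  have : \sum_x u x ^+ 2 <= \sum_x (2 * (Num.sqrt (p a x) - Num.sqrt (q x)) ^+ 2 +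
      2 * (Num.sqrt (p 1%g x) - Num.sqrt (q x)) ^+ 2).
    apply: ler_sum => x _; rewrite /u.
    move: (Num.sqrt (p a x)) (Num.sqrt (p 1%g x)) (Num.sqrt (q x)) => a1 b1 c1.
    have := sqr_ge0 (a1 + b1 - 2 * c1); rewrite !expr2; nra.
  rewrite big_split /= -!mulr_sumr => h1; apply: (le_trans h1).
  have := hell a aA; have := hell 1%g A1; nra.
have hw : \sum_x w x ^+ 2 <= 4 * k * \sum_x q x * h x ^+ 2.
  rewrite mulr_sumr; apply: ler_sum => x _; rewrite /w exprMn mulrA.
  rewrite ler_wpM2r ?sqr_ge0 //.
  have ea : p a x <= k * q x := walk_le n x aA.
  have e1 : p 1%g x <= k * q x := walk_le n x A1.
  have := sqr_sqrtr (walk_ge0 n (a^-1 * x)%g); rewrite -/(p a x).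
  have := sqr_sqrtr (walk_ge0 n (1^-1 * x)%g); rewrite -/(p 1%g x).
  move: (Num.sqrt (p a x)) (Num.sqrt (p 1%g x)) => a1 b1 hb ha.
  have := sqr_ge0 (a1 - b1); rewrite !expr2 in ha hb *; nra.
have -> : 16 * k ^+ 2 * eta * \sum_x q x * h x ^+ 2 =
    (4 * k * eta) * (4 * k * \sum_x q x * h x ^+ 2) by ring.
apply: ler_pM => //; apply: sumr_ge0 => x _; exact: sqr_ge0.
Qed.

End Walk.

End RandomWalk.

(** * Almost harmonic cocycles *)

Section HarmonicCocycles.
Import Order.TTheory GRing.Theory Num.Theory.
Local Open Scope ring_scope.

Section Norm.
Variable R : rcfType.

Definition nrm m n (A : 'M[R]_(m, n)) : R := Num.sqrt (dot A A).

Lemma nrm_ge0 m n (A : 'M[R]_(m, n)) : 0 <= nrm A.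
Proof. exact: sqrtr_ge0. Qed.

Lemma nrm_sq m n (A : 'M[R]_(m, n)) : nrm A ^+ 2 = dot A A.
Proof. by rewrite sqr_sqrtr ?dot_ge0. Qed.

Lemma nrm_le m n (A : 'M[R]_(m, n)) c : 0 <= c -> dot A A <= c ^+ 2 -> nrm A <= c.
Proof.
by move=> c0 h; rewrite -(@ler_sqr R) ?nnegrE ?nrm_ge0 // nrm_sq.
Qed.

Lemma nrm0 m n : nrm (0 : 'M[R]_(m, n)) = 0.
Proof. by rewrite /nrm dot0l sqrtr0. Qed.

Lemma nrm_eq0 m n (A : 'M[R]_(m, n)) : (nrm A == 0) = (A == 0).
Proof. by rewrite -sqrf_eq0 nrm_sq dot_eq0. Qed.

Lemma dot_nrm m n (A B : 'M[R]_(m, n)) : dot A B <= nrm A * nrm B.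
Proof.
have [h|/ltW h] := leP (dot A B) 0.
  by apply: (le_trans h); rewrite mulr_ge0 ?nrm_ge0.
rewrite -(@ler_sqr R) ?nnegrE ?mulr_ge0 ?nrm_ge0 // exprMn !nrm_sq.
exact: dot_cauchy.
Qed.

Lemma nrmD m n (A B : 'M[R]_(m, n)) : nrm (A + B) <= nrm A + nrm B.
Proof.
apply: nrm_le; first by rewrite addr_ge0 ?nrm_ge0.
rewrite dotDl !dotDr (dotC B) sqrrD !nrm_sq -mulr_natl.
have := dot_nrm A B; lra.
Qed.

Lemma nrmZ m n c (A : 'M[R]_(m, n)) : nrm (c *: A) = `|c| * nrm A.
Proof. by rewrite /nrm dotZl dotZr mulrA -expr2 sqrtrM ?sqr_ge0 // sqrtr_sqr. Qed.

Lemma nrmN m n (A : 'M[R]_(m, n)) : nrm (- A) = nrm A.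
Proof. by rewrite -scaleN1r nrmZ normrN1 mul1r. Qed.

Lemma nrmB m n (A B : 'M[R]_(m, n)) : nrm (A - B) <= nrm A + nrm B.
Proof. by rewrite -(nrmN B) nrmD. Qed.

Lemma nrm_sum m n I (r : seq I) (P : pred I) (F : I -> 'M[R]_(m, n)) :
  nrm (\sum_(i <- r | P i) F i) <= \sum_(i <- r | P i) nrm (F i).
Proof.
elim/big_rec2: _ => [|i x y _ h]; first by rewrite nrm0.
by apply: (le_trans (nrmD _ _)); rewrite lerD2l.
Qed.

Lemma nrm_tr m n (A : 'M[R]_(m, n)) : nrm A^T = nrm A.
Proof. by rewrite /nrm dot_trmx. Qed.

Lemma dot_orthl m n p (U : 'M[R]_(m, n)) (A B : 'M[R]_(n, p)) : U^T *m U = 1%:M ->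
  dot (U *m A) (U *m B) = dot A B.
Proof. by move=> h; rewrite dot_mulmxl mulmxA h mul1mx. Qed.

Lemma dot_orthr m n p (U : 'M[R]_(n, p)) (A B : 'M[R]_(m, n)) : U *m U^T = 1%:M ->
  dot (A *m U) (B *m U) = dot A B.
Proof. by move=> h; rewrite dot_mulmxr -mulmxA h mulmx1. Qed.

Lemma dot_rank1 n (u v : 'cV[R]_n) : dot (u *m u^T) (v *m v^T) = dot u v ^+ 2.
Proof.
rewrite dot_mulmxl !mulmxA.
have -> : u^T *m v = (dot u v)%:M.
  have := dot_row u^T v^T; rewrite trmxK dot_trmx => ->.
  by [].
by rewrite mul_scalar_mx dotZr dot_trmx expr2.
Qed.

Lemma nrmM m n p (A : 'M[R]_(m, n)) (B : 'M[R]_(n, p)) : nrm (A *m B) <= nrm A * nrm B.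
Proof.
apply: nrm_le; first by rewrite mulr_ge0 ?nrm_ge0.
rewrite exprMn !nrm_sq -(dot_trmx B B) /dot mulr_suml; apply: ler_sum => i _.
rewrite mulr_sumr; apply: ler_sum => j _.
rewrite -expr2 !mxE; apply: (le_trans (sum_cauchy _ _)).
by rewrite le_eqVlt; apply/orP; left; apply/eqP; congr (_ * _);
  apply: eq_bigr => k _; rewrite ?mxE.
Qed.

Lemma nrm_entry m n (A : 'M[R]_(m, n)) i j : `|A i j| <= nrm A.
Proof.
rewrite -(@ler_sqr R) ?nnegrE ?normr_ge0 ?nrm_ge0 // nrm_sq -normrX ger0_norm ?sqr_ge0 //.
rewrite /dot (bigD1 i) //= (bigD1 j) //= expr2 -addrA lerDl addr_ge0 //.
  by apply: sumr_ge0 => k _; rewrite -expr2 sqr_ge0.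
by apply: sumr_ge0 => k _; apply: sumr_ge0 => l _; rewrite -expr2 sqr_ge0.
Qed.

End Norm.

Section AlmostHarmonic.
Variables (R : realType) (Q : finGroupType) (A : seq Q).
Hypothesis (A1 : (1%g : Q) \in A).
Variables (N : nat) (rho : Q -> 'M[R]_N).
Hypothesis (rhoM : forall x y, rho (x * y)%g = rho x *m rho y).
Hypothesis (rhoO : forall x, (rho x)^T *m rho x = 1%:M).
Variables (v : 'cV[R]_N) (lam : R).
Hypotheses (lam0 : 0 < lam) (lam1 : lam <= 1).
Hypothesis (hv : (size A)%:R^-1 *: (\sum_(a <- A) rho a *m v) = (1 - lam) *: v).
(** Chosen so that the mean of [dot (b a) (b a)] over the letters is exactly 1. *)
Hypothesis (nv : dot v v = (2 * lam)^-1).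

Local Notation mu := (walk R A).
Local Notation k := ((size A)%:R : R).
Let rhoO' x : rho x *m (rho x)^T = 1%:M.
Proof. by apply: mulmx1C; exact: rhoO. Qed.

Let rho1 : rho 1%g = 1%:M.
Proof. by rewrite -[LHS]mulmx1 -(rhoO' 1%g) mulmxA -rhoM mulg1. Qed.

(** A coboundary at this stage; as [lam] tends to 0 the norm of [v] blows up, so a limit need not be
    one. *)
Definition cocycle x : 'cV[R]_N := rho x *m v - v.
Local Notation b := cocycle.

Lemma cocycleM x y : b (x * y)%g = b x + rho x *m b y.
Proof. by rewrite /cocycle rhoM mulmxBr mulmxA [RHS]addrC addrA subrK. Qed.

Lemma walk_lin (V : lmodType R) n (F : Q -> V) :
  \sum_x mu n.+1 x *: F x = k^-1 *: \sum_(a <- A) \sum_x mu n x *: F (a * x)%g.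
Proof.
transitivity (k^-1 *: \sum_x \sum_(a <- A) mu n (a^-1 * x)%g *: F x).
  by rewrite scaler_sumr; apply: eq_bigr => x _; rewrite -scaler_suml scalerA.
rewrite exchange_big /=; congr (_ *: _); apply: eq_bigr => a _.
rewrite -(sum_shift a (fun x => mu n (a^-1 * x)%g *: F x)).
by apply: eq_bigr => x _; rewrite mulKg.
Qed.

Lemma walk_rho_v n : \sum_x mu n x *: (rho x *m v) = (1 - lam) ^+ n *: v.
Proof.
elim: n => [|n IH].
  rewrite (bigD1 1%g) //= eqxx big1 ?addr0 => [|x /negbTE ->]; last by rewrite scale0r.
  by rewrite rho1 mul1mx.
rewrite walk_lin (eq_bigr (fun a => (1 - lam) ^+ n *: (rho a *m v))).
  by rewrite -scaler_sumr scalerA mulrC -scalerA hv scalerA exprSr.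
move=> a _; rewrite scalemxAr -IH mulmx_sumr; apply: eq_bigr => x _.
by rewrite rhoM -mulmxA scalemxAr.
Qed.

Definition conj_avg (X : 'M[R]_N) : 'M[R]_N :=
  k^-1 *: \sum_(a <- A) rho a *m X *m (rho a)^T.

Lemma conj_avgB X Y : conj_avg (X - Y) = conj_avg X - conj_avg Y.
Proof.
rewrite /conj_avg -scalerBr -sumrB; congr (_ *: _); apply: eq_bigr => a _.
by rewrite mulmxBr mulmxBl.
Qed.

Lemma conj_avgD X Y : conj_avg (X + Y) = conj_avg X + conj_avg Y.
Proof.
rewrite /conj_avg -scalerDr -big_split; congr (_ *: _); apply: eq_bigr => a _.
by rewrite mulmxDr mulmxDl.
Qed.

Lemma conj_avgZ c X : conj_avg (c *: X) = c *: conj_avg X.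
Proof.
rewrite /conj_avg scalerA mulrC -scalerA [c *: \sum_(_ <- _) _]scaler_sumr; congr (_ *: _).
by apply: eq_bigr => a _; rewrite -scalemxAr -scalemxAl.
Qed.

Lemma nrm_rho x X : nrm (rho x *m X *m (rho x)^T) = nrm X.
Proof. by rewrite /nrm dot_orthr ?trmxK // dot_orthl. Qed.

Lemma nrm_conj_avg X : nrm (conj_avg X) <= nrm X.
Proof.
rewrite nrmZ ger0_norm ?invr_ge0 ?ler0n //.
apply: (@le_trans _ _ (k^-1 * \sum_(a <- A) nrm X)); last by rewrite avg_const.
rewrite ler_wpM2l ?invr_ge0 ?ler0n //; apply: (le_trans (nrm_sum _ _ _)).
by apply: ler_sum => a _; rewrite nrm_rho.
Qed.

Lemma nrm_iter_conj n X : nrm (iter n conj_avg X) <= nrm X.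
Proof. by elim: n => //= n IH; apply: (le_trans (nrm_conj_avg _)). Qed.

Lemma iter_conj_comm n X : iter n conj_avg X - conj_avg (iter n conj_avg X) =
  iter n conj_avg (X - conj_avg X).
Proof. by elim: n => //= n IH; rewrite -IH conj_avgB. Qed.

Let P := v *m v^T.

Lemma walk_rho_P n :
  \sum_x mu n x *: (rho x *m P *m (rho x)^T) = iter n conj_avg P.
Proof.
elim: n => [|n IH] /=.
  rewrite (bigD1 1%g) //= eqxx big1 ?addr0 => [|x /negbTE ->]; last by rewrite scale0r.
  by rewrite rho1 trmx1 mul1mx mulmx1 scale1r.
rewrite -IH walk_lin /conj_avg; congr (_ *: _); apply: eq_bigr => a _.
rewrite mulmx_sumr mulmx_suml; apply: eq_bigr => x _.
by rewrite rhoM trmx_mul -scalemxAr -scalemxAl !mulmxA.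
Qed.

Definition covar n : 'M[R]_N := \sum_x mu n x *: (b x *m (b x)^T).

(** Expand the rank-one terms: because [v] is an eigenvector of the averaging operator, both mixed
    terms average to the same multiple of [P]. *)
Lemma covarE n : covar n = iter n conj_avg P + (1 - 2 * (1 - lam) ^+ n) *: P.
Proof.
have e x : b x *m (b x)^T = rho x *m P *m (rho x)^T - (rho x *m v) *m v^T
    - v *m (rho x *m v)^T + P.
  have -> : rho x *m P *m (rho x)^T = (rho x *m v) *m (rho x *m v)^T.
    by rewrite trmx_mul !mulmxA.
  rewrite /cocycle linearB /= mulmxBr !mulmxBl opprB addrA [LHS]addrAC.
  by congr (_ + _); exact: addrAC.
rewrite /covar (eq_bigr _ (fun x _ => congr1 _ (e x))).
under eq_bigr do rewrite scalerDr !scalerBr.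
rewrite big_split !sumrB /= walk_rho_P -scaler_suml walk_sum // scale1r.
have -> : \sum_x mu n x *: (rho x *m v *m v^T) = (1 - lam) ^+ n *: P.
  rewrite /P scalemxAl -walk_rho_v mulmx_suml; apply: eq_bigr => x _.
  by rewrite scalemxAl.
have -> : \sum_x mu n x *: (v *m (rho x *m v)^T) = (1 - lam) ^+ n *: P.
  rewrite /P scalemxAr -linearZ /= -walk_rho_v linear_sum mulmx_sumr.
  by apply: eq_bigr => x _; rewrite linearZ /= scalemxAr.
rewrite -!addrA; congr (_ + _); rewrite scalerBl scale1r mulr2n mulrDl mul1r scalerDl opprD.
by rewrite [RHS]addrC -addrA.
Qed.

Lemma covar_tr n : (covar n)^T = covar n.
Proof.
rewrite linear_sum; apply: eq_bigr => x _.
by rewrite linearZ /= trmx_mul trmxK.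
Qed.

Lemma cocycle_sq_mean n : \sum_x mu n x * dot (b x) (b x) = (1 - (1 - lam) ^+ n) / lam.
Proof.
have e x : dot (b x) (b x) = 2 * dot v v - 2 * dot (rho x *m v) v.
  by rewrite !(dotBl, dotBr) dot_orthl // (dotC v); ring.
rewrite (eq_bigr _ (fun x _ => congr1 _ (e x))).
under eq_bigr do rewrite mulrBr.
rewrite sumrB -mulr_suml walk_sum // mul1r.
have -> : \sum_x mu n x * (2 * dot (rho x *m v) v) = 2 * ((1 - lam) ^+ n * dot v v).
  rewrite -dotZl -walk_rho_v dot_suml mulr_sumr; apply: eq_bigr => x _.
  by rewrite dotZl; ring.
by rewrite nv; field; rewrite gt_eqF.
Qed.

Lemma bernoulli n : 1 - n%:R * lam <= (1 - lam) ^+ n.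
Proof.
elim: n => [|n IH]; first by rewrite mul0r subr0 expr0.
rewrite exprSr -natr1.
have := ler_wpM2r (_ : 0 <= 1 - lam) IH; rewrite subr_ge0 => /(_ lam1) h.
apply: le_trans h; have : 0 <= n%:R * lam * lam by rewrite !mulr_ge0 ?ler0n // ltW.
move=> h; lra.
Qed.

Lemma pow_le1 n : 0 <= (1 - lam) ^+ n <= 1.
Proof.
have h0 : 0 <= 1 - lam by rewrite subr_ge0.
by rewrite exprn_ge0 //= exprn_ile1 // lerBlDr lerDl ltW.
Qed.

Lemma cocycle_sq_mean_le n : \sum_x mu n x * dot (b x) (b x) <= n%:R.
Proof.
rewrite cocycle_sq_mean ler_pdivrMr //; have := bernoulli n; lra.
Qed.

Lemma nrm_covar n : nrm (covar n) <= n%:R.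
Proof.
apply: le_trans (cocycle_sq_mean_le n); apply: (le_trans (nrm_sum _ _ _)).
apply: ler_sum => x _; rewrite nrmZ ger0_norm ?walk_ge0 //.
rewrite /nrm dot_rank1 sqrtr_sqr ger0_norm ?dot_ge0 //.
Qed.

(** The bound does not depend on [n]. Iterated averaging contracts and commutes with [conj_avg], so
    only [P - conj_avg P] matters; it equals [(2 * lam) *: P - covar 1], a difference of two
    matrices of norm at most 1, although [P] itself is huge. *)
Lemma covar_almost_inv n : nrm (covar n - conj_avg (covar n)) <= 4.
Proof.
have hP : nrm (P - conj_avg P) <= 2.
  have -> : P - conj_avg P = (2 * lam) *: P - covar 1.
    rewrite covarE /= expr1; have -> : 1 - 2 * (1 - lam) = 2 * lam - 1 by ring.
    rewrite scalerBl scale1r; move: (_ *: P) (conj_avg P) => X Y.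
    by rewrite opprD opprB [RHS]addrCA [RHS]addrC [X + _]addrC subrK.

  have nP : nrm ((2 * lam) *: P) = 1.
    have l2 : 0 < 2 * lam by rewrite mulr_gt0.
    rewrite nrmZ gtr0_norm // /nrm /P dot_rank1 nv sqrtr_sqr gtr0_norm ?invr_gt0 //.
    by rewrite divff // gt_eqF.
  apply: (le_trans (nrmB _ _)); have := nrm_covar 1; rewrite nP; lra.
rewrite covarE conj_avgD conj_avgZ opprD addrACA iter_conj_comm -scalerBr.
apply: (le_trans (nrmD _ _)).
have h1 := le_trans (nrm_iter_conj n (P - conj_avg P)) hP.
rewrite nrmZ; have h2 : `|1 - 2 * (1 - lam) ^+ n| <= 1.
  by rewrite ler_norml; have := pow_le1 n; lra.
have := nrm_ge0 (P - conj_avg P); nra.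
Qed.

(** Conjugation preserves the norm, so the mean squared displacement is
    [2 * dot (T - conj_avg T) T], at most [2 * 4 * n]. After division of [T] by [n] it is O(1/n). *)
Lemma covar_conj_dist n :
  k^-1 * (\sum_(a <- A) nrm (rho a *m covar n *m (rho a)^T - covar n) ^+ 2) <= 8 * n%:R.
Proof.
set T := covar n.
have e a : nrm (rho a *m T *m (rho a)^T - T) ^+ 2 =
    2 * dot T T - 2 * dot (rho a *m T *m (rho a)^T) T.
  by rewrite nrm_sq !(dotBl, dotBr) dot_orthr ?trmxK // dot_orthl // (dotC T (_ *m _)); ring.
rewrite (eq_bigr _ (fun a _ => e a)) sumrB mulrBr avg_const // -mulr_sumr -dot_suml.
have -> : 2 * dot T T - k^-1 * (2 * dot (\sum_(a <- A) rho a *m T *m (rho a)^T) T) =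
    2 * dot (T - conj_avg T) T by rewrite dotBl dotZl; ring.
have h1 := covar_almost_inv n; have h2 := nrm_covar n; rewrite -/T in h1 h2.
have := dot_nrm (T - conj_avg T) T; have := nrm_ge0 T; have := nrm_ge0 (T - conj_avg T).
nra.
Qed.

(** Apply [walk_difference] to [h x = dot (b x) w]: shifting the walk by [a] changes the mean of [b]
    by [(1 - lam) ^+ n *: b a], and the second moment of [h] is the quadratic form of
    [covar n.+1]. *)
Lemma cocycle_dot_le n a w : a \in A ->
  dot (b a) w ^+ 2 * ((1 - lam) ^+ n) ^+ 2 <=
  16 * k ^+ 2 * (entropy R A n.+1 - entropy R A n) * dot (covar n.+1 *m w) w.
Proof.
move=> aA; have := walk_difference A1 n (fun x => dot (b x) w) aA.
have -> : \sum_x (mu n (a^-1 * x)%g - mu n x) * dot (b x) w = dot (b a) w * (1 - lam) ^+ n.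
  rewrite (eq_bigr (fun x => mu n (a^-1 * x)%g * dot (b x) w - mu n x * dot (b x) w)).
    rewrite sumrB -(sum_shift a (fun x => mu n (a^-1 * x)%g * dot (b x) w)) -sumrB.
    transitivity (dot (\sum_x mu n x *: (rho a *m (rho x *m v) - rho x *m v)) w).
      rewrite dot_suml; apply: eq_bigr => x _; rewrite mulKg -mulrBr -dotBl dotZl.
      by rewrite /cocycle rhoM -mulmxA opprB addrA subrK.
    under eq_bigr do rewrite scalerBr scalemxAr.
    rewrite sumrB -mulmx_sumr walk_rho_v -scalemxAr -scalerBr dotZl mulrC.
    by [].
  by move=> x _; rewrite mulrBl.
have -> : \sum_x mu n.+1 x * dot (b x) w ^+ 2 = dot (covar n.+1 *m w) w.
  rewrite /covar mulmx_suml dot_suml; apply: eq_bigr => x _.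
  rewrite -scalemxAl dotZl; congr (_ * _); rewrite -mulmxA.
  have -> : (b x)^T *m w = (dot (b x) w)%:M.
    by have := dot_row (b x)^T w^T; rewrite trmxK dot_trmx.
  by rewrite mul_mx_scalar dotZl expr2.
by rewrite exprMn.
Qed.

Lemma cocycle_avg_sq : k^-1 * (\sum_(a <- A) dot (b a) (b a)) = 1.
Proof.
have e x : dot (b x) (b x) = 2 * dot v v - 2 * dot (rho x *m v) v.
  by rewrite !(dotBl, dotBr) dot_orthl // (dotC v); ring.
rewrite (eq_bigr _ (fun x _ => e x)) sumrB mulrBr avg_const // -mulr_sumr -dot_suml.
by rewrite mulrCA -(dotZl k^-1) hv dotZl nv; field; rewrite gt_eqF.
Qed.

Lemma cocycle_avg : k^-1 *: (\sum_(a <- A) b a) = - lam *: v.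
Proof.
by rewrite /cocycle sumrB scalerBr hv avg_constv // scalerBl scale1r addrAC subrr add0r scaleNr.
Qed.

(* Cauchy-Schwarz on the diagonal vectors w = b a, averaged over a. *)
Lemma cocycle_covar_lower n c : 0 <= c -> 2 * (n%:R * lam) <= 2^-1 ->
  16 * k ^+ 2 * (entropy R A n.+1 - entropy R A n) <= c / 2 ->
  1 <= c * (k^-1 * \sum_(a <- A) dot (covar n.+1 *m b a) (b a)).
Proof.
move=> c0 hl hc.
have hp : 2^-1 <= ((1 - lam) ^+ n) ^+ 2.
  have := bernoulli n; have /andP [p0 _] := pow_le1 n.
  move: (_ ^+ n) p0 => q q0 h; rewrite expr2; nra.
have Tpos (w : 'cV_N) : 0 <= dot (covar n.+1 *m w) w.
  rewrite /covar mulmx_suml dot_suml; apply: sumr_ge0 => x _.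
  rewrite -scalemxAl dotZl mulr_ge0 ?walk_ge0 // -mulmxA.
  have -> : (b x)^T *m w = (dot (b x) w)%:M.
    by have := dot_row (b x)^T w^T; rewrite trmxK dot_trmx.
  by rewrite mul_mx_scalar dotZl -expr2 sqr_ge0.
have h a : a \in A -> dot (b a) (b a) ^+ 2 <= c * dot (covar n.+1 *m b a) (b a).
  move=> aA; have := cocycle_dot_le n (b a) aA; have := Tpos (b a).
  move: (dot _ _) (dot (b a) (b a)) => t s t0 h1.
  have h2 := ler_wpM2r t0 hc.
  have h3 := ler_wpM2l (sqr_ge0 s) hp; nra.
have e1 := cocycle_avg_sq.
(* From [s ^+ 2 >= 2 * s - 1]: numbers of mean 1 have mean square at least 1. *)
have : k^-1 * (\sum_(a <- A) (2 * dot (b a) (b a) - 1)) <=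
    k^-1 * \sum_(a <- A) dot (b a) (b a) ^+ 2.
  rewrite ler_wpM2l ?invr_ge0 ?ler0n //; apply: ler_sum => a _.
  have := sqr_ge0 (dot (b a) (b a) - 1); rewrite !expr2; nra.
rewrite sumrB mulrBr avg_const // -mulr_sumr mulrCA e1 => h4.
have h5 : k^-1 * (\sum_(a <- A) dot (b a) (b a) ^+ 2) <=
    k^-1 * \sum_(a <- A) c * dot (covar n.+1 *m b a) (b a).
  by rewrite ler_wpM2l ?invr_ge0 ?ler0n // !big_seq; apply: ler_sum => a /h.
move: h5; rewrite -mulr_sumr mulrCA; lra.
Qed.

End AlmostHarmonic.

End HarmonicCocycles.

(** * Small eigenvalues *)

Section Eigenvalues.
Import Order.TTheory GRing.Theory Num.Theory.
Local Open Scope ring_scope.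

Lemma sum_indicator (R : pzSemiRingType) (T : finType) (B : {pred T}) :
  \sum_x (x \in B)%:R = #|B|%:R :> R.
Proof. by rewrite -sum1_card natr_sum [RHS]big_mkcond /=; apply: eq_bigr => x _; case: ifP. Qed.

Section SmallEigenvalue.
Variables (R : realType) (Q : finGroupType) (A : seq Q).
Hypotheses (A1 : (1%g : Q) \in A) (AV : perm_eq [seq a^-1%g | a <- A] A).
Local Notation k := ((size A)%:R : R).

Section Rep.
Variables (N : nat) (rho : Q -> 'M[R]_N).
Hypothesis (rhoV : forall x, rho x^-1%g = (rho x)^T).
Hypothesis (rhoO : forall x, (rho x)^T *m rho x = 1%:M).

Let L : 'M[R]_N := 1%:M - k^-1 *: \sum_(a <- A) rho a.

Let L_sym : L^T = L.
Proof.
rewrite /L linearB /= trmx1 linearZ /= linear_sum; congr (_ - _ *: _).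
by rewrite -(sumA_inv AV); apply: eq_bigr => a _ /=; rewrite -rhoV invgK.
Qed.

Let dirichlet (f : 'cV[R]_N) :
  k^-1 * (\sum_(a <- A) dot (rho a *m f - f) (rho a *m f - f)) = 2 * dot (L *m f) f.
Proof.
have e a : dot (rho a *m f - f) (rho a *m f - f) = 2 * dot f f - 2 * dot (rho a *m f) f.
  by rewrite !(dotBl, dotBr) dot_orthl // (dotC f (_ *m _)); ring.
rewrite (eq_bigr _ (fun a _ => e a)) sumrB mulrBr avg_const // -mulr_sumr -dot_suml.
by rewrite /L mulmxBl mul1mx -scalemxAl dotBl dotZl mulmx_suml; ring.
Qed.

(** The Laplacian [L] has Rayleigh quotient at most [eps] at [f], and [f] has no component along
    invariant vectors, which are all the eigenvectors of eigenvalue at most 0. If no eigenvalue lay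
    between 0 and [eps], the quotient would exceed [eps]. *)
Lemma small_eigenvector (f : 'cV[R]_N) eps : f != 0 ->
  k^-1 * (\sum_(a <- A) dot (rho a *m f - f) (rho a *m f - f)) <= 2 * (eps * dot f f) ->
  (forall w : 'cV_N, (forall a, a \in A -> rho a *m w = w) -> dot w f = 0) ->
  exists lam (w : 'cV_N), [/\ 0 < lam, lam <= eps, w != 0 &
    k^-1 *: (\sum_(a <- A) rho a *m w) = (1 - lam) *: w].
Proof.
move=> f0 hf horth; have [O [d [OO LE]]] := symmetric_spectral L_sym.
pose w i : 'cV[R]_N := (row i O)^T.
have Lw i : L *m w i = d 0 i *: w i.
  rewrite /w -{1}L_sym -trmx_mul -row_mul LE !mulmxA OO mul1mx.
  by rewrite row_mul row_diag_mx -scalemxAl -rowE linearZ.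
have ww i : dot (w i) (w i) = 1.
  rewrite dot_trmx; have := dot_row (row i O) (row i O).
  rewrite -row_mul tr_row; move/(congr1 (fun M : 'M_1 => M 0 0)).
  rewrite [RHS]mxE eqxx mulr1n => <-.
  transitivity ((O *m O^T) i i); last by rewrite OO mxE eqxx.
  rewrite !mxE; by apply: eq_bigr => j _; rewrite !mxE.
have w0 i : w i != 0 by rewrite -dot_eq0 ww oner_eq0.
have [i /andP [di ei]|no] := pickP (fun i => (0 < d 0 i) && (d 0 i <= eps)).
  exists (d 0 i), (w i); split=> //.
  have := Lw i; rewrite /L mulmxBl mul1mx -scalemxAl mulmx_suml scalerBl scale1r => <-.
  by rewrite opprB addrC subrK.
pose c i := dot (w i) f.
have cE : O *m f = \col_i c i.
  apply/colP => i; rewrite !mxE /c /dot; rewrite (eq_bigr (fun j => O i j * f j 0)) //.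
  by apply: eq_bigr => j _; rewrite big_ord1 !mxE.
have ff : dot f f = \sum_i c i ^+ 2.
  have OO' : O^T *m O = 1%:M by apply: mulmx1C.
  rewrite -(dot_orthl f f OO') cE /dot; apply: eq_bigr => i _.
  by rewrite big_ord1 !mxE expr2.
have fLf : dot (L *m f) f = \sum_i d 0 i * c i ^+ 2.
  rewrite LE -!mulmxA dot_mulmxl trmxK cE /dot; apply: eq_bigr => i _.
  by rewrite big_ord1 mul_diag_mx !mxE expr2 mulrA.
have c0 i : d 0 i <= 0 -> c i = 0.
  move=> di; apply: horth => a aA.
  have h := dirichlet (w i); rewrite Lw dotZl ww mulr1 in h.
  have h0 : \sum_(a <- A) dot (rho a *m w i - w i) (rho a *m w i - w i) = 0.
    apply/eqP; rewrite eq_le sumr_ge0 ?andbT => [|b _]; last exact: dot_ge0.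
    rewrite -(@pmulr_rle0 _ k^-1) ?invr_gt0 ?sizeA_gt0 // h; lra.
  apply/eqP; rewrite -subr_eq0 -dot_eq0 eq_le dot_ge0 andbT -h0 (big_rem a aA) /= lerDl.
  by apply: sumr_ge0 => b _; exact: dot_ge0.
have [j cj] : exists j, c j != 0.
  apply: contrapT => h; move: f0; rewrite -dot_eq0 ff big1 ?eqxx // => i _.
  apply/eqP; rewrite sqrf_eq0; apply: contrapT => /negP ci; apply: h; by exists i.
have dj i : c i != 0 -> eps < d 0 i.
  move=> ci; have := no i; case: ltP => [/= _|/c0 /eqP]; first by case: ltP.
  by rewrite (negbTE ci).
rewrite dirichlet fLf ler_pM2l // ff mulr_sumr in hf.
suff : \sum_i eps * c i ^+ 2 < \sum_i d 0 i * c i ^+ 2 by rewrite ltNge hf.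
rewrite (bigD1 j) //= [X in _ < X](bigD1 j) //=; apply: ltr_leD.
  by rewrite ltr_pM2r ?dj // exprn_even_gt0.
apply: ler_sum => i _; have [->|ci] := eqVneq (c i) 0; first by rewrite expr0n !mulr0.
by rewrite ler_wpM2r ?sqr_ge0 // ltW // dj.
Qed.

End Rep.

Definition vecf (F : Q -> R) : 'cV[R]_#|Q| := \col_i F (enum_val i).

Definition regular (g : Q) : 'M[R]_#|Q| :=
  \matrix_(i, j) (enum_val i == g * enum_val j)%g%:R.

Lemma sum_enum_val (F : Q -> R) : \sum_(i < #|Q|) F (enum_val i) = \sum_x F x.
Proof. by rewrite -big_enum_val. Qed.

Lemma dot_vecf F1 F2 : dot (vecf F1) (vecf F2) = \sum_x F1 x * F2 x.
Proof.
rewrite -sum_enum_val /dot; apply: eq_bigr => i _.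
by rewrite big_ord1 !mxE.
Qed.

Lemma vecf_surj (w : 'cV[R]_#|Q|) : exists F, w = vecf F.
Proof.
by exists (fun x => w (enum_rank x) 0); apply/colP => i; rewrite mxE enum_valK.
Qed.

Lemma regularE g F : regular g *m vecf F = vecf (fun x => F (g^-1 * x)%g).
Proof.
apply/colP => i; rewrite !mxE.
transitivity (\sum_x (enum_val i == g * x)%g%:R * F x).
  rewrite -sum_enum_val; apply: eq_bigr => j _; by rewrite !mxE.
rewrite (bigD1 (g^-1 * enum_val i)%g) //= mulKVg eqxx mul1r big1 ?addr0 // => x xn.
case: eqP => [e|_]; last by rewrite mul0r.
by move: xn; rewrite e mulKg eqxx.
Qed.

Lemma regularV g : regular g^-1%g = (regular g)^T.
Proof.
apply/matrixP => i j; rewrite !mxE; congr (_%:R).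
by rewrite -(inj_eq (mulgI g)) mulKVg eq_sym.
Qed.

Lemma regularM g h : regular (g * h)%g = regular g *m regular h.
Proof.
apply/matrixP => i j; rewrite !mxE.
transitivity (\sum_x (enum_val i == g * x)%g%:R * (x == h * enum_val j)%g%:R : R).
  rewrite (bigD1 (h * enum_val j)%g) //= eqxx mulr1 big1 ?addr0 ?mulgA // => x /negbTE ->.
  by rewrite mulr0.
by rewrite -sum_enum_val; apply: eq_bigr => l _; rewrite !mxE.
Qed.

Lemma regularO g : (regular g)^T *m regular g = 1%:M.
Proof.
rewrite -regularV -regularM mulVg; apply/matrixP => i j; rewrite !mxE mul1g.
by rewrite (inj_eq enum_val_inj).
Qed.

(* The test function is the indicator of B recentred on the subgroup <<A>>. *)
Lemma ball_eigenvector (B : {set Q}) (delta : R) :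
  B \subset <<[set x in A]>>%g -> (0 < #|B|)%N -> (2 * #|B| <= #|<<[set x in A]>>%g|)%N ->
  (forall a, a \in A -> #|[set x in B | (a * x)%g \notin B]|%:R <= delta * #|B|%:R) ->
  exists lam (w : 'cV_#|Q|), [/\ 0 < lam, lam <= 2 * delta, w != 0 &
    k^-1 *: (\sum_(a <- A) regular a *m w) = (1 - lam) *: w].
Proof.
set P := <<_>>%g => BP B0 BP2 hB.
have AP a : a \in A -> a \in P by move=> aA; apply: mem_gen; rewrite inE.
pose beta : R := #|B|%:R / #|P|%:R.
have P0 : 0 < #|P|%:R :> R by rewrite ltr0n cardG_gt0.
have Bp : 0 < #|B|%:R :> R by rewrite ltr0n.
pose F x : R := (x \in B)%:R - beta * (x \in P)%:R.
have sumB : \sum_x (x \in B)%:R = #|B|%:R :> R.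
  exact: sum_indicator.
have sumP : \sum_x (x \in P)%:R = #|P|%:R :> R.
  exact: sum_indicator.
have bP : beta * #|P|%:R = #|B|%:R by rewrite /beta mulfVK // gt_eqF.
have ff : dot (vecf F) (vecf F) = #|B|%:R - beta * #|B|%:R.
  rewrite dot_vecf (eq_bigr (fun x => (1 - 2 * beta) * (x \in B)%:R + beta ^+ 2 * (x \in P)%:R)).
    by rewrite big_split /= -!mulr_sumr sumB sumP expr2 -mulrA bP; ring.
  move=> x _; rewrite /F; have [xB|xB] := boolP (x \in B).
    by rewrite (fintype.subsetP BP x xB) /= ?mulr1n; ring.
  by case: (x \in P); rewrite /= ?mulr1n ?mulr0n; ring.
have beta2 : beta <= 2^-1.
  rewrite /beta ler_pdivrMr // -(@ler_pM2l _ 2) // mulrA divff ?pnatr_eq0 // mul1r.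
  by rewrite -natrM ler_nat.
have ff2 : #|B|%:R / 2 <= dot (vecf F) (vecf F) by rewrite ff; nra.
have f0 : vecf F != 0.
  rewrite -dot_eq0 gt_eqF //; apply: lt_le_trans ff2; exact: divr_gt0.
have delta0 : 0 <= delta.
  rewrite -(pmulr_lge0 _ Bp); apply: le_trans (hB _ A1); exact: ler0n.
apply: (small_eigenvector regularV regularO f0).
  apply: (@le_trans _ _ (k^-1 * \sum_(a <- A) (2 * (delta * #|B|%:R)))); last first.
    by rewrite avg_const // ler_pM2l // mulrAC; nra.
  rewrite ler_wpM2l ?invr_ge0 ?ler0n // !big_seq; apply: ler_sum => a aA.
  have -> : regular a *m vecf F - vecf F =
      vecf (fun x => (a^-1 * x \in B)%g%:R - (x \in B)%:R).
    have aP y : ((a^-1 * y)%g \in P) = (y \in P) by rewrite groupMl // groupV AP.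
    rewrite regularE; apply/colP => i; rewrite !mxE /F aP; ring.
  rewrite dot_vecf.
  pose D x : R := ((x \in B) && (a * x \notin B)%g)%:R.
  have cD : \sum_x D x = #|[set x in B | (a * x)%g \notin B]|%:R.
    by rewrite -sum_indicator; apply: eq_bigr => x _; rewrite inE.
  have -> : \sum_x ((a^-1 * x \in B)%g%:R - (x \in B)%:R) *
      ((a^-1 * x \in B)%g%:R - (x \in B)%:R) = 2 * \sum_x D x.
    have s1 : \sum_x ((a^-1 * x \in B)%g%:R - (x \in B)%:R) = 0 :> R.
      by rewrite sumrB (sum_shift a^-1%g (fun x => (x \in B)%:R)) subrr.
    rewrite -(sum_shift a^-1%g D) -[LHS]addr0 -{2}s1 -big_split mulr_sumr /=.
    apply: eq_bigr => x _; rewrite /D mulKVg.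
    by case: (a^-1 * x \in B)%g; case: (x \in B) => /=; ring.
  by rewrite cD ler_pM2l // hB.
(* An invariant vector is constant on [P], and [F] is supported on [P] with total mass 0. *)
move=> w hw; have [W wE] := vecf_surj w.
have hP x : x \in P -> regular x *m w = w.
  pose Hs := [set x | regular x *m w == w].
  have gH : group_set Hs.
    apply/group_setP; split.
      by rewrite inE; apply/eqP; have := regularO 1%g; rewrite -regularV -regularM mulVg => ->; rewrite mul1mx.
    move=> x1 y1; rewrite !inE => /eqP e1 /eqP e2; apply/eqP.
    by rewrite regularM -mulmxA e2 e1.
  move=> xP; have : x \in Group gH.
    apply: (fintype.subsetP _ x xP); rewrite gen_subG; apply/fintype.subsetP => y.
    by rewrite !inE => yA; apply/eqP; apply: hw.
  by rewrite inE => /eqP.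
have Wc x : x \in P -> W x = W 1%g.
  move=> xP; have := hP x xP; rewrite wE regularE => /colP /(_ (enum_rank x)).
  by rewrite !mxE enum_rankK mulVg.
rewrite wE dot_vecf (eq_bigr (fun x => W 1%g * F x)).
  by rewrite -mulr_sumr sumrB -mulr_sumr sumB sumP bP subrr mulr0.
move=> x _; have [xP|xP] := boolP (x \in P); first by rewrite Wc.
have xB : x \notin B by apply: contra xP; exact: fintype.subsetP.
by rewrite /F (negbTE xP) (negbTE xB) mulr0 subr0 !mulr0.
Qed.

End SmallEigenvalue.

End Eigenvalues.

(** * Spectral projections *)

Section Projections.
Import Order.TTheory GRing.Theory Num.Theory.
Local Open Scope ring_scope.

(* Pigeonhole: among K.+1 consecutive intervals one contains no eigenvalue. *)
Lemma spectral_gap (R : realFieldType) N (d : 'I_N -> R) (t g : R) (K : nat) :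
  0 < t -> 0 < g -> (forall i, 0 <= d i) -> \sum_i d i <= 1 -> 1 <= K%:R * t ->
  exists theta, [/\ t <= theta, theta + g <= t + K.+1%:R * g &
    forall i, d i < theta \/ theta + g <= d i].
Proof.
move=> t0 g0 d0 sd Kt; apply: contrapT => hno.
have hj (j : 'I_K.+1) : exists i, t + j%:R * g <= d i /\ d i < t + j%:R * g + g.
  apply: contrapT => h; apply: hno; exists (t + j%:R * g); split.
  - by rewrite lerDl mulr_ge0 ?ler0n // ltW.
  - rewrite -addrA -[X in _ + (_ + X)]mul1r -mulrDl lerD2l ler_pM2r //.
    by rewrite natr1 ler_nat ltn_ord.
  - move=> i; have [h1|h1] := ltP (d i) (t + j%:R * g); first by left.
    by right; rewrite leNgt; apply/negP => h2; apply: h; exists i.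
have [f hf] := choice hj.
have finj : injective f.
  move=> j l e; apply: val_inj => /=; have [h1 h2] := hf j; have [h3 h4] := hf l.
  rewrite e in h1 h2.
  have a1 : (j : nat)%:R * g < (l : nat).+1%:R * g.
    by rewrite -natr1 mulrDl mul1r; lra.
  have a2 : (l : nat)%:R * g < (j : nat).+1%:R * g.
    by rewrite -natr1 mulrDl mul1r; lra.
  rewrite !(ltr_pM2r g0) !ltr_nat in a1 a2.
  by apply/eqP; rewrite eqn_leq -ltnS a1 -ltnS a2.
have : \sum_(i in codom f) d i <= 1.
  apply: le_trans sd; rewrite big_mkcond /=; apply: ler_sum => i _; case: ifP => // _; exact: d0.
rewrite leNgt => /negP; apply.
have : \sum_(i in codom f) t <= \sum_(i in codom f) d i.
  apply: ler_sum => i /codomP [j ->]; have [h1 _] := hf j.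
  by apply: le_trans h1; rewrite lerDl mulr_ge0 ?ler0n // ltW.
apply: lt_le_trans; rewrite sumr_const card_codom // card_ord -[t *+ _]mulr_natl -natr1 mulrDl mul1r.
lra.
Qed.

Section Projection.
Variables (R : realType) (N : nat) (T : 'M[R]_N).
Hypotheses (Tsym : T^T = T) (Tpos : forall w : 'cV_N, 0 <= dot (T *m w) w).
Hypothesis (Ttr : \tr T <= 1).

(** [E] spans the eigenvectors above a gap found between [c / 4] and [c / 2]. The trace bounds their
    number, the discarded part costs at most [c / 2], and the gap turns almost commuting with [T]
    into almost preserving the span: in an eigenbasis the commutator has entries
    [(d 0 j - d 0 i) * Y i j], with a factor of size at least [g] when exactly [j] is selected. *)
Lemma spectral_projection (c : R) (K : nat) : 0 < c -> 1 <= K%:R * (c / 4) ->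
  exists r (E : 'M[R]_(N, r)), [/\ (r <= K)%N, E^T *m E = 1%:M,
    (forall b : 'cV_N, dot (T *m b) b <= dot (E^T *m b) (E^T *m b) + c / 2 * dot b b) &
    forall U : 'M_N, U *m U^T = 1%:M ->
      (c / (4 * K.+1%:R)) ^+ 2 * nrm (U *m E - E *m (E^T *m U *m E)) ^+ 2 <=
      nrm (U *m T *m U^T - T) ^+ 2].
Proof.
move=> c0 hK; have [O [d [OO TE]]] := symmetric_spectral Tsym.
have OO' : O^T *m O = 1%:M by apply: mulmx1C.
(* [K.+1] intervals of this width starting at [c / 4] end exactly at [c / 2]. *)
set g := c / (4 * K.+1%:R).
have g0 : 0 < g by rewrite divr_gt0 // mulr_gt0 // ltr0n.
have dotT (w : 'cV_N) : dot (T *m w) w = \sum_i d 0 i * (O *m w) i 0 ^+ 2.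
  rewrite TE -!mulmxA dot_mulmxl trmxK /dot; apply: eq_bigr => i _.
  by rewrite big_ord1 mul_diag_mx mxE expr2 mulrA.
have d0 i : 0 <= d 0 i.
  have := Tpos (O^T *m delta_mx i 0); rewrite dotT mulmxA OO mul1mx.
  rewrite (bigD1 i) //= big1 ?addr0 => [|j /negbTE ji].
    by rewrite mxE !eqxx expr1n mulr1.
  by rewrite mxE ji expr0n mulr0.
have sd : \sum_i d 0 i <= 1.
  apply: le_trans Ttr; rewrite TE -mulmxA mxtrace_mulC -mulmxA OO mulmx1.
  by rewrite /mxtrace le_eqVlt; apply/orP; left; apply/eqP; apply: eq_bigr => i _;
    rewrite mxE eqxx mulr1n.
have d1 i : d 0 i <= 1.
  apply: le_trans sd; rewrite (bigD1 i) //= lerDl; apply: sumr_ge0 => j _; exact: d0.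
have [|th [th1 th2 gap]] := spectral_gap (_ : 0 < c / 4) g0 d0 sd hK.
  by rewrite divr_gt0.
have th3 : th + g <= c / 2.
  have e (q : R) : q != 0 -> q * (c / (4 * q)) = c / 4 by move=> q0; field.
  apply: (le_trans th2); rewrite /g e ?pnatr_eq0 //; lra.
pose I := [set i | th + g <= d 0 i].
pose E : 'M[R]_(N, #|I|) := \matrix_(a, l) O (enum_val l) a.
have ETm m (X : 'M[R]_(N, m)) l j : (E^T *m X) l j = (O *m X) (enum_val l) j.
  by rewrite !mxE; apply: eq_bigr => a _; rewrite !mxE.
have OE i l : (O *m E) i l = (i == enum_val l)%:R.
  transitivity ((O *m O^T) i (enum_val l)); last by rewrite OO mxE.
  by rewrite !mxE; apply: eq_bigr => a _; rewrite !mxE.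
have sumI (F : 'I_N -> R) : \sum_(l < #|I|) F (enum_val l) = \sum_(i in I) F i.
  by rewrite -big_enum_val.
exists #|I|, E; split.
- have : \sum_(i in I) (c / 4) <= \sum_(i in I) d 0 i.
    by apply: ler_sum => i; rewrite inE => h; apply: le_trans h; lra.
  have : \sum_(i in I) d 0 i <= 1.
    apply: le_trans sd; rewrite big_mkcond /=; apply: ler_sum => i _; case: ifP => // _; exact: d0.
  rewrite sumr_const -[c / 4 *+ _]mulr_natl => h1 h2.
  rewrite -(ler_nat R) -(@ler_pM2r _ (c / 4)) ?divr_gt0 //; lra.
- apply/matrixP => l m; rewrite ETm OE mxE (inj_eq enum_val_inj) //.
- move=> b; rewrite dotT.
  have -> : dot (E^T *m b) (E^T *m b) = \sum_(i in I) (O *m b) i 0 ^+ 2.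
    rewrite -sumI /dot; apply: eq_bigr => l _; by rewrite big_ord1 ETm expr2.
  have -> : dot b b = \sum_i (O *m b) i 0 ^+ 2.
    by rewrite -(dot_orthl b b OO') /dot; apply: eq_bigr => i _; rewrite big_ord1 expr2.
  rewrite mulr_sumr [X in _ <= X + _]big_mkcond -big_split /=; apply: ler_sum => i _.
  have s0 := sqr_ge0 ((O *m b) i 0).
  rewrite inE; case: ifP => [h|h].
    have := d1 i; nra.
  have : d 0 i < th by case: (gap i) => //; rewrite h.
  move=> h1; rewrite add0r ler_wpM2r //; lra.
- move=> U UU.
  have -> : nrm (U *m T *m U^T - T) = nrm (U *m T - T *m U).
    rewrite /nrm -[in RHS](dot_orthr _ _ (_ : U^T *m (U^T)^T = 1%:M)).
      by rewrite mulmxBl -(mulmxA T) UU mulmx1.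
    by rewrite trmxK; exact: mulmx1C.
  rewrite !nrm_sq -(dot_orthl (U *m E - _) _ OO').
  rewrite -(dot_orthl (U *m T - _) (U *m T - T *m U) OO').
  rewrite -(dot_orthr (O *m (U *m T - _)) _ (_ : O^T *m (O^T)^T = 1%:M)); last by rewrite trmxK.
  pose Y := O *m U *m O^T.
  have e1 i j : (O *m (U *m T - T *m U) *m O^T) i j = (d 0 j - d 0 i) * Y i j.
    have -> : O *m (U *m T - T *m U) *m O^T = Y *m diag_mx d - diag_mx d *m Y.
      rewrite mulmxBr mulmxBl TE !mulmxA OO mul1mx /Y ?mulmxA.
      by rewrite -(mulmxA _ O O^T) OO mulmx1.
    by rewrite mul_mx_diag mul_diag_mx !mxE; ring.
  have e2 i l : (O *m (U *m E - E *m (E^T *m U *m E))) i l =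
      (i \notin I)%:R * Y i (enum_val l).
    have YE j : (O *m (U *m E)) j l = Y j (enum_val l).
      rewrite /Y mulmxA !mxE; apply: eq_bigr => a _; by rewrite !mxE.
    have subE (X1 X2 : 'M[R]_(N, #|I|)) : (X1 - X2) i l = X1 i l - X2 i l by rewrite !mxE.
    rewrite -(mulmxA E^T U E) mulmxBr subE YE (mulmxA O E) [(O *m E *m _) i l]mxE.
    have [iI|iI] := boolP (i \in I).
      rewrite (bigD1 (enum_rank_in iI i)) //= big1 ?addr0.
        by rewrite OE enum_rankK_in // eqxx mul1r ETm YE enum_rankK_in // subrr mul0r.
      move=> m mi; rewrite OE; case: eqP => [e|_]; last by rewrite mul0r.
      by case/eqP: mi; apply: enum_val_inj; rewrite enum_rankK_in.
    rewrite big1 ?oppr0 ?addr0 ?mul1r // => m _; rewrite OE; case: eqP => [e|_].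
      by move: iI; rewrite e enum_valP.
    by rewrite mul0r.
  rewrite /dot mulr_sumr; apply: ler_sum => i _.
  apply: (@le_trans _ _ (\sum_(j in I) ((d 0 j - d 0 i) * Y i j) ^+ 2)).
    rewrite -(sumI (fun j => ((d 0 j - d 0 i) * Y i j) ^+ 2)) mulr_sumr.
    apply: ler_sum => l _; rewrite e2 -expr2 !(exprMn _ _ (Y i (enum_val l))) mulrA.
    rewrite ler_wpM2r ?sqr_ge0 //; have [iI|iI] := boolP (i \in I).
      by rewrite expr0n mulr0 sqr_ge0.
    rewrite expr1n mulr1 (@ler_sqr R) ?nnegrE ?(ltW g0) //.
      have := enum_valP l; rewrite inE => h1.
      case: (gap i) => [h2|h2]; first lra.
      by move: iI; rewrite inE h2.
    have := enum_valP l; rewrite inE => h1.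
    case: (gap i) => [h2|h2]; first lra.
    by move: iI; rewrite inE h2.
  rewrite big_mkcond; apply: ler_sum => j _; rewrite e1 -expr2.
  by case: ifP => // _; exact: sqr_ge0.
Qed.

End Projection.

End Projections.

(** * Approximate representations *)

Section Approximation.
Import Order.TTheory GRing.Theory Num.Theory.
Local Open Scope classical_set_scope.
Local Open Scope ring_scope.

Lemma exp_beats_poly_real (R : realType) (C d : nat) (delta : R) : 0 < delta ->
  exists n, (C * n.+1 ^ d)%:R < (1 + delta) ^+ n.
Proof.
move=> d0; have d1 : 0 <= 1 + delta by lra.
have bern n : 1 + n%:R * delta <= (1 + delta) ^+ n.
  elim: n => [|n IH]; first by rewrite mul0r addr0 expr0.
  rewrite exprSr -natr1; have := ler_wpM2r d1 IH.
  have : 0 <= n%:R * delta * delta by rewrite !mulr_ge0 ?ler0n // ltW.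
  lra.
have [m hm] : exists m : nat, 1 <= m%:R * delta.
  exists (Num.bound delta^-1); rewrite -ler_pdivrMr // mul1r ltW //.
  by apply: archi_boundP; rewrite invr_ge0 ltW.
have [n hn] := exp_beats_poly C m d; exists (m * n)%N.
rewrite exprM; apply: (@lt_le_trans _ _ (2 ^ n)%:R); first by rewrite ltr_nat.
rewrite natrX lerXn2r ?nnegrE ?exprn_ge0 //.
by apply: le_trans (bern m); rewrite -[2%:R]/(1 + 1); lra.
Qed.

(** If all increments between [M] and [M'] were larger, [H] would gain [d.+1] times the logarithm,
    and [M'] is where this overtakes [ln (C * n.+1 ^ d)]. The range depends only on [C], [d] and
    [M], so it can be fixed before [H] is known. *)
Lemma good_scale (R : realType) (H : nat -> R) (C d : nat) (M : nat) : (0 < C)%N ->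
  H 0%N = 0 -> (forall n, H n <= H n.+1) -> (forall n, H n <= ln ((C * n.+1 ^ d)%:R : R)) ->
  exists n, [/\ (M <= n)%N, (n < C * M.+1 ^ d.+1)%N & H n.+1 - H n <= d.+1%:R / n.+1%:R].
Proof.
move=> C0 H0 Hmono HC; set M' := (C * M.+1 ^ d.+1)%N.
have MM' : (M < M')%N.
  by rewrite /M' expnS mulnCA leq_pmulr // muln_gt0 C0 expn_gt0.
have Hge0 n : 0 <= H n by elim: n => [|n IH]; [rewrite H0|apply: (le_trans IH)].
apply: contrapT => hno.
have lnS m : ln (m.+2%:R : R) - ln (m.+1%:R) <= m.+1%:R^-1.
  rewrite -ln_div ?posrE ?ltr0n //.
  have -> : m.+2%:R / m.+1%:R = 1 + m.+1%:R^-1 :> R.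
    by rewrite -[m.+2%:R]natr1 mulrDl divff ?mul1r // pnatr_eq0.
  by apply: le_ln1Dx; apply: (@lt_trans _ _ 0); rewrite ?invr_gt0 ?ltr0n // ltrN10.
have step m : (M + m <= M')%N ->
    d.+1%:R * (ln ((M + m).+1%:R : R) - ln (M.+1%:R)) <= H (M + m)%N.
  elim: m => [|m IH] hm; first by rewrite addn0 subrr mulr0.
  have h1 := IH (leq_trans (_ : M + m <= M + m.+1)%N hm).
  rewrite leq_add2l leqnSn in h1; have {}h1 := h1 isT.
  have h2 : d.+1%:R / (M + m).+1%:R < H (M + m).+1 - H (M + m)%N.
    rewrite ltNge; apply/negP => h; apply: hno; exists (M + m)%N; split=> //.
      by rewrite leq_addr.
    by rewrite -addnS.
  have h3 := ler_wpM2l (ler0n R d.+1) (lnS (M + m)%N).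
  rewrite addnS; move: h1 h2 h3.
  move: (ln (M + m).+1%:R) (ln (M + m).+2%:R) (ln M.+1%:R) (H (M + m)%N) (H (M + m).+1).
  move: (d.+1%:R : R) ((M + m).+1%:R^-1 : R) => D q x y z u w; nra.
have := step (M' - M)%N; rewrite subnKC ?(ltnW MM') // => /(_ (leqnn _)) h.
have h2 := HC M'.
have lM' : ln ((C * M'.+1 ^ d)%:R : R) = ln (C%:R : R) + d%:R * ln (M'.+1%:R : R).
  rewrite natrM lnM ?posrE ?ltr0n ?expn_gt0 // natrX lnXn ?ltr0n //.
  by rewrite mulr_natl.
have lM : ln (M'%:R : R) = ln (C%:R : R) + d.+1%:R * ln (M.+1%:R : R).
  rewrite natrM lnM ?posrE ?ltr0n ?expn_gt0 // natrX lnXn ?ltr0n //.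
  by rewrite mulr_natl.
have : ln (M'%:R : R) < ln (M'.+1%:R : R).
  by rewrite ltr_ln ?posrE ?ltr0n ?ltr_nat //; exact: leq_ltn_trans MM'.
rewrite lM; rewrite lM' in h2; rewrite -natr1 in h *.
by move: (ln C%:R) (ln M'.+1%:R) (ln M.+1%:R) h h2 => x y z; lra.
Qed.

Lemma mult1 (G Q : groupType) (phi : {multiplicative G -> Q}) : phi 1%g = 1%g.
Proof. by apply: (mulgI (phi 1%g)); rewrite -gmulfM !mulg1. Qed.

Lemma multV (G Q : groupType) (phi : {multiplicative G -> Q}) x : phi x^-1%g = (phi x)^-1%g.
Proof. by apply/esym/mulg1_eq; rewrite -gmulfM mulgV mult1. Qed.

Definition residually_finite (G : groupType) := forall s : seq G,
  exists (Q : finGroupType) (phi : {multiplicative G -> Q}), {in s &, injective phi}.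

Section ApproximateRepresentation.
Context {R : realType} {G : groupType}.
Variables (S : seq G) (d : nat).
Hypotheses (gS : growth S d) (infS : ~ fidx [set (1%g : G)] (gen S)).
Hypothesis (rf : residually_finite G).

Local Notation A := (letters S).
Local Notation k := ((size A)%:R : R).

Section Quotient.
Variables (Q : finGroupType) (phi : {multiplicative G -> Q}).
Let AQ := [seq phi a | a <- A].

Let AQ1 : (1%g : Q) \in AQ.
Proof. by rewrite -(mult1 phi); apply: map_f; exact: letters1. Qed.

Let AQV : perm_eq [seq a^-1%g | a <- AQ] AQ.
Proof.
have -> : [seq a^-1%g | a <- AQ] = [seq phi a | a <- [seq a^-1%g | a <- A]].
  by rewrite -!map_comp; apply: eq_map => a /=; rewrite multV.
apply: perm_map; rewrite /letters /= invg1 perm_cons map_cat.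
have -> : [seq a^-1%g | a <- [seq a^-1%g | a <- S]] = S.
  by rewrite -map_comp -[RHS]map_id; apply: eq_map => x /=; rewrite invgK.
by rewrite perm_catC.
Qed.

Definition ballQ n : {set Q} := [set x | `[< exists2 g, wball S n g & phi g = x >]].

Lemma ballQP n x : reflect (exists2 g, wball S n g & phi g = x) (x \in ballQ n).
Proof. by rewrite inE; exact: asboolP. Qed.

Lemma ballQ_card C : (forall n (s : seq G), uniq s -> (forall x, x \in s -> wball S n x) ->
    (size s <= C * n.+1 ^ d)%N) -> forall n, (#|ballQ n| <= C * n.+1 ^ d)%N.
Proof.
move=> hC n; pose f x := xget (1%g : G) [set g | wball S n g /\ phi g = x].
have fP x : x \in ballQ n -> wball S n (f x) /\ phi (f x) = x.
  move=> /ballQP [g bg gx].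
  by apply: (@xgetPex _ 1%g [set g | wball S n g /\ phi g = x]); exists g.
rewrite cardE -(size_map f); apply: hC.
  rewrite map_inj_in_uniq ?enum_uniq // => x y; rewrite !mem_enum => /fP [_ hx] /fP [_ hy] e.
  by rewrite -hx -hy e.
by move=> _ /mapP [x + ->]; rewrite mem_enum => /fP [].
Qed.

Lemma walk_supp n x : walk R AQ n x != 0 -> x \in ballQ n.
Proof.
elim: n x => [|n IH] x /=.
  by case: (x =P 1%g) => [-> _|_]; [apply/ballQP; exists 1%g => //; exact: mult1|rewrite eqxx].
move=> h; have [a aA ha] : exists2 a, a \in AQ & walk R AQ n (a^-1 * x)%g != 0.
  apply: contrapT => hno; move: h; rewrite big_seq big1 ?mulr0 ?eqxx // => a aA.
  by apply: contrapT => /eqP h; apply: hno; exists a.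
have /ballQP [g bg gx] := IH _ ha; case/mapP: aA => b bA e.
apply/ballQP; exists (b * g)%g; first exact: ballS.
by rewrite gmulfM gx e mulKVg.
Qed.

Lemma ballQ_sub n : ballQ n \subset <<[set x in AQ]>>%g.
Proof.
apply/fintype.subsetP => x /ballQP [g + <-] {x}.
elim: n g => [g ->|n IH g [a aA /IH h]]; first by rewrite mult1 group1.
rewrite -[g](mulVKg a) gmulfM groupM //; apply: mem_gen; rewrite inE; exact: map_f.
Qed.

Lemma ballQ_mono n : ballQ n \subset ballQ n.+1.
Proof.
apply/fintype.subsetP => x /ballQP [g bg gx]; apply/ballQP; exists g => //.
exact: ball_mono bg.
Qed.

Lemma ballQ_boundary n a : a \in AQ ->
  (#|[set x in ballQ n | (a * x)%g \notin ballQ n]| + #|ballQ n| <= #|ballQ n.+1|)%N.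
Proof.
case/mapP => b bA ->; set D := [set x in _ | _].
rewrite -(finset.card_imset D (mulgI (phi b))) -(finset.cardsID (ballQ n) (ballQ n.+1)).
have /finset.setIidPr -> := ballQ_mono n.
rewrite addnC leq_add2l subset_leq_card //; apply/fintype.subsetP => _ /imsetP [x + ->].
rewrite !inE -!/(ballQ _) => /andP [/asboolP [g bg gx] h]; rewrite h /=.
by apply/asboolP; exists (b * g)%g; [exact: ballS|rewrite gmulfM gx].
Qed.

(** Were the balls to grow by a factor above [1 + delta] at each radius below [n0], the ball of
    radius [n0] would break the polynomial bound. A radius of slow growth gives a set of small
    boundary, and the size of the image makes it at most half of the group. *)
Lemma quotient_spectral_gap C (delta : R) (n0 : nat) : 0 < delta ->
  (forall n, (#|ballQ n| <= C * n.+1 ^ d)%N) ->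
  (C * n0.+1 ^ d)%:R < (1 + delta) ^+ n0 ->
  (2 * (C * n0.+1 ^ d) <= #|<<[set x in AQ]>>%g|)%N ->
  exists lam (w : 'cV[R]_#|Q|), [/\ 0 < lam, lam <= 2 * delta, w != 0 &
    k^-1 *: (\sum_(a <- AQ) regular R a *m w) = (1 - lam) *: w].
Proof.
move=> d0 hC hn0 hP.
have B0 n : (0 < #|ballQ n|)%N.
  apply/card_gt0P; exists 1%g; apply/ballQP; exists 1%g; [exact: ball_one|exact: mult1].
have [n nn0 hn] : exists2 n, (n < n0)%N & #|ballQ n.+1|%:R <= (1 + delta) * #|ballQ n|%:R.
  apply: contrapT => hno; have : (1 + delta) ^+ n0 <= #|ballQ n0|%:R.
    have : (n0 <= n0)%N by []; elim: {-2}n0 => [|m IH] hm; first by rewrite expr0 ler1n B0.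
    have h1 := IH (ltnW hm); rewrite exprS; apply: (@le_trans _ _ ((1 + delta) * #|ballQ m|%:R)).
      by rewrite ler_wpM2l //; lra.
    by rewrite leNgt; apply/negP => h2; apply: hno; exists m => //; apply: ltW.
  rewrite leNgt (le_lt_trans _ hn0) // ler_nat; exact: hC.
have := @ball_eigenvector R Q AQ AQ1 AQV (ballQ n) delta (ballQ_sub n) (B0 n).
rewrite size_map; apply.
  apply: leq_trans hP; rewrite leq_mul2l /=; apply: (leq_trans (hC n)).
  by rewrite leq_mul2l leq_expn ?orbT // ltnS ltnW.
move=> a aA; have := ballQ_boundary n aA; rewrite -(ler_nat R) natrD.
move: hn; rewrite mulrDl mul1r; lra.
Qed.

End Quotient.

Lemma big_image_card (m : nat) : exists (Q : finGroupType) (phi : {multiplicative G -> Q}),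
  (m <= #|<<[set x in [seq phi a | a <- A]]>>%g|)%N.
Proof.
have [s [ss sS sf]] := not_fidx_free m (@sg_one G) infS.
have [Q [phi pinj]] := rf s; exists Q, phi.
have us := coset_free_uniq (@sg_one G) sf.
have u2 : uniq (map phi s) by rewrite map_inj_in_uniq.
rewrite -ss -(size_map phi) -(card_uniqP u2) subset_leq_card //.
apply/fintype.subsetP => _ /mapP [g /sS [n bg] ->].
by apply: (fintype.subsetP (ballQ_sub phi n)); apply/ballQP; exists g.
Qed.

(** The dimension [ar_N] is unbounded as [eps] tends to 0; only compressions by [ar_E], of fixed
    size [r], pass to the limit, and [ar_low] keeps the limit cocycle from vanishing. *)
Record approx_rep (r : nat) (c eps : R) := ApproxRep {
  ar_N : nat;
  ar_E : 'M[R]_(ar_N, r);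
  ar_rho : G -> 'M[R]_ar_N;
  ar_b : G -> 'cV[R]_ar_N;
  ar_EE : ar_E^T *m ar_E = 1%:M;
  ar_rhoM : forall x y, ar_rho (x * y)%g = ar_rho x *m ar_rho y;
  ar_rhoO : forall x, (ar_rho x)^T *m ar_rho x = 1%:M;
  ar_bM : forall x y, ar_b (x * y)%g = ar_b x + ar_rho x *m ar_b y;
  ar_inv : forall a, a \in A ->
    nrm (ar_rho a *m ar_E - ar_E *m (ar_E^T *m ar_rho a *m ar_E)) <= eps;
  ar_harm : nrm (k^-1 *: (\sum_(a <- A) ar_b a)) <= eps;
  ar_norm : k^-1 * (\sum_(a <- A) dot (ar_b a) (ar_b a)) = 1;
  ar_low : c <= k^-1 * (\sum_(a <- A) dot (ar_E^T *m ar_b a) (ar_E^T *m ar_b a))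
}.

Lemma approx_rep_exists : exists K c, 0 < c /\ forall eps, 0 < eps ->
  exists r, (r <= K)%N /\ inhabited (approx_rep r c eps).
Proof.
case: gS => C0 hC0; pose C := C0.+1.
have hC n (s : seq G) : uniq s -> (forall x, x \in s -> wball S n x) ->
    (size s <= C * n.+1 ^ d)%N.
  by move=> us hs; apply: (leq_trans (hC0 n s us hs)); rewrite leq_mul2r leqnSn orbT.
have k0 : 0 < k by rewrite ltr0n.
(* With this value an entropy increment of at most [d.+1 / n.+1] satisfies the hypothesis of
   [cocycle_covar_lower] for the constant [c^-1 / n.+1]. *)
pose c := (32 * k ^+ 2 * d.+1%:R)^-1.
have c0 : 0 < c by rewrite invr_gt0 !mulr_gt0 ?exprn_gt0 ?ltr0n.
have [K hK] : exists K : nat, 1 <= K%:R * (c / 4).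
  exists (Num.bound (c / 4)^-1); rewrite -ler_pdivrMr ?divr_gt0 // mul1r ltW //.
  by apply: archi_boundP; rewrite invr_ge0 ltW // divr_gt0.
exists K, (c / 2); split; first exact: divr_gt0.
move=> eps eps0; have [gam gamE] : {gam | gam = c / (4 * K.+1%:R)} by eexists.
have gam0 : 0 < gam by rewrite gamE divr_gt0 // mulr_gt0 // ltr0n.
(* A single letter moves the normalized covariance by at most [8 * k / n.+1] in squared norm; from
   scale [M] on this is below [(eps * gam) ^+ 2]. *)
have [M hM] : exists M : nat, 8 * k <= M.+1%:R * (eps * gam) ^+ 2.
  have e0 : 0 < (eps * gam) ^+ 2 by rewrite exprn_gt0 // mulr_gt0.
  exists (Num.bound (8 * k / (eps * gam) ^+ 2)); rewrite -ler_pdivrMr //.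
  apply: (@le_trans _ _ (Num.bound (8 * k / (eps * gam) ^+ 2))%:R); last by rewrite ler_nat.
  by apply/ltW/archi_boundP; apply: divr_ge0; [rewrite mulr_ge0 ?ler0n|exact: ltW].
have [M' M'E] : {M' | M' = (C * M.+1 ^ d.+1)%N} by exists (C * M.+1 ^ d.+1)%N.
(* The three bounds give [n * lam <= 1 / 4] at every admissible scale, a harmonic defect of squared
   norm [lam / 2 <= eps ^+ 2], and [lam <= 1]. The quotient is chosen only after [delta]. *)
pose delta := Num.min ((8 * M'.+1%:R)^-1) (Num.min (eps ^+ 2) 2^-1) : R.
have delta0 : 0 < delta.
  by rewrite !lt_min; apply/and3P; split; [rewrite invr_gt0 mulr_gt0 ?ltr0n|exact: exprn_gt0|rewrite invr_gt0].
have [n0 hn0] := exp_beats_poly_real C d delta0.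
have [Q [phi hP]] := big_image_card (2 * (C * n0.+1 ^ d))%N.
pose AQ := [seq phi a | a <- A].
have AQ1 : (1%g : Q) \in AQ by rewrite -(mult1 phi); apply: map_f; exact: letters1.
have cardB := ballQ_card phi hC.
have [lam [w [lam0 lamd w0 hw]]] := quotient_spectral_gap delta0 cardB hn0 hP.
have [ld1 ld2 ld3] : [/\ lam <= 2 * (8 * M'.+1%:R)^-1, lam <= 2 * eps ^+ 2 & lam <= 1].
  split; apply: (le_trans lamd).
  - by rewrite ler_pM2l // /delta ge_min lexx.
  - by rewrite ler_pM2l // /delta !ge_min lexx !orbT.
  - by have : delta <= 2^-1 by [rewrite /delta !ge_min lexx !orbT]; lra.
pose v := (Num.sqrt (2 * lam * dot w w))^-1 *: w.
have dw : 0 < dot w w := dot_gt0 w0.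
have nv : dot v v = (2 * lam)^-1.
  rewrite dotZl dotZr mulrA -expr2 exprVn sqr_sqrtr ?mulr_ge0 ?(ltW dw) ?(ltW lam0) //.
  by rewrite [in LHS]invfM mulfVK // gt_eqF.
have hv : (size AQ)%:R^-1 *: (\sum_(a <- AQ) regular R a *m v) = (1 - lam) *: v.
  rewrite size_map /v; under eq_bigr do rewrite -scalemxAr.
  by rewrite -scaler_sumr scalerA mulrC -scalerA hw !scalerA mulrC.
have rM := @regularM R Q; have rO := @regularO R Q.
have [n [Mn nM' hent]] : exists n, [/\ (M <= n)%N, (n < M')%N &
    entropy R AQ n.+1 - entropy R AQ n <= d.+1%:R / n.+1%:R].
  rewrite M'E; apply: (good_scale M (C := C)) => //; first exact: entropy0.
    by move=> n; exact: entropy_mono.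
  move=> n; apply: (le_trans (entropy_le AQ1 (@walk_supp _ phi n))).
  have cb := cardB n.
  have b0 : (0 < #|ballQ phi n|)%N.
    apply/card_gt0P; exists 1%g; apply/ballQP; exists 1%g; [exact: ball_one|exact: mult1].
  by rewrite ler_ln ?posrE ?ltr0n ?ler_nat // (leq_trans b0).
have n1 : 0 < n.+1%:R :> R by rewrite ltr0n.
pose b := cocycle (@regular R Q) v.
pose Tn := covar AQ (@regular R Q) v n.+1.
pose T := n.+1%:R^-1 *: Tn.
have low : c <= k^-1 * \sum_(a <- AQ) dot (T *m b a) (b a).
  have := @cocycle_covar_lower R Q AQ AQ1 _ _ rM rO v lam lam0 ld3 hv nv n (c^-1 / n.+1%:R).
  rewrite size_map -/Tn -/b => h.
  have {}h : 1 <= c^-1 / n.+1%:R * (k^-1 * \sum_(a <- AQ) dot (Tn *m b a) (b a)).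
    apply: h.
    - by apply: divr_ge0; [rewrite invr_ge0|]; exact: ltW.
    - have : n%:R * lam <= M'.+1%:R * (2 * (8 * M'.+1%:R)^-1).
        apply: ler_pM; [exact: ler0n|exact: ltW| |exact: ld1].
        by rewrite ler_nat ltnW // ltnS ltnW.
      have e (q : R) : q != 0 -> q * (2 * (8 * q)^-1) = 4^-1 by move=> q0; field.
      rewrite e ?pnatr_eq0 //; lra.
    - rewrite /c invrK; have := ler_wpM2l (_ : 0 <= 16 * k ^+ 2) hent.
      rewrite mulr_ge0 ?sqr_ge0 // => /(_ isT) h1; apply: (le_trans h1).
      have e (x y q : R) : q != 0 -> 16 * x * (y / q) = 32 * x * y / q / 2 by move=> q0; field.
      by rewrite e ?pnatr_eq0.
  have -> : \sum_(a <- AQ) dot (T *m b a) (b a) = n.+1%:R^-1 * \sum_(a <- AQ) dot (Tn *m b a) (b a).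
    by rewrite mulr_sumr; apply: eq_bigr => a _; rewrite -scalemxAl dotZl.
  have := ler_wpM2l (ltW c0) h; rewrite mulr1 !mulrA divff ?gt_eqF // mul1r.
  by rewrite [_^-1 * k^-1]mulrC.
have Tsym : T^T = T by rewrite /T linearZ /= covar_tr.
have Tpos (u : 'cV_#|Q|) : 0 <= dot (T *m u) u.
  rewrite -scalemxAl dotZl mulr_ge0 ?invr_ge0 ?(ltW n1) //.
  rewrite /Tn /covar mulmx_suml dot_suml; apply: sumr_ge0 => x _.
  rewrite -scalemxAl dotZl mulr_ge0 ?walk_ge0 // -mulmxA dot_mulmxl.
  exact: dot_ge0.
have Ttr : \tr T <= 1.
  rewrite /T mxtraceZ ler_pdivrMl // mulr1.
  apply: le_trans (cocycle_sq_mean_le AQ1 rM rO lam0 ld3 hv nv n.+1).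
  rewrite /Tn /covar raddf_sum le_eqVlt; apply/orP; left; apply/eqP.
  by apply: eq_bigr => x _; rewrite /= mxtraceZ dot_tr.
have [r [E [rK EE hE1 hE2]]] := spectral_projection Tsym Tpos Ttr c0 hK.
rewrite -gamE in hE2.
have hb1 := cocycle_avg_sq AQ1 rO lam0 hv nv.
exists r; split=> //; constructor.
apply: (@ApproxRep r (c / 2) eps #|Q| E (fun g => regular R (phi g)) (fun g => b (phi g)) EE).
- by move=> x y /=; rewrite gmulfM rM.
- by move=> x; exact: rO.
- by move=> x y; rewrite gmulfM /b cocycleM.
- move=> a aA; rewrite -(@ler_pM2l _ gam) //.
  have pa : phi a \in AQ by exact: map_f.
  have hU := hE2 (regular R (phi a)) (mulmx1C (rO _)).
  rewrite -(@ler_sqr R) ?nnegrE ?mulr_ge0 ?nrm_ge0 ?(ltW gam0) ?(ltW eps0) //.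
  rewrite exprMn; apply: (le_trans hU).
  have := covar_conj_dist AQ1 rM rO lam0 ld3 hv nv n.+1; rewrite -/Tn size_map.
  rewrite ler_pdivrMl // => h1.
  have h2 : nrm (regular R (phi a) *m Tn *m (regular R (phi a))^T - Tn) ^+ 2 <= k * (8 * n.+1%:R).
    apply: le_trans h1; rewrite (big_rem _ pa) /= lerDl.
    by apply: sumr_ge0 => x _; exact: sqr_ge0.
  have -> : regular R (phi a) *m T *m (regular R (phi a))^T - T =
      n.+1%:R^-1 *: (regular R (phi a) *m Tn *m (regular R (phi a))^T - Tn).
    by rewrite /T -scalemxAr -scalemxAl scalerBr.
  rewrite nrmZ ger0_norm ?invr_ge0 ?(ltW n1) // exprMn exprVn ler_pdivrMl ?exprn_gt0 //.
  apply: (le_trans h2).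
  have : M.+1%:R <= n.+1%:R :> R by rewrite ler_nat.
  have := sqr_ge0 (eps * gam); rewrite [gam * eps]mulrC.
  move: ((eps * gam) ^+ 2) hM => e hM e0 hMn.
  have h3 : 8 * k <= n.+1%:R * e by apply: (le_trans hM); rewrite ler_wpM2r.
  have := ler_wpM2r (ltW n1) h3; lra.
- rewrite /=; have := cocycle_avg AQ1 (rho := @regular R Q) hv; rewrite size_map big_map -/b => e.
  rewrite [X in nrm X](_ : _ = - lam *: v); last exact: e.
  rewrite nrmZ normrN gtr0_norm //.
  rewrite -(@ler_sqr R) ?nnegrE ?mulr_ge0 ?nrm_ge0 ?(ltW lam0) ?(ltW eps0) //.
  rewrite exprMn nrm_sq nv.
  have -> : lam ^+ 2 / (2 * lam) = lam / 2 by field; rewrite gt_eqF.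
  lra.
- by move: hb1; rewrite size_map big_map.
- move: hb1; rewrite size_map big_map => hb1.
  move: low; rewrite big_map => low.
  set kk := k^-1 in low hb1 *; have kk0 : 0 <= kk by rewrite invr_ge0 ltW.
  have : kk * (\sum_(a <- A) dot (T *m b (phi a)) (b (phi a))) <=
     kk * (\sum_(a <- A) (dot (E^T *m b (phi a)) (E^T *m b (phi a)) +
        c / 2 * dot (b (phi a)) (b (phi a)))).
    by rewrite ler_wpM2l //; apply: ler_sum => a _; exact: hE1.
  rewrite big_split /= mulrDr -mulr_sumr mulrCA hb1 mulr1; lra.
Qed.

End ApproximateRepresentation.

End Approximation.

(** * Ultralimits *)

Section Limits.
Import Order.TTheory GRing.Theory Num.Theory.
Import numFieldNormedType.Exports.
Local Open Scope classical_set_scope.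
Local Open Scope ring_scope.

Section UltraLimit.
Variables (R : realType) (F : set_system nat).
Context {FU : UltraFilter F}.
Hypothesis (Foo : eventually `<=` F).

Lemma ultra_bounded (f : nat -> R) (B : R) : (forall m, `|f m| <= B) ->
  exists l : R, f @ F --> l.
Proof.
move=> fB; have cpt := @segment_compact R (- B) B.
have UG : UltraFilter (f @ F).
  split; first exact: fmap_proper_filter.
  move=> H HF sub; apply/seteqP; split=> // A HA; apply: contrapT => nA.
  have [//|nf] := in_ultra_setVsetC (f @^-1` A) FU.
  have HC : H (~` A) by apply: sub.
  have : H (A `&` ~` A) by apply: filterI.
  by rewrite setICr; exact: filter_not_empty.
rewrite compact_ultra in cpt.
have [|l [_ hl]] := cpt _ UG.
  suff : F (f @^-1` [set` `[- B, B]]) by [].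
  by apply: filterE => m /=; rewrite in_itv /= -ler_norml.
by exists l.
Qed.

Definition mconv p q (f : nat -> 'M[R]_(p, q)) (L : 'M[R]_(p, q)) :=
  forall i j, (fun m => f m i j) @ F --> L i j.

Lemma mconv_bounded p q (f : nat -> 'M[R]_(p, q)) (B : R) : (forall m, nrm (f m) <= B) ->
  exists L, mconv f L.
Proof.
move=> fB.
have h (ij : 'I_p * 'I_q) : exists l : R, (fun m => f m ij.1 ij.2) @ F --> l.
  apply: (@ultra_bounded _ B) => m; apply: le_trans (fB m); exact: nrm_entry.
have [g hg] := choice h; exists (\matrix_(i, j) g (i, j)) => i j.
by rewrite mxE; exact: (hg (i, j)).
Qed.

Lemma mconv_unique p q (f : nat -> 'M[R]_(p, q)) L1 L2 : mconv f L1 -> mconv f L2 -> L1 = L2.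
Proof.
move=> h1 h2; apply/matrixP => i j.
exact: (cvg_unique _ (h1 i j) (h2 i j)).
Qed.

Lemma mconvD p q (f g : nat -> 'M[R]_(p, q)) L1 L2 : mconv f L1 -> mconv g L2 ->
  mconv (fun m => f m + g m) (L1 + L2).
Proof.
move=> h1 h2 i j; rewrite mxE; under eq_fun do rewrite mxE.
exact: (cvgD (h1 i j) (h2 i j)).
Qed.

Lemma cvg_bigsum (I : finType) (f : nat -> I -> R) (l : I -> R) :
  (forall i, (fun m => f m i) @ F --> l i) ->
  (fun m => \sum_i f m i) @ F --> \sum_i l i.
Proof.
move=> h; elim: (index_enum I) => [|i s IH].
  by rewrite big_nil; under eq_fun do rewrite big_nil; exact: cvg_cst.
rewrite big_cons; under eq_fun do rewrite big_cons.
exact: (cvgD (h i) IH).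
Qed.

Lemma mconvM p q r (f : nat -> 'M[R]_(p, q)) (g : nat -> 'M[R]_(q, r)) L1 L2 :
  mconv f L1 -> mconv g L2 -> mconv (fun m => f m *m g m) (L1 *m L2).
Proof.
move=> h1 h2 i j; rewrite mxE; under eq_fun do rewrite mxE.
by apply: cvg_bigsum => k; exact: (cvgM (h1 i k) (h2 k j)).
Qed.

Lemma mconv_tr p q (f : nat -> 'M[R]_(p, q)) L : mconv f L -> mconv (fun m => (f m)^T) L^T.
Proof. by move=> h i j; rewrite mxE; under eq_fun do rewrite mxE; exact: h. Qed.

Lemma mconv_cst p q (L : 'M[R]_(p, q)) : mconv (fun=> L) L.
Proof. by move=> i j; exact: cvg_cst. Qed.

Lemma mconv_dot p q (f : nat -> 'M[R]_(p, q)) L : mconv f L ->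
  (fun m => dot (f m) (f m)) @ F --> dot L L.
Proof.
move=> h; apply: cvg_bigsum => i; apply: cvg_bigsum => j.
exact: (cvgM (h i j) (h i j)).
Qed.

Lemma mconv_small p q (f : nat -> 'M[R]_(p, q)) (c : R) :
  (forall m, nrm (f m) <= c / m.+1%:R) -> mconv f 0.
Proof.
move=> h i j; rewrite mxE.
have c1 : (fun m : nat => c / m.+1%:R) @ F --> (0 : R).
  have : (fun m : nat => c * harmonic m) @ \oo --> c * (0 : R).
    by apply: cvgM; [exact: cvg_cst|exact: cvg_harmonic].
  rewrite mulr0 => hc; apply: cvg_trans hc => A hA; exact: Foo.
apply: norm_cvg0; apply: (@squeeze_cvgr _ _ _ _ (cst 0) (fun m => c / m.+1%:R)) => //.
  apply: filterE => m; rewrite normr_ge0 /=.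
  apply: le_trans (h m); exact: nrm_entry.
exact: cvg_cst.
Qed.

Lemma mconv_close p q (f g : nat -> 'M[R]_(p, q)) L : mconv f L ->
  mconv (fun m => g m - f m) 0 -> mconv g L.
Proof.
move=> h1 h2; have := mconvD h1 h2; rewrite addr0.
by under [X in mconv X]eq_fun do rewrite addrC subrK.
Qed.

End UltraLimit.

End Limits.

(** * The limit cocycle *)

Section LimitCocycle.
Import Order.TTheory GRing.Theory Num.Theory.
Import numFieldNormedType.Exports.
Local Open Scope classical_set_scope.
Local Open Scope ring_scope.

Section OneApprox.
Context {R : realType} {G : groupType}.
Variables (S : seq G) (r : nat) (c eps : R) (X : approx_rep S r c eps).
Local Notation A := (letters S).
Local Notation k := ((size A)%:R : R).
Local Notation E := (ar_E X).
Local Notation rho := (ar_rho X).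
Local Notation b := (ar_b X).

(** Compressions to the span of [E]. They obey the representation and cocycle laws up to [defect],
    the component of [rho g *m E] orthogonal to that span. *)
Definition comp (g : G) : 'M[R]_r := E^T *m rho g *m E.
Definition compb (g : G) : 'cV[R]_r := E^T *m b g.
Definition defect (g : G) := rho g *m E - E *m comp g.

Let rhoM := ar_rhoM X.
Let rhoO := ar_rhoO X.
Let EE := ar_EE X.
Let rhoO' g : rho g *m (rho g)^T = 1%:M. Proof. exact: mulmx1C. Qed.
Let rho1 : rho 1%g = 1%:M.
Proof. by rewrite -[LHS]mulmx1 -(rhoO' 1%g) mulmxA -rhoM mulg1. Qed.
Let rhoV g : rho g^-1%g = (rho g)^T.
Proof. by rewrite -[LHS]mulmx1 -(rhoO' g) mulmxA -rhoM mulVg rho1 mul1mx. Qed.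

Lemma nrm_orthl p q (U : 'M[R]_p) (Y : 'M[R]_(p, q)) : U^T *m U = 1%:M -> nrm (U *m Y) = nrm Y.
Proof. by move=> h; rewrite /nrm dot_orthl. Qed.

Lemma nrmE : nrm E = Num.sqrt r%:R.
Proof. by rewrite /nrm dot_tr mxtrace_mulC EE mxtrace1. Qed.

Lemma nrmE_le : nrm E <= r.+1%:R.
Proof.
rewrite nrmE; apply: (@le_trans _ _ (Num.sqrt (r.+1%:R ^+ 2))).
  by rewrite ler_sqrt ?exprn_ge0 ?ler0n // -natrX ler_nat; nia.
by rewrite sqrtr_sqr ger0_norm ?ler0n.
Qed.

Lemma nrmET p (Y : 'M[R]_(_, p)) : nrm (E^T *m Y) <= r.+1%:R * nrm Y.
Proof.
apply: (le_trans (nrmM _ _)); rewrite nrm_tr ler_wpM2r ?nrm_ge0 //; exact: nrmE_le.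
Qed.

Lemma nrmEl p (Y : 'M[R]_(r, p)) : nrm (E *m Y) = nrm Y.
Proof. by rewrite /nrm dot_orthl. Qed.

Lemma nrm_comp g : nrm (comp g) <= r.+1%:R * r.+1%:R.
Proof.
rewrite /comp -mulmxA; apply: (le_trans (nrmET _)).
by rewrite ler_wpM2l ?ler0n // nrm_orthl // nrmE_le.
Qed.

Lemma defect_split g : rho g *m E = E *m comp g + defect g.
Proof. by rewrite /defect addrC subrK. Qed.

Lemma defect_orth g : E^T *m defect g = 0.
Proof. by rewrite /defect mulmxBr (mulmxA E^T E) EE mul1mx /comp mulmxA subrr. Qed.

Lemma defect1 : defect 1%g = 0.
Proof. by rewrite /defect /comp rho1 mul1mx mulmx1 EE mulmx1 subrr. Qed.

Lemma defectM g h : nrm (defect (g * h)%g) <=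
  nrm (defect g) * (r.+1%:R * r.+1%:R) + (1 + r.+1%:R) * nrm (defect h).
Proof.
have -> : defect (g * h)%g = defect g *m comp h +
    (rho g *m defect h - E *m (E^T *m (rho g *m defect h))).
  rewrite {1}/defect {1}/comp rhoM -!mulmxA (defect_split h) !mulmxDr.
  rewrite opprD addrACA; congr (_ + _); rewrite /defect mulmxBl /comp.
  by rewrite !mulmxA.
apply: (le_trans (nrmD _ _)); apply: lerD.
  apply: (le_trans (nrmM _ _)); rewrite ler_wpM2l ?nrm_ge0 //; exact: nrm_comp.
apply: (le_trans (nrmB _ _)); rewrite mulrDl mul1r nrm_orthl // lerD2l.
rewrite nrmEl; apply: (le_trans (nrmET _)).
by rewrite nrm_orthl.
Qed.

Lemma compM_err g h : nrm (comp (g * h)%g - comp g *m comp h) <= r.+1%:R * nrm (defect h).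
Proof.
have -> : comp (g * h)%g - comp g *m comp h = E^T *m (rho g *m defect h).
  by rewrite /defect !mulmxBr /comp rhoM !mulmxA.
by apply: (le_trans (nrmET _)); rewrite nrm_orthl.
Qed.

Lemma comp_orth_err g : nrm ((comp g)^T *m comp g - 1%:M) <= nrm (defect g) * nrm (defect g).
Proof.
have e : (rho g *m E)^T *m (rho g *m E) = 1%:M.
  by rewrite trmx_mul -mulmxA (mulmxA _^T (rho g)) rhoO mul1mx EE.
have e2 : (comp g)^T *m comp g - 1%:M = - ((defect g)^T *m defect g).
  rewrite -e (defect_split g); move: (defect g) (defect_orth g) (comp g) => D dO Y.
  have e0 : (E *m Y + D)^T = Y^T *m E^T + D^T.
    by rewrite -(trmx_mul E Y); apply/matrixP => i j; rewrite !mxE.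
  rewrite e0 !(mulmxDl, mulmxDr).
  have -> : Y^T *m E^T *m (E *m Y) = Y^T *m Y.
    by rewrite -mulmxA (mulmxA E^T) EE mul1mx.
  have -> : Y^T *m E^T *m D = 0 by rewrite -mulmxA dO mulmx0.
  have -> : D^T *m (E *m Y) = 0.
    by rewrite mulmxA -[E]trmxK -trmx_mul dO trmx0 mul0mx.
  by rewrite addr0 add0r opprD addrA subrr add0r.
by rewrite e2 nrmN; apply: (le_trans (nrmM _ _)); rewrite nrm_tr.
Qed.

Lemma compb_err g h : nrm (compb (g * h)%g - (compb g + comp g *m compb h)) <=
  nrm (defect g^-1%g) * nrm (b h).
Proof.
have -> : compb (g * h)%g - (compb g + comp g *m compb h) = (defect g^-1%g)^T *m b h.
  rewrite /compb (ar_bM X) mulmxDr opprD addrACA subrr add0r.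
  rewrite /defect linearB /= mulmxBl; congr (_ - _).
    by rewrite trmx_mul rhoV trmxK mulmxA.
  by rewrite /comp !trmx_mul rhoV !trmxK !mulmxA.
by apply: (le_trans (nrmM _ _)); rewrite nrm_tr.
Qed.

(** The factor per letter comes from [(r + 1)^2 + (r + 2) <= (r + 3)^2]. Exponential dependence on
    [n] is harmless, as the limit is taken with [g] fixed and [eps] tending to 0. *)
Lemma defect_ball n g : 0 <= eps -> wball S n g ->
  nrm (defect g) <= (r.+3%:R ^+ (2 * n)) * eps.
Proof.
move=> e0; elim: n g => [g ->|n IH g [a aA /IH h]].
  by rewrite defect1 nrm0 mulr_ge0 ?exprn_ge0 ?ler0n.
rewrite -[g](mulVKg a); apply: (le_trans (defectM _ _)).
have ha : nrm (defect a) <= eps by exact: (ar_inv X aA).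
have p1 : 1 <= r.+3%:R ^+ (2 * n) :> R by rewrite exprn_ege1 // ler1n.
have rE : r.+3%:R = r%:R + 3 :> R by rewrite -[r.+3]addn3 natrD.
have rE1 : r.+1%:R = r%:R + 1 :> R by rewrite -[r.+1]addn1 natrD.
have r0 : 0 <= r%:R :> R by rewrite ler0n.
rewrite mulnS exprD expr2 rE rE1 in p1 h *.
move: (_ ^+ (2 * n)) p1 h => p p1 h.
move: (nrm (defect a)) (nrm_ge0 (defect a)) ha (nrm (defect _)) h => x x0 xe y yp.
move: (r%:R : R) r0 => q q0.
have h1 : x * ((q + 1) * (q + 1)) <= p * eps * ((q + 1) * (q + 1)).
  rewrite ler_wpM2r ?mulr_ge0 ?addr_ge0 //; apply: (le_trans xe); nra.
have h2 : (1 + (q + 1)) * y <= (1 + (q + 1)) * (p * eps).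
  by rewrite ler_wpM2l // !addr_ge0.
have pe : 0 <= p * eps by nra.
apply: (le_trans (lerD h1 h2)).
have -> : (q + 3) * (q + 3) * p * eps = (q + 3) * (q + 3) * (p * eps) by ring.
move: (p * eps) pe => z z0; nra.
Qed.

Lemma b_ball n g : wball S n g -> nrm (b g) <= n%:R * k.
Proof.
have k1 : 1 <= k by rewrite ler1n.
elim: n g => [g ->|n IH g [a aA /IH h]].
  have e : b 1%g = 0.
    have := ar_bM X 1%g 1%g; rewrite mulg1 rho1 mul1mx => /esym/eqP.
    by rewrite -subr_eq0 addrK => /eqP.
  by rewrite e nrm0 mul0r.
rewrite -[g](mulVKg a) (ar_bM X); apply: (le_trans (nrmD _ _)).
rewrite nrm_orthl // -natr1 mulrDl mul1r addrC lerD //.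
apply: nrm_le; first by apply: le_trans k1.
apply: (@le_trans _ _ k); last by rewrite expr2 ler_peMr // (le_trans _ k1).
have := ar_norm X; move/(congr1 ( *%R k)); rewrite mulr1 mulVKf ?gt_eqF ?(lt_le_trans ltr01 k1) // => <-.
rewrite (big_rem a aA) /= lerDl; apply: sumr_ge0 => x _; exact: dot_ge0.
Qed.

End OneApprox.

(** The compressions are bounded for each element of [gen S], so they converge along an ultrafilter;
    the defects tend to 0 and the exact identities appear in the limit, while [ar_low] survives as
    positivity. *)
Theorem finite_dimensional_cocycle (R : realType) (G : groupType) (S : seq G) (d : nat) :
  growth S d -> ~ fidx [set (1%g : G)] (gen S) -> residually_finite G ->
  exists r (u : G -> 'M[R]_r) (beta : G -> 'cV[R]_r),
  [/\ (forall x y, gen S x -> gen S y -> u (x * y)%g = u x *m u y),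
      (forall x, gen S x -> (u x)^T *m u x = 1%:M),
      (forall x y, gen S x -> gen S y -> beta (x * y)%g = beta x + u x *m beta y),
      \sum_(a <- letters S) beta a = 0 &
      0 < \sum_(a <- letters S) dot (beta a) (beta a)].
Proof.
move=> gS infS rf.
have [K [c [c0 hA]]] := @approx_rep_exists R G S d gS infS rf.
have mono r e1 e2 : e1 <= e2 -> approx_rep S r c e1 -> approx_rep S r c e2.
  move=> e12 [N E rho b EE rhoM rhoO bM inv harm norm low].
  apply: (@ApproxRep R G S r c e2 N E rho b) => //.
    by move=> a aA; exact: le_trans (inv a aA) e12.
  exact: le_trans harm e12.
(* Finitely many ranks are possible. If each failed at some precision, all would fail at the finest
   of these precisions. *)
have [r hr] : exists r, forall m : nat, inhabited (approx_rep S r c (m.+1%:R^-1)).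
  apply: contrapT => hno.
  have h r : exists m : nat, ~ inhabited (approx_rep S r c (m.+1%:R^-1)).
    by apply: contrapT => h; apply: hno; exists r => m; apply: contrapT => h2; apply: h; exists m.
  have [f hf] := choice h.
  pose M := \max_(r < K.+1) f r.
  have [|r [rK [X]]] := hA (M.+1%:R^-1); first by rewrite invr_gt0 ltr0n.
  apply: (hf r); constructor; apply: mono X.
  rewrite lef_pV2 ?posrE ?ltr0n // ler_nat ltnS.
  exact: (leq_bigmax (Ordinal (_ : (r < K.+1)%N))).
have [X _] : exists X : forall m : nat, approx_rep S r c (m.+1%:R^-1), True.
  have h m : exists _ : approx_rep S r c (m.+1%:R^-1), True by case: (hr m) => X; exists X.
  by exists (fun m => projT1 (cid (h m))).
have [F [FU Foo]] := ultraFilterLemma eventually_filter.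
have eps0 m : 0 <= m.+1%:R^-1 :> R by rewrite invr_ge0 ler0n.
have cu g : exists L, mconv F (fun m => comp (X m) g) L.
  by apply: mconv_bounded => m; exact: nrm_comp.
have [u hu] := choice cu.
have cb g : exists L, gen S g -> mconv F (fun m => compb (X m) g) L.
  have [[n bg]|ng] := pselect (gen S g); last by exists 0.
  have [|L hL] := @mconv_bounded R F FU _ _ (fun m => compb (X m) g)
     (r.+1%:R * (n%:R * (size (letters S))%:R)); last by exists L.
  move=> m /=; apply: (le_trans (nrmET _)); rewrite ler_wpM2l ?ler0n //.
  exact: (b_ball (X m) bg).
have [beta hb] := choice cb.
have sG := sg_gen S.
have k0 : 0 < (size (letters S))%:R :> R by rewrite ltr0n.
exists r, u, beta; split.
- move=> x y Sx [n by_]; apply: (mconv_unique (hu (x * y)%g)).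
  apply: (mconv_close (mconvM (hu x) (hu y))).
  apply: (mconv_small Foo (c := r.+1%:R * r.+3%:R ^+ (2 * n))) => m.
  apply: (le_trans (compM_err _ _ _)); rewrite -mulrA ler_wpM2l ?ler0n //.
  exact: (defect_ball (X m) (eps0 m) by_).
- move=> x [n bx]; apply: (mconv_unique (mconvM (mconv_tr (hu x)) (hu x))).
  apply: (mconv_close (@mconv_cst R F _ r r 1%:M)).
  apply: (mconv_small Foo (c := r.+3%:R ^+ (2 * n) * r.+3%:R ^+ (2 * n))) => m.
  apply: (le_trans (comp_orth_err _ _)).
  have h := defect_ball (X m) (eps0 m) bx.
  apply: (le_trans (ler_pM (nrm_ge0 _) (nrm_ge0 _) h h)).
  rewrite -!mulrA ler_wpM2l ?exprn_ge0 ?ler0n // mulrCA ler_wpM2l ?exprn_ge0 ?ler0n //.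
  by rewrite ler_piMl // invf_le1 ?ltr0n // ler1n.
- move=> x y Sx Sy; apply: (mconv_unique (hb _ (sgM sG Sx Sy))).
  apply: (mconv_close (mconvD (hb x Sx) (mconvM (hu x) (hb y Sy)))).
  have [n bx] := sgV sG Sx; have [l by_] := Sy.
  apply: (mconv_small Foo (c := r.+3%:R ^+ (2 * n) * (l%:R * (size (letters S))%:R))) => m.
  apply: (le_trans (compb_err _ _ _)); rewrite mulrAC.
  apply: ler_pM; rewrite ?nrm_ge0 //; first exact: (defect_ball (X m) (eps0 m) bx).
  exact: (b_ball (X m) by_).
- have e1 : mconv F (fun m => \sum_(a <- letters S) compb (X m) a) (\sum_(a <- letters S) beta a).
    have : forall a, a \in letters S -> gen S a by move=> a; exact: gen_letter.
    elim: (letters S) => [|a s IH] hs.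
      by rewrite big_nil; under [X in mconv _ X]eq_fun do rewrite big_nil; exact: mconv_cst.
    rewrite big_cons; under [X in mconv _ X]eq_fun do rewrite big_cons.
    apply: mconvD; last by apply: IH => x xs; apply: hs; rewrite inE xs orbT.
    by apply: hb; apply: hs; exact: mem_head.
  apply: (mconv_unique e1).
  apply: (mconv_small Foo (c := (size (letters S))%:R * r.+1%:R)) => m.
  have -> : \sum_(a <- letters S) compb (X m) a = (size (letters S))%:R *:
      ((ar_E (X m))^T *m ((size (letters S))%:R^-1 *: (\sum_(a <- letters S) ar_b (X m) a))).
    by rewrite -scalemxAr scalerA divff ?gt_eqF // scale1r mulmx_sumr.
  rewrite nrmZ ger0_norm ?ler0n // -mulrA ler_wpM2l ?ler0n //.
  apply: (le_trans (nrmET _)); rewrite ler_wpM2l ?ler0n //.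
  exact: (ar_harm (X m)).
- have e1 : (fun m => \sum_(a <- letters S) dot (compb (X m) a) (compb (X m) a)) @ F -->
     \sum_(a <- letters S) dot (beta a) (beta a).
    have : forall a, a \in letters S -> gen S a by move=> a; exact: gen_letter.
    elim: (letters S) => [|a s IH] hs.
      by rewrite big_nil; under eq_fun do rewrite big_nil; exact: cvg_cst.
    rewrite big_cons; under eq_fun do rewrite big_cons.
    apply: cvgD; last by apply: IH => x xs; apply: hs; rewrite inE xs orbT.
    by apply: mconv_dot; apply: hb; apply: hs; exact: mem_head.
  apply: (@lt_le_trans _ _ ((size (letters S))%:R * c)); first exact: mulr_gt0.
  rewrite -(cvg_lim _ e1) //; apply: limr_ge; first by apply/cvg_ex; exists (\sum_(a <- letters S) dot (beta a) (beta a)).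
  apply: filterE => m; have := ar_low (X m).
  by rewrite ler_pdivlMl.
Qed.

End LimitCocycle.

(** * Almost trivial orthogonal matrices *)

Section NearIdentity.
Import Order.TTheory GRing.Theory Num.Theory.
Local Open Scope classical_set_scope.
Local Open Scope ring_scope.

Section OrthogonalImage.
Context {R : realType} {G : groupType}.
Variables (H : set G) (r : nat) (u : G -> 'M[R]_r).
Hypothesis (sH : is_subgroup H).
Hypothesis (uM : forall x y, H x -> H y -> u (x * y)%g = u x *m u y).
Hypothesis (uO : forall x, H x -> (u x)^T *m u x = 1%:M).

Let uO' x : H x -> u x *m (u x)^T = 1%:M.
Proof. by move=> Hx; apply: mulmx1C; exact: uO. Qed.

Lemma rep1 : u 1%g = 1%:M.
Proof.
have H1 := sg1 sH.
by rewrite -[LHS]mulmx1 -(uO' H1) mulmxA -uM // mulg1.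
Qed.

Lemma repVl x : H x -> u x^-1%g *m u x = 1%:M.
Proof. by move=> Hx; rewrite -uM ?mulVg ?rep1 //; exact: sgV. Qed.

Lemma repVr x : H x -> u x *m u x^-1%g = 1%:M.
Proof. by move=> Hx; rewrite -uM ?mulgV ?rep1 //; exact: sgV. Qed.

Definition dist1 x := nrm (u x - 1%:M).

Lemma nrm_repl x m (Y : 'M[R]_(r, m)) : H x -> nrm (u x *m Y) = nrm Y.
Proof. by move=> Hx; rewrite /nrm dot_orthl // uO. Qed.

Lemma nrm_repr x m (Y : 'M[R]_(m, r)) : H x -> nrm (Y *m u x) = nrm Y.
Proof. by move=> Hx; rewrite /nrm dot_orthr // uO'. Qed.

Lemma dist1_ge0 x : 0 <= dist1 x. Proof. exact: nrm_ge0. Qed.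

Lemma dist1_eq0 x : (dist1 x == 0) = (u x == 1%:M).
Proof. by rewrite nrm_eq0 subr_eq0. Qed.

Lemma dist1M x y : H x -> H y -> dist1 (x * y)%g <= dist1 x + dist1 y.
Proof.
move=> Hx Hy; rewrite /dist1 uM //.
have -> : u x *m u y - 1%:M = (u x - 1%:M) + u x *m (u y - 1%:M).
  by rewrite mulmxBr mulmx1 [RHS]addrC addrA subrK.
by apply: (le_trans (nrmD _ _)); rewrite nrm_repl.
Qed.

Lemma dist1V x : H x -> dist1 x^-1%g = dist1 x.
Proof.
move=> Hx; rewrite /dist1 -(@nrm_repl x) // mulmxBr repVr // mulmx1 -opprB nrmN //.
Qed.

Lemma dist1X x n : H x -> dist1 (x ^+ n)%g <= n%:R * dist1 x.
Proof.
move=> Hx; elim: n => [|n IH].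
  by rewrite /dist1 expg0 rep1 subrr nrm0 mul0r.
rewrite expgS -natr1 mulrDl mul1r addrC; apply: (le_trans (dist1M _ _)) => //.
  exact: sgX.
by rewrite lerD2l.
Qed.

Lemma dist1R_aux x y : H x -> H y -> dist1 [~ x, y]%g = nrm (u x *m u y - u y *m u x).
Proof.
move=> Hx Hy; have Hyx : H (y * x)%g by exact: sgM.
rewrite /dist1 -(@nrm_repl (y * x)%g) // mulmxBr mulmx1.
rewrite -(uM Hyx (sgR sH Hx Hy)).
by rewrite -commgC !uM.
Qed.

(** From [xy - yx = (x - 1)(y - 1) - (y - 1)(x - 1)]: near the identity, commutators are much closer
    to it than their entries. *)
Lemma dist1R_le x y : H x -> H y -> dist1 [~ x, y]%g <= 2 * dist1 x * dist1 y.
Proof.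
move=> Hx Hy; rewrite dist1R_aux //.
have -> : u x *m u y - u y *m u x =
    (u x - 1%:M) *m (u y - 1%:M) - (u y - 1%:M) *m (u x - 1%:M).
  rewrite !mulmxBr !mulmxBl !mulmx1 !mul1mx.
  set X := u x *m u y; set Y := u y *m u x.
  rewrite !opprB !addrA; apply/matrixP => i j; rewrite !mxE; ring.
apply: (le_trans (nrmB _ _)).
have h1 := nrmM (u x - 1%:M) (u y - 1%:M); have h2 := nrmM (u y - 1%:M) (u x - 1%:M).
by rewrite /dist1; lra.
Qed.

Lemma dist1R_le2 x y : H x -> H y -> dist1 [~ x, y]%g <= 2 * dist1 y.
Proof.
move=> Hx Hy; rewrite dist1R_aux //.
have -> : u x *m u y - u y *m u x = u x *m (u y - 1%:M) - (u y - 1%:M) *m u x.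
  by rewrite mulmxBr mulmxBl mulmx1 mul1mx opprB addrA subrK.
apply: (le_trans (nrmB _ _)); rewrite nrm_repl // nrm_repr // /dist1; lra.
Qed.

(* There are no small subgroups: dist1 grows by a factor 3/2 under squaring. *)
Lemma no_small_subgroup x : H x -> (forall n, dist1 (x ^+ n)%g <= 2^-1) -> u x = 1%:M.
Proof.
move=> Hx h; apply/eqP; rewrite -dist1_eq0; apply: contrapT => /negP d0.
have dpos : 0 < dist1 x by rewrite lt_neqAle eq_sym d0 dist1_ge0.
have sq y : H y -> dist1 y <= 2^-1 -> 3 / 2 * dist1 y <= dist1 (y * y)%g.
  move=> Hy hy; have e : u (y * y)%g - 1%:M = (u y - 1%:M) *m (u y - 1%:M) + 2 *: (u y - 1%:M).
    rewrite uM // mulmxBr mulmxBl mulmx1 mul1mx.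
    by apply/matrixP => i j; rewrite !mxE; ring.
  have : nrm (2 *: (u y - 1%:M)) <= dist1 (y * y)%g + nrm ((u y - 1%:M) *m (u y - 1%:M)).
    rewrite /dist1 e; set X := _ *m _; set Y := 2 *: _.
    have -> : Y = (X + Y) - X by rewrite addrC addKr.
    have -> : X + (X + Y - X) = X + Y by rewrite [X + Y]addrC addrK addrC.
    exact: nrmB.
  rewrite nrmZ gtr0_norm //; have := nrmM (u y - 1%:M) (u y - 1%:M).
  rewrite -/(dist1 y); have := dist1_ge0 y; nra.
have key n : (3 / 2) ^+ n * dist1 x <= dist1 (x ^+ (2 ^ n))%g.
  elim: n => [|n IH]; first by rewrite expr0 mul1r.
  rewrite expnS mul2n -addnn expgnDr exprS -mulrA.
  apply: le_trans (sq _ _ (h _)); last exact: sgX.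
  by rewrite ler_wpM2l // divr_ge0.
have bern n : 1 + n%:R / 2 <= (3 / 2) ^+ n :> R.
  elim: n => [|n IH]; first by rewrite mul0r addr0 expr0.
  rewrite exprS -natr1; have : 0 <= n%:R :> R by rewrite ler0n.
  move: (n%:R : R) (_ ^+ n) IH => q p hp q0; nra.
pose n := Num.bound (dist1 x)^-1.
have nb : (dist1 x)^-1 < n%:R by apply: archi_boundP; rewrite invr_ge0 ltW.
have := key n; have := h (2 ^ n)%N; have := bern n.
have : 1 < n%:R * dist1 x by rewrite -ltr_pdivrMr // mul1r.
move: (dist1 (_ ^+ _)%g) (_ ^+ n) => D p; nra.
Qed.

(* If c = [a,b] commutes with a then c^m = [a^m,b] stays within 2|b-1| of 1. *)
Lemma frobenius_commutator a b : H a -> H b -> dist1 b <= 4^-1 ->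
  u [~ a, [~ a, b]]%g = 1%:M -> u [~ a, b]%g = 1%:M.
Proof.
move=> Ha Hb hb hc; have Hc : H [~ a, b]%g by exact: sgR.
set c := [~ a, b]%g in hc Hc *.
have comm : u a *m u c = u c *m u a.
  by apply/eqP; rewrite -subr_eq0 -nrm_eq0 -dist1R_aux // dist1_eq0 hc.
have HX x n : H x -> H (x ^+ n)%g by exact: sgX.
have commX n : u a *m u (c ^+ n)%g = u (c ^+ n)%g *m u a.
  elim: n => [|n IH]; first by rewrite expg0 rep1 mulmx1 mul1mx.
  by rewrite expgS (uM Hc (HX _ n Hc)) mulmxA comm -mulmxA IH mulmxA.
have pw n : u ((a * c) ^+ n)%g = u (a ^+ n)%g *m u (c ^+ n)%g.
  elim: n => [|n IH]; first by rewrite !expg0 rep1 mulmx1.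
  have Hac : H (a * c)%g by exact: sgM.
  rewrite !expgSr (uM (HX _ n Hac) Hac) (uM Ha Hc) (uM (HX _ n Ha) Ha) (uM (HX _ n Hc) Hc) IH.
  by rewrite !mulmxA; congr (_ *m _); rewrite -!mulmxA commX.
have abE : (a * c = a ^ b)%g by rewrite /c commgEl mulVKg.
apply: no_small_subgroup => // n.
have -> : dist1 (c ^+ n)%g = dist1 [~ a ^+ n, b]%g.
  rewrite /dist1; congr (nrm (_ - _)).
  rewrite commgEl conjXg -abE (uM (sgV sH (HX _ n Ha)) (HX _ n (sgM sH Ha Hc))) pw.
  by rewrite mulmxA repVl ?mul1mx //; exact: HX.
apply: (le_trans (dist1R_le2 _ _)) => //; first exact: HX.
lra.
Qed.

Lemma dist1X_lower x n : H x ->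
  nrm (u (x ^+ n)%g - 1%:M - n%:R *: (u x - 1%:M)) <= n%:R ^+ 2 * dist1 x ^+ 2.
Proof.
move=> Hx; elim: n => [|n IH].
  by rewrite expg0 rep1 subrr scale0r subr0 nrm0 expr0n mul0r.
have -> : u (x ^+ n.+1)%g - 1%:M - n.+1%:R *: (u x - 1%:M) =
    u x *m (u (x ^+ n)%g - 1%:M - n%:R *: (u x - 1%:M)) +
    n%:R *: ((u x - 1%:M) *m (u x - 1%:M)).
  rewrite expgS uM //; last exact: sgX.
  rewrite !mulmxBr -!scalemxAr !mulmxBr !mulmxBl !mulmx1 !mul1mx -natr1.
  by apply/matrixP => i j; rewrite !mxE; ring.
apply: (le_trans (nrmD _ _)); rewrite nrm_repl // nrmZ ger0_norm ?ler0n //.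
have := nrmM (u x - 1%:M) (u x - 1%:M); rewrite -!/(dist1 x) -natr1.
have : 0 <= n%:R :> R by rewrite ler0n.
have := sqr_ge0 (dist1 x); move: (n%:R : R) IH => q; rewrite !expr2.
move: (nrm _) (nrm _) (dist1 x) => A1 B1 D; nra.
Qed.

(** To first order [u (x ^+ n) - 1] is [n] times [u x - 1], and the quadratic error is at most half
    of this while [n * dist1 x <= 1 / 2]. *)
Lemma dist1X_ge x n (N : R) : H x -> (0 < n)%N -> n%:R <= N -> N * dist1 x <= 2^-1 ->
  dist1 x / 2 <= dist1 (x ^+ n)%g.
Proof.
move=> Hx n0 nN hN; have h1 := dist1X_lower n Hx.
have h2 : nrm (n%:R *: (u x - 1%:M)) <= dist1 (x ^+ n)%g + n%:R ^+ 2 * dist1 x ^+ 2.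
  apply: le_trans (lerD (lexx _) h1); rewrite /dist1.
  set X := u (x ^+ n)%g - _; set Y := n%:R *: _.
  have {1}-> : Y = X - (X - Y) by rewrite opprB addrC subrK.
  exact: nrmB.
rewrite nrmZ ger0_norm ?ler0n // -/(dist1 x) in h2.
have : 1 <= n%:R :> R by rewrite ler1n.
have := dist1_ge0 x; move: h2; rewrite !expr2; move: (n%:R : R) nN (dist1 x) hN => q qN D hD.
move=> h2 D0 q1; have : q * D <= 2^-1 by apply: le_trans hD; rewrite ler_wpM2r.
have e : q * q * (D * D) = (q * D) * (q * D) by ring.
have h4 : D <= q * D by rewrite ler_peMl.
rewrite e in h2; move: (q * D) h2 h4 => z h2 h4 h3.
have h5 : z * z <= 2^-1 * z by rewrite ler_wpM2r // (le_trans D0).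
lra.
Qed.

Section Commute.
Variables (S : seq G) (d : nat).
Hypotheses (HS : H = gen S) (gS : growth S d).

(** The number of digits in [word]. The [A ^ m = 2 ^ m * 16 ^ (m * d)] words of [m] digits have
    length O(m 4^m), at most a constant times [16 ^ m], so the growth bound allows only a constant
    times [16 ^ (m * d)] of them. *)
Let A : nat := (2 * 16 ^ d)%N.
Let A0 : 0 < A%:R :> R. Proof. by rewrite ltr0n muln_gt0 expn_gt0. Qed.
(** Small enough that [A * eps0 = 1 / 32], which keeps all later digits of a word from compensating
    one earlier digit. *)
Definition eps0 : R := (32 * A%:R)^-1.

Lemma eps0_gt0 : 0 < eps0. Proof. by rewrite invr_gt0 mulr_gt0. Qed.

Let Aeps : A%:R * eps0 = 32^-1.
Proof. by rewrite /eps0 invfM mulrCA divff ?mulr1 // gt_eqF. Qed.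

Let eps_small : eps0 <= 32^-1.
Proof.
rewrite lef_pV2 ?posrE ?mulr_gt0 // ler_peMr // ler1n muln_gt0 expn_gt0 //.
Qed.

Variables (a b : G).
Hypotheses (Ha : H a) (Hb : H b) (da : dist1 a < eps0) (db : dist1 b < eps0).
Hypothesis (nc : u [~ a, b]%g != 1%:M).

Fixpoint itc (i : nat) : G := if i is j.+1 then [~ a, itc j]%g else b.

Let itcH i : H (itc i). Proof. by elim: i => //= i IH; exact: sgR. Qed.

Let itc_dist i : dist1 (itc i.+1) <= 2 * eps0 * dist1 (itc i).
Proof.
apply: (le_trans (dist1R_le Ha (itcH i))).
by rewrite ler_wpM2r ?dist1_ge0 // ler_wpM2l // ltW.
Qed.

Let itc_small i : dist1 (itc i) <= eps0.
Proof.
elim: i => [|i IH]; first exact: ltW.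
apply: (le_trans (itc_dist i)); have := dist1_ge0 (itc i); have := eps0_gt0; have := eps_small.
move: (eps0) IH => e; nra.
Qed.

Let itc_neq i : u (itc i.+1) != 1%:M.
Proof.
elim: i => [|i IH] //; apply: contraNneq IH => h; apply/eqP.
apply: frobenius_commutator => //; apply: (le_trans (itc_small i)).
by apply: (le_trans eps_small); lra.
Qed.

Let itc_pos i : 0 < dist1 (itc i).
Proof.
rewrite lt_neqAle dist1_ge0 andbT eq_sym dist1_eq0.
case: i => [|i]; last exact: itc_neq.
apply: contraNneq nc => h; apply/eqP.
have : dist1 [~ a, b]%g <= 0.
  by apply: (le_trans (dist1R_le2 Ha Hb)); rewrite /dist1 h subrr nrm0 mulr0.
by rewrite le_eqVlt ltNge dist1_ge0 orbF dist1_eq0 => /eqP.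
Qed.

(** A positional system in base [A], whose place values are the rapidly shrinking iterated
    commutators. *)
Fixpoint word (i : nat) (es : seq 'I_A) : G :=
  if es is e :: es' then (itc i ^+ e * word i.+1 es')%g else 1%g.

Let wordH i es : H (word i es).
Proof.
elim: es i => [|e es IH] i /=; first exact: sg1.
by apply: sgM => //; exact: sgX.
Qed.

Let word_dist i es : dist1 (word i es) <= 2 * A%:R * dist1 (itc i).
Proof.
elim: es i => [|e es IH] i /=.
  by rewrite /dist1 rep1 subrr nrm0 !mulr_ge0 ?nrm_ge0 // ltW.
apply: (le_trans (dist1M (sgX _ sH (itcH i)) (wordH _ _))).
have h1 := dist1X e (itcH i).
have h2 : (e : nat)%:R * dist1 (itc i) <= A%:R * dist1 (itc i).
  by rewrite ler_wpM2r ?dist1_ge0 // ler_nat ltnW.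
have h3 := IH i.+1; have h4 := itc_dist i.
have h5 : 2 * A%:R * dist1 (itc i.+1) <= 2 * A%:R * (2 * eps0 * dist1 (itc i)).
  by rewrite ler_wpM2l // mulr_ge0 // ltW.
have e1 : 2 * A%:R * (2 * eps0 * dist1 (itc i)) = 4 * (A%:R * eps0) * dist1 (itc i) by ring.
rewrite e1 Aeps in h5; have := dist1_ge0 (itc i).
have : 1 <= A%:R :> R by rewrite ler1n muln_gt0 expn_gt0.
move: (A%:R : R) (dist1 _) (dist1 _) (dist1 _) (dist1 _) h1 h2 h3 h5 => *; nra.
Qed.

(** At the first differing digit the power [itc i ^+ (q - p)] has distance at least
    [dist1 (itc i) / 2] from 1, whereas the two tails together reach at most [8 * A * eps0 = 1 / 4]
    times [dist1 (itc i)]. *)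
Let word_inj i es es' : size es = size es' -> u (word i es) = u (word i es') -> es = es'.
Proof.
elim: es es' i => [|e es IH] [|e' es'] i //= [ss].
have key (p q : 'I_A) ps qs : (p < q)%N ->
    u (itc i ^+ p * word i.+1 ps)%g = u (itc i ^+ q * word i.+1 qs)%g -> False.
  move=> pq; have {1}-> : (q : nat) = (p + (q - p))%N by rewrite subnKC // ltnW.
  rewrite expgnDr -mulgA.
  have Hp : H (itc i ^+ p)%g by exact: sgX.
  have Hqp : H (itc i ^+ (q - p))%g by exact: sgX.
  have Hw := wordH i.+1 qs; have Hw' := wordH i.+1 ps.
  rewrite !(uM Hp) //; last exact: sgM.
  move/(congr1 (mulmx (u (itc i ^+ p)^-1%g))); rewrite !mulmxA repVl // !mul1mx => e1.
  have e2 : u (itc i ^+ (q - p))%g = u (word i.+1 ps * (word i.+1 qs)^-1)%g.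
    rewrite (uM Hw' (sgV sH Hw)) e1 (uM Hqp Hw) -mulmxA repVr // mulmx1 //.
  have h1 : dist1 (itc i ^+ (q - p))%g <= 4 * A%:R * dist1 (itc i.+1).
    rewrite /dist1 e2 -/(dist1 _); apply: (le_trans (dist1M Hw' (sgV sH Hw))).
    have -> : 4 * A%:R * dist1 (itc i.+1) =
        2 * A%:R * dist1 (itc i.+1) + 2 * A%:R * dist1 (itc i.+1) by ring.
    by rewrite dist1V //; apply: lerD; exact: word_dist.
  have h2 : dist1 (itc i) / 2 <= dist1 (itc i ^+ (q - p))%g.
    apply: (dist1X_ge (N := A%:R)) => //; first by rewrite subn_gt0.
      by rewrite ler_nat; have := ltn_ord q; lia.
    apply: (@le_trans _ _ (A%:R * eps0)); first by rewrite ler_wpM2l ?itc_small // ltW.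
    by rewrite Aeps; lra.
  have h3 : 4 * A%:R * dist1 (itc i.+1) <= 4 * A%:R * (2 * eps0 * dist1 (itc i)).
    by rewrite ler_wpM2l ?itc_dist // mulr_ge0 // ltW.
  have e3 : 4 * A%:R * (2 * eps0 * dist1 (itc i)) = 8 * (A%:R * eps0) * dist1 (itc i) by ring.
  rewrite e3 Aeps in h3; have := itc_pos i; lra.
case: (ltngtP e e') => [lt|gt|/val_inj <-].
- by move=> h; case: (key _ _ _ _ lt h).
- by move/esym => h; case: (key _ _ _ _ gt h).
have He : H (itc i ^+ e)%g by exact: sgX.
rewrite !(uM He) // => /(congr1 (mulmx (u (itc i ^+ e)^-1%g))).
by rewrite !mulmxA repVl // !mul1mx => /IH ->.
Qed.

Lemma near_not_commuting : False.
Proof.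
have [C hC] := gS.
have [al ha] : exists n, wball S n a by move: Ha; rewrite HS.
have [bl hb] : exists n, wball S n b by move: Hb; rewrite HS.
pose L := (al + bl)%N.
have len i : wball S (4 ^ i * L) (itc i).
  elim: i => [|i IH]; first by rewrite expn0 mul1n; apply: ball_mono hb; rewrite /L; lia.
  have h : wball S (al + 4 ^ i * L + (al + 4 ^ i * L)) [~ a, itc i]%g.
    rewrite commgEl conjgE.
    have -> : (a^-1 * ((itc i)^-1 * (a * itc i)) = (a^-1 * (itc i)^-1) * (a * itc i))%g.
      by rewrite !mulgA.
    by apply: ballM; apply: ballM => //; exact: ballV.
  apply: ball_mono h; rewrite expnS /L; have : (0 < 4 ^ i)%N by rewrite expn_gt0.
  move: (4 ^ i)%N => q; nia.
have wlen i es : wball S (A * L * (size es * 4 ^ (i + size es))) (word i es).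
  elim: es i => [|e es IH] i /=; first by rewrite mul0n muln0.
  have h := ballM (ballX e (len i)) (IH i.+1).
  apply: ball_mono h; rewrite addSnnS.
  have h1 : (4 ^ i <= 4 ^ (i + (size es).+1))%N by rewrite leq_exp2l // leq_addr.
  have h2 : ((e : nat) <= A)%N by rewrite ltnW.
  have h3 : (4 ^ i * L * e <= A * L * 4 ^ (i + (size es).+1))%N.
    by rewrite mulnC (mulnC _ L) mulnA; apply: leq_mul => //; rewrite leq_mul2r h2 orbT.
  by apply: (leq_trans (leq_add h3 (leqnn _))); rewrite mulSn [X in (_ <= X)%N]mulnDr.
pose D := (C * (A * L).+1 ^ d)%N.
(* After cancellation of [16 ^ (m * d)] the growth bound reads [2 ^ m <= D], which fails at
   [m = D]. *)
pose m := D.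
have := hC (A * L * (m * 4 ^ m))%N [seq word 0 t | t : m.-tuple 'I_A] _ _.
rewrite size_map -cardE card_tuple card_ord => h.
have {}h : (A ^ m <= C * (A * L * (m * 4 ^ m)).+1 ^ d)%N.
  apply: h.
    rewrite map_inj_uniq ?enum_uniq // => s t e; apply: val_inj.
    by apply: (@word_inj 0); rewrite ?size_tuple // e.
  by move=> x /mapP [t _ ->]; have := wlen 0%N t; rewrite size_tuple add0n.
have h1 : ((A * L * (m * 4 ^ m)).+1 <= (A * L).+1 * 16 ^ m)%N.
  have aux (p q s : nat) : (s <= p -> 0 < p -> (q * (s * p)).+1 <= q.+1 * (p * p))%N by nia.
  have -> : (16 ^ m = 4 ^ m * 4 ^ m)%N by rewrite -expnMn.
  by apply: aux; rewrite ?expn_gt0 // ltnW // ltn_expl.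
have h2 : (C * (A * L * (m * 4 ^ m)).+1 ^ d <= D * 16 ^ (m * d))%N.
  by rewrite /D -[X in (_ <= X)%N]mulnA leq_mul2l expnM -expnMn leq_expn ?orbT.
have e : (A ^ m = 2 ^ m * 16 ^ (m * d))%N by rewrite /A expnMn -expnM [(d * m)%N]mulnC.
have := leq_trans h h2; rewrite e leq_pmul2r ?expn_gt0 // leqNgt => /negP; apply.
exact: ltn_expl.
Qed.

End Commute.

End OrthogonalImage.

End NearIdentity.

(** * A virtually cyclic quotient *)

Section CyclicQuotient.
Import Order.TTheory GRing.Theory Num.Theory.
Local Open Scope classical_set_scope.
Local Open Scope ring_scope.

(** Round the entries to a grid of mesh [eps / r.+1]: two matrices in the same cell are closer than
    [eps], and there are finitely many cells. *)
Lemma packing (R : realType) (r : nat) (B eps : R) : 0 < eps ->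
  exists n : nat, forall s : seq 'M[R]_r, (forall X, X \in s -> nrm X <= B) ->
    pairwise (fun X Y => eps <= nrm (X - Y)) s -> (size s <= n)%N.
Proof.
move=> e0; have [eta etaE] : {eta | eta = eps / r.+1%:R} by eexists.
have eta0 : 0 < eta by rewrite etaE divr_gt0 // ltr0n.
pose M := (Num.bound (2 * `|B| / eta)).+1.
pose f (X : 'M[R]_r) : {ffun 'I_r * 'I_r -> 'I_M} :=
  [ffun ij => inord (Num.truncn ((X ij.1 ij.2 + `|B|) / eta))].
exists #|{ffun 'I_r * 'I_r -> 'I_M}| => s sB sp.
rewrite -(size_map f); apply: (@leq_trans (size (undup (map f s)))); last first.
  by rewrite -(card_uniqP (undup_uniq _)) max_card.
rewrite undup_id // map_inj_in_uniq; last first.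
  move=> X Y Xs Ys fXY.
  suff hXY : nrm (X - Y) < eps.
    apply: contrapT => nXY; move: hXY; rewrite ltNge => /negP; apply.
    have sym Z1 Z2 : eps <= nrm (Z1 - Z2) -> eps <= nrm (Z2 - Z1).
      by rewrite -nrmN opprB.
    elim: s sp Xs Ys {sB} => // Z s IH /= /andP [/allP hZ /IH {}IH].
    rewrite !inE => /orP [/eqP XZ|Xs] /orP [/eqP YZ|Ys].
    - by case: nXY; rewrite XZ YZ.
    - by rewrite XZ; exact: hZ.
    - by rewrite YZ; apply: sym; exact: hZ.
    - exact: IH.
  have entry i j : (X i j - Y i j) ^+ 2 <= eta ^+ 2.
    have bnd (Z : 'M[R]_r) : Z \in s -> 0 <= (Z i j + `|B|) / eta <= 2 * `|B| / eta.
      move=> /sB hZ; have := le_trans (nrm_entry Z i j) (le_trans hZ (ler_norm B)).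
      rewrite ler_norml => /andP [h1 h2]; apply/andP; split.
        by rewrite divr_ge0 ?(ltW eta0) //; lra.
      by rewrite ler_pM2r ?invr_gt0 //; lra.
    have trunc_lt (Z : 'M[R]_r) : Z \in s -> (Num.truncn ((Z i j + `|B|) / eta) < M)%N.
      move=> /bnd /andP [h1 h2]; rewrite truncn_lt_nat //; apply: (le_lt_trans h2).
      apply: (@lt_trans _ _ (Num.bound (2 * `|B| / eta))%:R); last by rewrite ltr_nat.
      by apply: archi_boundP; apply: divr_ge0; [rewrite mulr_ge0 ?normr_ge0 ?ler0n|exact: ltW].
    have := congr1 (fun g : {ffun 'I_r * 'I_r -> 'I_M} => val (g (i, j))) fXY.
    rewrite !ffunE /= !inordK ?trunc_lt // => e.
    have /andP [x0 _] := bnd X Xs; have /andP [y0 _] := bnd Y Ys.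
    have := truncn_itv x0; have := truncn_itv y0; rewrite e => /andP [h1 h2] /andP [h3 h4].
    have h5 : (X i j - Y i j) / eta = (X i j + `|B|) / eta - (Y i j + `|B|) / eta by ring.
    have h6 : `|(X i j - Y i j) / eta| <= 1.
      rewrite ler_norml h5; rewrite -natr1 in h2 h4; lra.
    rewrite normrM [`|eta^-1|]gtr0_norm ?invr_gt0 // ler_pdivrMr // mul1r in h6.
    by rewrite -real_normK ?num_real // ler_sqr ?nnegrE // ltW.
  rewrite -(@ltr_sqr R) ?nnegrE ?nrm_ge0 ?(ltW e0) // nrm_sq.
  apply: (@le_lt_trans _ _ (r%:R * (r%:R * eta ^+ 2))).
    rewrite /dot; apply: (@le_trans _ _ (\sum_(i < r) \sum_(j < r) eta ^+ 2)).
      apply: ler_sum => i _; apply: ler_sum => j _.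
      by rewrite -expr2 !mxE; exact: entry.
    by rewrite !sumr_const !card_ord !mulr_natl.
  have -> : r%:R * (r%:R * eta ^+ 2) = (r%:R * eta) ^+ 2 by ring.
  rewrite ltr_sqr ?nnegrE ?mulr_ge0 ?ler0n ?(ltW eta0) ?(ltW e0) //.
  by rewrite etaE mulrCA gtr_pMr // ltr_pdivrMr ?ltr0n // mul1r ltr_nat.
elim: s sp {sB} => //= X s IH /andP [/allP hX /IH ->]; rewrite andbT.
by apply/negP => /hX; rewrite subrr nrm0 leNgt e0.
Qed.

Section VirtuallyZ.
Context {R : realType} {G : groupType}.
Variables (S : seq G) (d : nat).
Hypotheses (gS : growth S d) (infS : ~ fidx [set (1%g : G)] (gen S)).
Hypothesis (rf : residually_finite G).

Let H := gen S.
Let sH : is_subgroup H := sg_gen S.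

Variables (r : nat) (u : G -> 'M[R]_r) (beta : G -> 'cV[R]_r).
Hypothesis (uM : forall x y, H x -> H y -> u (x * y)%g = u x *m u y).
Hypothesis (uO : forall x, H x -> (u x)^T *m u x = 1%:M).
Hypothesis (bM : forall x y, H x -> H y -> beta (x * y)%g = beta x + u x *m beta y).
Hypothesis (b0 : \sum_(a <- letters S) beta a = 0).
Hypothesis (bpos : 0 < \sum_(a <- letters S) dot (beta a) (beta a)).

Definition near : set G := [set x | H x /\ dist1 u x < @eps0 R d].
Definition nearH := gen_subgroup near.

Lemma nearH_sub : nearH `<=` H.
Proof. by apply: gen_subgroup_min => // x []. Qed.

Lemma near_commute x y : near x -> near y -> u x *m u y = u y *m u x.
Proof.
move=> [Hx dx] [Hy dy]; apply/eqP; rewrite -subr_eq0 -nrm_eq0.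
rewrite -(dist1R_aux sH uM uO) // dist1_eq0; apply: contrapT => /negP nc.
exact: (near_not_commuting sH uM uO (erefl _) gS Hx Hy dx dy nc).
Qed.

Lemma sg_centralizer (P : set G) : P `<=` H ->
  is_subgroup [set x | H x /\ forall y, P y -> u x *m u y = u y *m u x].
Proof.
move=> PH; apply/is_subgroupP; split.
  by split; [exact: sg1|move=> y Py; rewrite (rep1 sH uM uO) mul1mx mulmx1].
move=> x y [Hx cx] [Hy cy]; have HyV := sgV sH Hy.
split; first exact: sgM.
move=> z Pz; rewrite uM // -mulmxA.
have -> : u y^-1%g *m u z = u z *m u y^-1%g.
  rewrite -[LHS]mulmx1 -(repVr sH uM uO Hy) !mulmxA -(mulmxA _ (u z)) -cy //.
  by rewrite !mulmxA (repVl sH uM uO) // mul1mx.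
by rewrite !mulmxA cx.
Qed.

Lemma nearH_commute x y : nearH x -> nearH y -> u x *m u y = u y *m u x.
Proof.
have nH : near `<=` H by move=> z [].
have h1 : nearH `<=` [set x | H x /\ forall y, near y -> u x *m u y = u y *m u x].
  apply: gen_subgroup_min; first exact: sg_centralizer.
  by move=> z nz; split; [exact: nH|move=> w; exact: near_commute].
have h2 : nearH `<=` [set x | H x /\ forall y, nearH y -> u x *m u y = u y *m u x].
  apply: gen_subgroup_min; first exact: sg_centralizer nearH_sub.
  move=> z nz; split; [exact: nH|move=> w /h1 [_ hw]].
  by rewrite (hw z).
by move=> /h2 [_ hx] /hx.
Qed.

Lemma nrm_orth_le x : H x -> nrm (u x) <= Num.sqrt r%:R.
Proof. by move=> Hx; rewrite /nrm dot_tr mxtrace_mulC uO // mxtrace1. Qed.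

(** Elements of distinct cosets of [nearH] have images at distance at least [eps0], and orthogonal
    matrices form a bounded set. *)
Lemma nearH_fidx : fidx nearH H.
Proof.
apply: contrapT => nf.
have [n hn] := @packing R r (Num.sqrt r%:R) (@eps0 R d) (@eps0_gt0 R d).
have [s [ss sH' sf]] := not_fidx_free n.+1 (sg_gen_subgroup _ : is_subgroup nearH) nf.
have := hn (map u s); rewrite size_map ss ltnn => h; apply: notF; apply: h.
  by move=> _ /mapP [x /sH' Hx ->]; exact: nrm_orth_le.
elim: s {ss} sH' sf => //= x s IH sH' /andP [/allP hx sf]; apply/andP; split; last first.
  by apply: IH => // y ys; apply: sH'; rewrite inE ys orbT.
apply/allP => _ /mapP [y ys ->]; have /asboolP hxy := hx y ys.
rewrite leNgt; apply/negP => h; apply: hxy; apply: sub_gen_subgroup.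
have Hx : H x by apply: sH'; exact: mem_head.
have Hy : H y by apply: sH'; rewrite inE ys orbT.
split; first by apply: sgM => //; exact: sgV.
rewrite /dist1 -(nrm_repl uO _ Hx) mulmxBr mulmx1 -uM //; last first.
  by apply: sgM => //; exact: sgV.
by rewrite mulVKg -nrmN opprB.
Qed.

Definition kerU : set G := [set x | nearH x /\ u x = 1%:M].

Lemma sg_kerU : is_subgroup kerU.
Proof.
have sN : is_subgroup nearH := sg_gen_subgroup _.
apply/is_subgroupP; split; first by split; [exact: sg1|exact: (rep1 sH uM uO)].
move=> x y [nx ux] [ny uy]; have Hx := nearH_sub nx; have Hy := nearH_sub ny.
split; first exact: (sgM sN nx (sgV sN ny)).
rewrite uM ?ux ?mul1mx //; last exact: sgV.
by rewrite -[LHS]mulmx1 -uy (repVl sH uM uO).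
Qed.

Lemma kerU_sub : kerU `<=` H.
Proof. by move=> x [/nearH_sub]. Qed.

Lemma beta_ker x y : H x -> kerU y -> beta (x * y)%g = beta x + u x *m beta y.
Proof. by move=> Hx ky; apply: bM => //; exact: kerU_sub. Qed.

Lemma beta1 : beta 1%g = 0.
Proof.
have := bM (sg1 sH) (sg1 sH); rewrite mulg1 (rep1 sH uM uO) mul1mx => /esym/eqP.
by rewrite -subr_eq0 addrK => /eqP.
Qed.

Lemma beta_kerM x y : kerU x -> H y -> beta (x * y)%g = beta x + beta y.
Proof. by move=> [nx ux] Hy; rewrite bM ?ux ?mul1mx //; exact: nearH_sub. Qed.

Lemma beta_kerV x : kerU x -> beta x^-1%g = - beta x.
Proof.
move=> kx; have Hx := kerU_sub kx.
have := beta_kerM (sgV sg_kerU kx) Hx; rewrite mulVg beta1 => /esym/eqP.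
by rewrite addr_eq0 => /eqP.
Qed.

Lemma beta_kerX x n : kerU x -> beta (x ^+ n)%g = n%:R *: beta x.
Proof.
move=> kx; elim: n => [|n IH]; first by rewrite expg0 beta1 scale0r.
rewrite expgS beta_kerM //; last by apply: sgX => //; exact: kerU_sub.
by rewrite IH -natr1 scalerDl scale1r addrC.
Qed.

Definition kerB : set G := [set x | kerU x /\ beta x = 0].

Lemma sg_kerB : is_subgroup kerB.
Proof.
apply/is_subgroupP; split; first by split; [exact: sg1 sg_kerU|exact: beta1].
move=> x y [kx bx] [ky by_]; have kyV := sgV sg_kerU ky.
split; first exact: sgM sg_kerU _ _.
by rewrite beta_kerM ?beta_kerV ?bx ?by_ ?oppr0 ?addr0 //; exact: kerU_sub.
Qed.

(* Otherwise beta vanishes on kerU and takes finitely many values on H; the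
   harmonic cocycle then contradicts the maximum principle. *)
Lemma kerB_infinite : fidx kerU H -> ~ fidx kerB kerU.
Proof.
move=> fU [q hq].
(* [beta] is additive on [kerU]; two powers of [x] fall into the same coset of [kerB], so a positive
   multiple of [beta x] vanishes. *)
have bk x : kerU x -> beta x = 0.
  move=> kx; pose f (n : 'I_(size q).+1) := xget 1%g [set y | y \in q /\ kerB (y^-1 * x ^+ n)%g].
  have fP n : f n \in q /\ kerB ((f n)^-1 * x ^+ n)%g.
    have [y yq hy] := hq (x ^+ n)%g (sgX n sg_kerU kx).
    by apply: (@xgetPex _ 1%g [set y | y \in q /\ kerB (y^-1 * x ^+ n)%g]); exists y.
  have [i [j [ij fij]]] : exists i j : 'I_(size q).+1, (i < j)%N /\ f i = f j.
    apply: contrapT => h.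
    have finj : injective f.
      move=> i j e; apply: val_inj => /=; case: (ltngtP i j) => // lt.
        by case: h; exists i, j.
      by case: h; exists j, i.
    have us : uniq (map f (enum 'I_(size q).+1)) by rewrite map_inj_uniq ?enum_uniq.
    have := uniq_leq_size us (_ : {subset _ <= q}).
    rewrite size_map size_enum_ord ltnn => h2; apply: notF; apply: h2.
    by move=> _ /mapP [n _ ->]; case: (fP n).
  have [_ hi] := fP i; have [_ hj] := fP j.
  have := sgM sg_kerB (sgV sg_kerB hi) hj.
  rewrite fij invgM invgK mulgA mulgK -(subnKC (ltnW ij)) expgnDr mulKg => -[_].
  rewrite beta_kerX // => /eqP; rewrite scaler_eq0 pnatr_eq0 subn_eq0 leqNgt ij /=.
  by move/eqP.
have [p pH hp] := fidx_in sg_kerU sH fU.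
pose m x := dot (beta x) (beta x).
have [y yp _] := hp _ (sg1 sH).
have mE x : H x -> exists2 y, y \in p & m x = m y.
  move=> Hx; have [z zp kz] := hp x Hx; exists z => //.
  have e : beta x = beta z.
    by rewrite -{1}[x](mulVKg z) (beta_ker (pH z zp) kz) (bk _ kz) mulmx0 addr0.
  by rewrite /m e.
have [z zp hz] : exists2 z, z \in p & forall w, w \in p -> m w <= m z.
  elim: p {hp mE pH} y yp => // w p IH y; rewrite inE => _.
  case: p IH => [|w2 p] IH; first by exists w; rewrite ?mem_head // => v; rewrite inE => /eqP ->.
  have [z zp hz] := IH w2 (mem_head _ _).
  have [h|h] := leP (m z) (m w).
    exists w; first exact: mem_head.
    by move=> v; rewrite inE => /orP [/eqP ->//|/hz h2]; exact: le_trans h2 h.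
  exists z; first by rewrite inE zp orbT.
  by move=> v; rewrite inE => /orP [/eqP ->|/hz //]; exact: ltW.
have Hz := pH z zp.
have le1 : \sum_(a <- letters S) m (z * a)%g <= \sum_(a <- letters S) m z.
  rewrite !big_seq; apply: ler_sum => a aA.
  by have [w wp ->] := mE _ (sgM sH Hz (gen_letter aA)); exact: hz.
(* At a maximum [z] of the squared norm, harmonicity removes the cross terms and leaves a strictly
   positive gain. *)
have : \sum_(a <- letters S) m (z * a)%g = \sum_(a <- letters S) m z +
    \sum_(a <- letters S) dot (beta a) (beta a).
  have -> : \sum_(a <- letters S) m (z * a)%g = \sum_(a <- letters S)
      (m z + dot (beta a) (beta a) + 2 * dot (beta z) (u z *m beta a)).
    rewrite !big_seq; apply: eq_bigr => a aA; rewrite /m bM //; last exact: gen_letter.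
    by rewrite !(dotDl, dotDr) (dotC (u z *m _)) dot_orthl ?uO //; ring.
  have e0 : \sum_(a <- letters S) 2 * dot (beta z) (u z *m beta a) = 0.
    by rewrite -mulr_sumr -dot_sumr -mulmx_sumr b0 mulmx0 dotC dot0l mulr0.
  by rewrite !big_split /= e0 addr0.
move=> e; rewrite e gerDl in le1; by rewrite leNgt bpos in le1.
Qed.

Lemma virtually_Z_aux : exists L t, [/\ is_subgroup L, L `<=` H, H t &
  [/\ (forall i : int, L (expz t i) -> i = 0), normalizes t L & fidx (ext L t) H]].
Proof.
have sN : is_subgroup nearH := sg_gen_subgroup _.
have [S1 eS1] := fidx_fg sN nearH_sub nearH_fidx.
have abU x y : nearH x -> nearH y -> kerU [~ x, y]%g.
  move=> nx ny; split; first exact: (sgR sN nx ny).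
  have Hx := nearH_sub nx; have Hy := nearH_sub ny.
  apply/eqP; rewrite -(dist1_eq0 u) (dist1R_aux sH uM uO) //.
  by rewrite (nearH_commute nx ny) subrr nrm0.
have kN : kerU `<=` nearH by move=> x [].
have [fU|nfU] := pselect (fidx kerU nearH); last first.
  have [L [t [sL _ LN Nt [inj nt ft]]]] := abelian_infinite sg_kerU sN kN abU eS1 nfU.
  exists L, t; split=> //; first exact: subset_trans LN nearH_sub.
    exact: nearH_sub.
  by split=> //; apply: fidx_trans ft nearH_fidx.
have fU' : fidx kerU H := fidx_trans sN sH fU nearH_fidx.
have [S2 eS2] := fidx_fg sg_kerU kerU_sub fU'.
have abB x y : kerU x -> kerU y -> kerB [~ x, y]%g.
  move=> kx ky; split; first exact: (sgR sg_kerU kx ky).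
  have Hx := kerU_sub kx; have Hy := kerU_sub ky.
  have kxy := sgM sg_kerU kx ky; have kyx := sgM sg_kerU ky kx.
  have : beta (x * y)%g = beta (y * x * [~ x, y])%g by rewrite -commgC.
  rewrite (beta_kerM kx Hy) (beta_kerM kyx (sgR sH Hx Hy)) (beta_kerM ky Hx).
  by rewrite [beta y + _]addrC -[LHS]addr0 => /addrI <-.
have kB : kerB `<=` kerU by move=> x [].
have [L [t [sL _ LN Nt [inj nt ft]]]] :=
  abelian_infinite sg_kerB sg_kerU kB abB eS2 (kerB_infinite fU').
exists L, t; split=> //; first exact: subset_trans LN kerU_sub.
  exact: kerU_sub.
by split=> //; apply: fidx_trans ft fU' => //; exact: sg_kerU.
Qed.

End VirtuallyZ.

Theorem virtually_Z (R : realType) (G : groupType) (S : seq G) (d : nat) :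
  growth S d -> ~ fidx [set (1%g : G)] (gen S) -> residually_finite G ->
  exists L t, [/\ is_subgroup L, L `<=` gen S, gen S t &
    [/\ (forall i : int, L (expz t i) -> i = 0), normalizes t L & fidx (ext L t) (gen S)]].
Proof.
move=> gS infS rf.
have [r [u [beta [uM uO bM b0 bpos]]]] := @finite_dimensional_cocycle R G S d gS infS rf.
exact: virtually_Z_aux gS r u beta uM uO bM b0 bpos.
Qed.

End CyclicQuotient.

(** * Nilpotent groups *)

Section Nilpotent.
Local Open Scope classical_set_scope.
Local Open Scope group_scope.

Section CommutatorIdentities.
Context {G : groupType}.
Implicit Types (x y z : G).

Lemma commgMr x y z : [~ x, y * z] = [~ x, z] * [~ x, y] ^ z.
Proof. by rewrite !commgEl !conjgE !gnorm. Qed.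

Lemma commgMl x y z : [~ x * y, z] = [~ x, z] ^ y * [~ y, z].
Proof. by rewrite !commgEl !conjgE !gnorm. Qed.

Lemma commgVr x y : [~ x, y^-1] = ([~ x, y]^-1) ^ y^-1.
Proof. by rewrite !commgEl !conjgE !gnorm. Qed.

Lemma commgVl x y : [~ x^-1, y] = ([~ x, y]^-1) ^ x^-1.
Proof. by rewrite !commgEl !conjgE !gnorm. Qed.

End CommutatorIdentities.

Section LowerCentral.
Context {G : groupType}.
Implicit Types (x y z : G) (H K : set G).

Lemma normalizes_mem g H x : normalizes g H -> H x -> H (x ^ g).
Proof. by move=> n; case: (n x). Qed.

Lemma commutator_mem H K x y : H x -> K y -> commutator_subgroup H K [~ x, y].
Proof. by move=> Hx Ky; apply: sub_gen_subgroup; exists x, y. Qed.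

Lemma sg_lc H c : is_subgroup H -> is_subgroup (lower_central H c).
Proof. by case: c => [|c] //= _; exact: sg_gen_subgroup. Qed.

Lemma lc_comm H c x y : lower_central H c x -> H y -> lower_central H c.+1 [~ x, y].
Proof. exact: commutator_mem. Qed.

Lemma lc_normalizes H c g : normalizes g H -> normalizes g (lower_central H c).
Proof.
move=> n; elim: c => [|c IH] //=.
apply: normalizes_gen => _ [x [y [hx hy ->]]]; rewrite conjRg; apply: commutator_mem.
- exact: normalizes_mem IH hx.
- exact: normalizes_mem n hy.
- exact: normalizes_mem (normalizesV IH) hx.
- exact: normalizes_mem (normalizesV n) hy.
Qed.

Lemma lc_subS H c : is_subgroup H -> lower_central H c.+1 `<=` lower_central H c.
Proof.
move=> sH; have sc := sg_lc c sH.
apply: gen_subgroup_min => // _ [x [y [hx hy ->]]].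
rewrite commgEl; apply: sgM => //; first exact: sgV.
by apply: normalizes_mem hx; apply: lc_normalizes; exact: sg_self_normalizes.
Qed.

Lemma lc_sub H c : is_subgroup H -> lower_central H c `<=` H.
Proof. by move=> sH; elim: c => // c IH; exact: subset_trans (lc_subS sH) IH. Qed.

Lemma lc_le H i j : is_subgroup H -> (i <= j)%N -> lower_central H j `<=` lower_central H i.
Proof.
move=> sH /subnKC <-; elim: (j - i)%N => [|k IH]; first by rewrite addn0.
by rewrite addnS; exact: subset_trans (lc_subS sH) IH.
Qed.

Lemma lc_mono H K c : H `<=` K -> lower_central H c `<=` lower_central K c.
Proof.
move=> HK; elim: c => //= c IH; apply: gen_subgroup_mono.
by move=> _ [x [y [hx hy ->]]]; exists x, y; split=> //; [exact: IH|exact: HK].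
Qed.

Lemma nilpotentP H : is_subgroup H ->
  nilpotent_subgroup H <-> exists c, lower_central H c `<=` [set 1].
Proof.
move=> sH; split=> [[c hc]|[c hc]]; exists c; first by rewrite hc.
by apply/seteqP; split=> // _ ->; exact: sg1 (sg_lc c sH).
Qed.

Lemma nilpotent_sub H K : is_subgroup H -> is_subgroup K -> H `<=` K ->
  nilpotent_subgroup K -> nilpotent_subgroup H.
Proof.
move=> sH sK HK /(nilpotentP sK) [c hc]; apply/(nilpotentP sH); exists c.
exact: subset_trans (lc_mono HK) hc.
Qed.

End LowerCentral.

Section CentralLists.
Context {G : groupType}.
Implicit Types (x y z : G) (H K : set G) (S l : seq G).

(* Each entry is central modulo the subgroup generated by the later ones. *)
Fixpoint central_list (H : set G) l : Prop :=
  if l is x :: l' then central_list H l' /\ forall h, H h -> gen l' [~ x, h] else True.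

Lemma gen_cons x l : gen l `<=` gen (x :: l).
Proof. by apply: gen_min (sg_gen _) _ => y yl; apply: gen_mem; rewrite inE yl orbT. Qed.

Lemma gen_head x l : gen (x :: l) x.
Proof. by apply: gen_mem; exact: mem_head. Qed.

Lemma central_list_normal H l g : is_subgroup H -> central_list H l -> H g ->
  normalizes g (gen l).
Proof.
move=> sH; elim: l g => [|x l IH] g cl Hg.
  by rewrite -gen_subgroup_seq; apply: normalizes_gen => y; rewrite /= in_nil.
case: cl => cl hx; rewrite -gen_subgroup_seq.
have aux k : H k -> forall y, y \in x :: l -> gen (x :: l) (y ^ k).
  move=> Hk y; rewrite inE => /orP [/eqP ->|yl].
    rewrite -[x ^ k](mulVKg x) -commgEl; apply: (sgM (sg_gen _)); first exact: gen_head.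
    by apply: gen_cons; exact: hx.
  by apply: gen_cons; apply: normalizes_mem (IH _ cl Hk) _; exact: gen_mem.
by apply: normalizes_gen => y yl; rewrite gen_subgroup_seq; apply: aux => //; exact: sgV.
Qed.

Lemma gen_cons_ext H x l : is_subgroup H -> central_list H (x :: l) -> H x ->
  gen (x :: l) = ext (gen l) x.
Proof.
move=> sH [cl _] Hx; have nx := central_list_normal sH cl Hx.
apply/seteqP; split.
  apply: gen_min; first exact: sg_ext (sg_gen _) nx.
  move=> y; rewrite inE => /orP [/eqP ->|/gen_mem]; first exact: ext_mem (sg_gen _).
  exact: ext_sub.
by apply: ext_min; [exact: sg_gen|exact: gen_cons|exact: gen_head].
Qed.

(** Normal forms along the list: since [K] contains [x ^+ m], the exponent of each entry matters
    only modulo [m], which leaves [m] choices per entry. *)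
Lemma power_index H K l m : is_subgroup H -> is_subgroup K -> central_list H l ->
  (forall x, x \in l -> H x) -> (forall g, H g -> normalizes g K) -> (0 < m)%N ->
  (forall x, x \in l -> K (x ^+ m)) ->
  exists2 r : seq G, (size r <= m ^ size l)%N &
    forall x, gen l x -> exists2 y, y \in r & K (y^-1 * x).
Proof.
move=> sH sK cl lH nK m0 hK; elim: l cl lH hK => [|x l IH] cl lH hK.
  exists [:: 1] => // x gx; exists 1; first exact: mem_head.
  have -> : x = 1 by apply: (gen_min (@sg_one G) _ gx) => y; rewrite in_nil.
  by rewrite invg1 mulg1; exact: sg1.
have Hx : H x := lH x (mem_head _ _).
have [| | |r rs hr] := IH; [by case: cl| | |].
- by move=> y yl; apply: lH; rewrite inE yl orbT.
- by move=> y yl; apply: hK; rewrite inE yl orbT.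
exists [seq y * x ^+ i | y <- r, i <- iota 0 m].
  by rewrite size_allpairs size_iota /= expnS mulnC leq_mul2l rs orbT.
move=> g; rewrite (gen_cons_ext sH cl Hx) => -[j /hr [y yr Ky]].
pose i := `|((- j) %% m%:Z)%Z|%N; have iE : (Posz i = (- j) %% m%:Z)%Z by rewrite /i; lia.
exists (y * x ^+ i); first by apply: allpairs_f => //; rewrite mem_iota; lia.
have e : (- j)%R = (Posz i + m%:Z * ((- j) %/ m%:Z)%Z)%R by rewrite iE; lia.
have -> : (y * x ^+ i)^-1 * g =
    (y^-1 * (g * expz x j)) ^ (x ^+ i) * expz x (m%:Z * ((- j) %/ m%:Z)%Z)%R.
  have -> : expz x (m%:Z * ((- j) %/ m%:Z)%Z)%R = (x ^+ i)^-1 * expz x (- j)%R.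
    by rewrite {2}e expzD mulKg.
  by rewrite expzN !conjgE invgM !mulgA !mulgK.
apply: sgM => //; first by apply: normalizes_mem Ky; apply: nK; exact: sgX.
have Kx : K (x ^+ m) := hK x (mem_head _ _).
case: ((- j) %/ m%:Z)%Z => q; first by rewrite expz_mul; exact: sgX.
by rewrite NegzE GRing.mulrN expzN expz_mul; apply: sgV => //; exact: sgX.
Qed.

End CentralLists.

Section IteratedCommutators.
Context {G : groupType}.
Variables (S : seq G) (c : nat).
Local Notation H := (gen S).
Hypothesis (nilH : lower_central H c `<=` [set 1]).

Fixpoint comms (i : nat) : seq G :=
  if i is j.+1 then [seq [~ x, a] | x <- comms j, a <- letters S] else S.

Definition comms_from (i : nat) : seq G := flatten [seq comms j | j <- iota i (c - i)].

Let sH : is_subgroup H := sg_gen S.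

Lemma comms_lc i x : x \in comms i -> lower_central H i x.
Proof.
elim: i x => [|i IH] x; first exact: gen_mem.
by move=> /allpairsP [[y a] /= [yi aS ->]]; apply: lc_comm; [exact: IH|exact: gen_letter].
Qed.

Lemma comms_big i x : (c <= i)%N -> x \in comms i -> x = 1.
Proof. by move=> ci /comms_lc /(lc_le sH ci) /nilH. Qed.

Lemma comms_fromP i x :
  reflect (exists2 j, (i <= j < c)%N & x \in comms j) (x \in comms_from i).
Proof.
apply: (iffP flatten_mapP) => [[j]|[j hj xj]].
  by rewrite mem_iota => hj xj; exists j => //; lia.
by exists j => //; rewrite mem_iota; lia.
Qed.

Lemma comms_gen i j x : (i <= j)%N -> x \in comms j -> gen (comms_from i) x.
Proof.
move=> ij xj; have [jc|cj] := ltnP j c.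
  by apply: gen_mem; apply/comms_fromP; exists j => //; rewrite ij.
by rewrite (comms_big cj xj); exact: sg1 (sg_gen _).
Qed.

(* The left-normed commutators of weight > i in the generators generate the
   i-th term of the lower central series. *)
Lemma comms_normal i g : H g -> normalizes g (gen (comms_from i)).
Proof.
have aux a : a \in letters S -> normalizes a (gen (comms_from i)).
  move=> aS; have aux2 b x : b \in letters S -> x \in comms_from i ->
      gen (comms_from i) (x ^ b).
    move=> bS /comms_fromP [j /andP [ij jc] xj].
    rewrite -[x ^ b](mulVKg x) -commgEl; apply: (sgM (sg_gen _)); first exact: comms_gen xj.
    by apply: (@comms_gen _ j.+1); [lia|apply: allpairs_f].
  rewrite -gen_subgroup_seq; apply: normalizes_gen => x xi; rewrite gen_subgroup_seq.
    exact: aux2.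
  by apply: aux2 => //; rewrite lettersV.
move=> [n]; elim: n g => [g ->|n IH g [a aS bg]]; first exact: normalizes1.
by rewrite -[g](mulVKg a); apply: normalizesM; [exact: aux|exact: IH].
Qed.

Lemma comms_comm i x h : gen (comms_from i) x -> H h -> gen (comms_from i.+1) [~ x, h].
Proof.
have key y g : y \in comms_from i -> H g -> gen (comms_from i.+1) [~ y, g].
  move=> /comms_fromP [j /andP [ij jc] yj] [n].
  elim: n g => [g ->|n IH g [a aS bg]]; first by rewrite commg1; exact: sg1 (sg_gen _).
  rewrite -[g](mulVKg a) commgMr; apply: (sgM (sg_gen _)); first exact: IH.
  apply: normalizes_mem; first by apply: comms_normal; exact: ball_gen bg.
  by apply: (@comms_gen _ j.+1) => //; apply: allpairs_f.
move=> gx Hh.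
have sub : gen (comms_from i) `<=` [set x | H x /\ gen (comms_from i.+1) [~ x, h]].
  apply: gen_min; last first.
    move=> y yi; split; last exact: key.
    by case/comms_fromP: yi => j _ /comms_lc /(lc_sub sH).
  apply/is_subgroupP; split; first by split; [exact: sg1|rewrite comm1g; exact: sg1 (sg_gen _)].
  move=> y z [Hy hy] [Hz hz]; split; first by apply: sgM => //; exact: sgV.
  rewrite commgMl commgVl; apply: (sgM (sg_gen _)).
    by apply: normalizes_mem hy; apply: comms_normal; exact: sgV.
  apply: normalizes_mem; first by apply: comms_normal; exact: sgV.
  exact: sgV (sg_gen _) hz.
by case: (sub x gx).
Qed.

Lemma lc_gen i : lower_central H i = gen (comms_from i).
Proof.
apply/seteqP; split.
  elim: i => [|i IH] /=.
    by apply: gen_min (sg_gen _) _ => x xS; exact: (@comms_gen _ 0).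
  apply: gen_subgroup_min; first exact: sg_gen.
  by move=> _ [x [y [hx hy ->]]]; apply: comms_comm => //; exact: IH.
apply: gen_min; first exact: sg_lc.
by move=> x /comms_fromP [j /andP [ij _] /comms_lc]; exact: lc_le.
Qed.

Lemma central_list_comms : central_list H (comms_from 0) /\ H = gen (comms_from 0).
Proof.
split; last exact: (lc_gen 0).
have key s i : (forall x, x \in s -> x \in comms i) ->
   central_list H (comms_from i.+1) -> central_list H (s ++ comms_from i.+1).
  move=> hs cl; elim: s hs => [|x s IH] hs //=; split.
    by apply: IH => y ys; apply: hs; rewrite inE ys orbT.
  move=> h Hh; have : gen (comms_from i.+1) [~ x, h].
    by apply: comms_comm => //; apply: comms_gen (leqnn _) _; apply: hs; exact: mem_head.
  move=> hg; apply: gen_min hg; first exact: sg_gen.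
  by move=> y yi; apply: gen_mem; rewrite mem_cat yi orbT.
have : forall k i, (c - i)%N = k -> central_list H (comms_from i).
  elim => [|k IH] i hi; first by rewrite /comms_from hi.
  have -> : comms_from i = comms i ++ comms_from i.+1.
    by rewrite /comms_from hi /= subnS hi.
  by apply: key => //; apply: IH; rewrite subnS hi.
by apply.
Qed.

End IteratedCommutators.

Lemma nilpotent_central_list (G : groupType) (S : seq G) : nilpotent_subgroup (gen S) ->
  exists2 l, gen S = gen l & central_list (gen S) l.
Proof.
move=> /(nilpotentP (sg_gen S)) [c hc].
by have [cl e] := central_list_comms hc; exists (comms_from S c 0).
Qed.

Lemma nilpotent_power_fidx (G : groupType) (S : seq G) m : nilpotent_subgroup (gen S) ->
  (0 < m)%N -> fidx (power_subgroup (gen S) m) (gen S).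
Proof.
move=> /nilpotent_central_list [l el cl] m0.
have sH := sg_gen S.
have lH x : x \in l -> gen S x by move=> xl; rewrite el; exact: gen_mem.
have nP g : gen S g -> normalizes g (power_subgroup (gen S) m).
  by move=> Hg; apply: power_normalizes; exact: sg_self_normalizes.
have hP x : x \in l -> power_subgroup (gen S) m (x ^+ m).
  by move=> xl; apply: power_mem; exact: lH.
have [r _ hr] := power_index sH (sg_power (gen S) m) cl lH nP m0 hP.
by exists r => x; rewrite {1}el; exact: hr.
Qed.

End Nilpotent.

(** * Kronecker's theorem *)

Section Kronecker.
Import Order.TTheory GRing.Theory Num.Theory.
Local Open Scope ring_scope.

Local Notation mapC := (map_poly (intr : int -> algC)).

Lemma char_poly_conj (F : fieldType) n (P A : 'M[F]_n) : P \in unitmx ->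
  char_poly (P *m A *m invmx P) = char_poly A.
Proof.
move=> uP; pose Q := map_mx polyC P; pose Q' := map_mx polyC (invmx P).
have QQ : Q *m Q' = 1%:M by rewrite -map_mxM mulmxV // map_mx1.
rewrite /char_poly.
have -> : char_poly_mx (P *m A *m invmx P) = Q *m char_poly_mx A *m Q'.
  rewrite /char_poly_mx mulmxBr mulmxBl !map_mxM; congr (_ - _).
  by rewrite mul_mx_scalar -scalemxAl QQ scalemx1.
rewrite !det_mulmx mulrAC -det_mulmx QQ det1 mul1r //.
Qed.

Lemma trig_mul (F : comPzRingType) n (A B : 'M[F]_n) : is_trig_mx A -> is_trig_mx B ->
  is_trig_mx (A *m B) /\ forall i, (A *m B) i i = A i i * B i i.
Proof.
move=> /is_trig_mxP tA /is_trig_mxP tB; split.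
  apply/is_trig_mxP => i j ij; rewrite mxE big1 // => l _.
  have [il|li] := ltnP i l; first by rewrite tA // mul0r.
  by rewrite tB ?mulr0 //; exact: leq_ltn_trans li ij.
move=> i; rewrite mxE (bigD1 i) //= big1 ?addr0 // => l li.
have [il|il] := ltnP i l; first by rewrite tA // mul0r.
by rewrite tB ?mulr0 // ltn_neqAle il andbT.
Qed.

Lemma trig_exp (F : comPzRingType) n (A : 'M[F]_n) k : is_trig_mx A ->
  is_trig_mx (A ^+ k) /\ forall i, (A ^+ k) i i = A i i ^+ k.
Proof.
move=> tA; elim: k => [|k [t1 h1]].
  split; last by move=> i; rewrite !expr0 mxE eqxx.
  by apply/is_trig_mxP => i j ij; rewrite expr0 mxE; case: eqP ij => // ->; rewrite ltnn.
have [t2 h2] := trig_mul tA t1; split; first by rewrite exprS.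
by move=> i; rewrite !exprS h2 h1.
Qed.

Lemma map_mx_exp (F F' : pzRingType) (f : {rmorphism F -> F'}) n (A : 'M[F]_n) k :
  map_mx f (A ^+ k) = map_mx f A ^+ k.
Proof.
elim: k => [|k IH]; first by rewrite !expr0 map_mx1.
by rewrite !exprS -IH -[A * _]/(A *m _) map_mxM.
Qed.

Lemma prod_coef_le (I : Type) (s : seq I) (z : I -> algC) j : (forall i, `|z i| <= 1) ->
  `|(\prod_(i <- s) ('X - (z i)%:P))`_j| <= 2 ^+ size s.
Proof.
move=> hz; elim: s j => [|i s IH] j.
  by rewrite big_nil coef1; case: (j == 0%N); rewrite ?normr1 ?normr0 ?expr0 // ler01.
rewrite big_cons mulrBl coefB coefXM coefCM exprS.
apply: (le_trans (ler_normB _ _)).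
have h1 : `|if j == 0%N then 0 else (\prod_(j <- s) ('X - (z j)%:P))`_j.-1| <= 2 ^+ size s.
  by case: ifP => _; [rewrite normr0 exprn_ge0|exact: IH].
have h2 : `|z i * (\prod_(j <- s) ('X - (z j)%:P))`_j| <= 2 ^+ size s.
  rewrite normrM -[X in _ <= X]mul1r; apply: ler_pM => //; exact: IH.
by rewrite mulr_natl mulr2n; apply: lerD.
Qed.

Lemma pigeonhole_nat (T : finType) (f : nat -> T) (N : nat) :
  exists k l, [/\ (N <= k)%N, (k < l)%N & f k = f l].
Proof.
apply: contrapT => hno.
pose g (i : 'I_#|T|.+1) := f (N + i)%N.
have ginj : injective g.
  move=> i j e; apply: val_inj => /=; case: (ltngtP i j) => // lt.
    by case: hno; exists (N + i)%N, (N + j)%N; split; rewrite ?leq_addr ?ltn_add2l.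
  by case: hno; exists (N + j)%N, (N + i)%N; split; rewrite ?leq_addr ?ltn_add2l.
have := leq_card g ginj; by rewrite card_ord ltnn.
Qed.

(* Kronecker's theorem; the powers of the companion matrix have characteristic
   polynomials with bounded integer coefficients, hence two of them agree. *)
Lemma kronecker (p : {poly int}) : p \is monic ->
  (forall a : algC, root (mapC p) a -> `|a| <= 1 /\ a != 0) ->
  exists2 e : nat, (0 < e)%N & forall a : algC, root (mapC p) a -> a ^+ e = 1.
Proof.
move=> mp hp; have mpC : mapC p \is monic by rewrite monic_map.
(* Schur triangularization requires a positive dimension, so constant polynomials are treated
   apart. *)
have [d0|d0] := posnP (size p).-1.
  exists 1%N => // a; have -> : mapC p = 1.
    apply/eqP; have := mpC; rewrite monicE => /eqP lc.
    have szE : size (mapC p) = size p by apply: size_map_inj_poly; [exact: intr_inj|].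
    have sp : (size (mapC p) <= 1)%N by rewrite szE; lia.
    have s0 : (size (mapC p)).-1 = 0%N by lia.
    move: lc; rewrite lead_coefE s0 => c1.
    by have := size1_polyC sp; rewrite c1 => ->.
  by move=> ra; have := root1 a; rewrite ra.
pose M := companionmx p; pose MC := map_mx (intr : int -> algC) M.
(* In triangular form the eigenvalues of [M ^+ k] are visibly the [k]-th powers of the roots of
   [p]. *)
have [P uP tP] := Schur MC d0.
have Pu : P \in unitmx by exact: unitarymx_unit.
pose T := P *m MC *m invmx P.
have tT : is_trig_mx T by move: tP; rewrite /similar_to conjumx.
have powT k : T ^+ k = P *m MC ^+ k *m invmx P.
  elim: k => [|k IH]; first by rewrite !expr0 mulmx1 mulmxV.
  rewrite !exprS IH -[T * _]/(T *m _) -[MC * _]/(MC *m _) /T !mulmxA; congr (_ *m _ *m _).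
  by rewrite -(mulmxA _ (invmx P)) mulVmx // mulmx1.
have charE k : mapC (char_poly (M ^+ k)) = \prod_(i < _) ('X - ((T i i) ^+ k)%:P).
  rewrite map_char_poly map_mx_exp.
  rewrite -(char_poly_conj _ Pu) -powT.
  have [t h] := trig_exp k tT; rewrite (char_poly_trig t).
  by apply: eq_bigr => i _; rewrite h.
have pE : mapC p = \prod_(i < _) ('X - (T i i)%:P).
  have := charE 1%N; rewrite expr1 /M companionmxK // => ->.
have rT i : root (mapC p) (T i i).
  by rewrite pE rootE horner_prod (bigD1 i) //= !hornerE subrr mul0r.
have Tle i : `|T i i| <= 1 by case: (hp _ (rT i)).
have T0 i : T i i != 0 by case: (hp _ (rT i)).
have cb k j : `|(char_poly (M ^+ k))`_j| <= (2 ^ (size p).-1)%N%:Z.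
  rewrite -(ler_int algC) intr_norm; set c := (_)%:~R.
  have -> : c = (\prod_(i < (size p).-1) ('X - ((T i i) ^+ k)%:P))`_j.
    by rewrite -charE coef_map.
  have := @prod_coef_le _ (index_enum 'I_(size p).-1) (fun i => T i i ^+ k) j.
  rewrite /index_enum -enumT size_enum_ord -[X in _ <= X]natrX => h; apply: h => i.
  by rewrite normrX exprn_ile1.
pose B := (2 ^ (size p).-1)%N.
pose code k : {ffun 'I_(size p).+1 -> 'I_(2 * B).+1} :=
  [ffun j : 'I_(size p).+1 => inord (absz ((char_poly (M ^+ k))`_j + B%:Z))].
have [k [l [k0 kl ckl]]] := pigeonhole_nat code 1.
have ekl : char_poly (M ^+ k) = char_poly (M ^+ l).
  apply/polyP => j; have [jp|jp] := ltnP j (size p).+1; last first.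
    have sz q : (char_poly (M ^+ q))`_j = 0.
      rewrite nth_default // size_char_poly.
      by apply: leq_trans (ltnW jp); case: (size p) (d0).
    by rewrite !sz.
  have := congr1 (fun g : {ffun 'I_(size p).+1 -> 'I_(2 * B).+1} => val (g (Ordinal jp))) ckl.
  rewrite !ffunE /=; have h1 := cb k j; have h2 := cb l j; rewrite -/B in h1 h2.
  move: h1 h2; move: ((char_poly (M ^+ k))`_j) ((char_poly (M ^+ l))`_j) => a b h1 h2.
  have h3 (c : int) : `|c| <= B%:Z -> (absz (c + B%:Z)%R < (2 * B).+1)%N by lia.
  by rewrite !inordK; [lia|exact: h3|exact: h3].
have sig i : exists j, T i i ^+ k = T j j ^+ l.
  have : root (mapC (char_poly (M ^+ k))) (T i i ^+ k).
    by rewrite charE rootE horner_prod (bigD1 i) //= !hornerE subrr mul0r.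
  rewrite ekl charE rootE horner_prod => /prodf_eq0 [j _].
  by rewrite !hornerE subr_eq0 => /eqP e; exists j.
(* Iterating the self-map [f] of the indices gives [T i i ^+ (k ^ n) = T j j ^+ (l ^ n)] with
   [j = iter n f i]. An index that recurs satisfies two such relations, and [k < l] makes its entry
   a root of unity. *)
have [f hf] := choice sig.
have hit n i : T i i ^+ (k ^ n) = T (iter n f i) (iter n f i) ^+ (l ^ n).
  elim: n i => [|n IH] i; first by rewrite !expn0 !expr1.
  by rewrite expnSr exprM IH /= exprAC hf -exprM mulnC -expnSr.
have rou i : exists2 e : nat, (0 < e)%N & T i i ^+ e = 1.
  have [n1 [n2 [_ n12 e12]]] := pigeonhole_nat (fun n => iter n f i) 1.
  have l0 : (0 < l)%N by lia.
  set b := T (iter n1 f i) (iter n1 f i).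
  have b0 : b != 0 by exact: T0.
  have e1 := hit n1 i; have e2 := hit n2 i; rewrite -e12 -/b in e1 e2.
  have e3 : b ^+ (l ^ n1 * k ^ (n2 - n1)) = b ^+ (l ^ n2).
    by rewrite exprM -e1 -exprM -expnD subnKC // ltnW.
  have lt : (l ^ n1 * k ^ (n2 - n1) < l ^ n2)%N.
    rewrite -{2}(subnKC (ltnW n12)) expnD ltn_pmul2l ?expn_gt0 ?l0 //.
    by rewrite ltn_exp2r // subn_gt0.
  have bq : b ^+ (l ^ n2 - l ^ n1 * k ^ (n2 - n1)) = 1.
    apply: (mulfI (expf_neq0 (l ^ n1 * k ^ (n2 - n1)) b0)).
    by rewrite -exprD subnKC ?(ltnW lt) // mulr1 e3.
  set q := (l ^ n2 - l ^ n1 * k ^ (n2 - n1))%N in bq.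
  have q0 : (0 < q)%N by rewrite /q subn_gt0.
  exists (k ^ n1 * q)%N; first by rewrite muln_gt0 expn_gt0 k0.
  by rewrite exprM e1 -exprM mulnC exprM bq expr1n.
have [g hg] := choice (fun i => let: ex_intro2 e h1 h2 := rou i in ex_intro _ e (conj h1 h2)).
exists (\prod_i g i)%N; first by apply: prodn_gt0 => i; case: (hg i).
move=> a; rewrite pE rootE horner_prod => /prodf_eq0 [j _].
rewrite !hornerE subr_eq0 => /eqP ->.
by rewrite (bigD1 j) //= exprM; case: (hg j) => _ ->; rewrite expr1n.
Qed.

End Kronecker.

(** * Unipotent action on lattices *)

Section Lattices.
Import Order.TTheory GRing.Theory Num.Theory.
Local Open Scope ring_scope.

Local Notation mapC := (map_poly (intr : int -> algC)).

(** If [2 <= |a|], the lower terms sum to at most [|a| ^+ d - 1], less than the leading term, whose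
    coefficient is a nonzero integer. *)
Lemma root_lt2 (p : {poly int}) (a : algC) : p != 0 -> (forall j, `|p`_j| <= 1) ->
  root (mapC p) a -> `|a| < 2.
Proof.
move=> p0 hp ra; rewrite real_ltNge ?normr_real ?realn //; apply/negP => a2.
have geo d : \sum_(j < d) `|a| ^+ j <= `|a| ^+ d - 1.
  elim: d => [|d IH]; first by rewrite big_ord0 expr0 subrr.
  rewrite big_ord_recr /= exprS.
  apply: (le_trans (lerD IH (lexx _))); rewrite addrAC lerD2r -mulr2n -mulr_natl.
  by rewrite ler_wpM2r // exprn_ge0.
have hc j : `|(mapC p)`_j| <= 1.
  by rewrite coef_map /= -intr_norm -[1]/(1%:~R) ler_int.
have szE : size (mapC p) = size p by apply: size_map_inj_poly; [exact: intr_inj|].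
have sp : (0 < size p)%N by rewrite lt0n size_poly_eq0.
move: ra; rewrite rootE horner_coef szE -(prednK sp) big_ord_recr /= addr_eq0 => /eqP e.
have l1 : 1 <= `|(mapC p)`_(size p).-1|.
  by rewrite coef_map /= -intr_norm -[1]/(1%:~R) ler_int -lead_coefE -gtz0_ge1 normr_gt0 lead_coef_eq0.
suff /negP h0 : ~~ (\sum_(j < (size p).-1) `|a| ^+ j <= `|a| ^+ (size p).-1 - 1) by apply: h0; exact: geo.
rewrite -real_ltNge; last 2 first.
- by rewrite realB ?real1 // realX // normr_real.
- by apply: ger0_real; apply: sumr_ge0 => j _; rewrite exprn_ge0.
have h : `|a| ^+ (size p).-1 <= \sum_(j < (size p).-1) `|a| ^+ j.
  have : `|(mapC p)`_(size p).-1 * a ^+ (size p).-1| <= \sum_(j < (size p).-1) `|a| ^+ j.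
    rewrite -normrN -e; apply: (le_trans (ler_norm_sum _ _ _)); apply: ler_sum => j _.
    by rewrite normrM normrX -[leRHS]mul1r ler_wpM2r // exprn_ge0.
  apply: le_trans; rewrite normrM normrX -[leLHS]mul1r ler_wpM2r // exprn_ge0 //.
by apply: lt_le_trans h; rewrite ltrBlDr ltrDl ltr01.
Qed.

Lemma norm_le1_pow (a : algC) : (forall k, (0 < k)%N -> `|a ^+ k| < 2) -> `|a| <= 1.
Proof.
move=> h; rewrite real_leNgt ?normr_real ?real1 //; apply/negP => a1.
have x0 : 0 < `|a| - 1 by rewrite subr_gt0.
have bern k : 1 + (`|a| - 1) *+ k <= `|a| ^+ k.
  elim: k => [|k IH]; first by rewrite mulr0n addr0.
  rewrite exprS; apply: (@le_trans _ _ (`|a| * (1 + (`|a| - 1) *+ k))).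
    have -> : `|a| * (1 + (`|a| - 1) *+ k) = `|a| + `|a| * ((`|a| - 1) *+ k) by ring.
    rewrite mulrS addrA addrC [1 + _]addrC subrK addrC lerD2l.
    rewrite -[leLHS]mul1r ler_wpM2r ?mulrn_wge0 // ltW //.
  by rewrite ler_wpM2l.
pose k := Num.bound (`|a| - 1)^-1.
have kb : (`|a| - 1)^-1 < k%:R by apply: archi_boundP; rewrite invr_ge0 ltW.
have k0 : (0 < k)%N.
  by rewrite -(ltr_nat algC); apply: le_lt_trans kb; rewrite invr_ge0 ltW.
have := h k k0; rewrite normrX => h2.
have h3 : 1 <= (`|a| - 1) *+ k.
  by rewrite -mulr_natr -[leLHS](divff (lt0r_neq0 x0)); apply: ler_wpM2l; apply: ltW.
have := le_lt_trans (bern k) h2; rewrite -[2]/(1 + 1) ltrD2l => h4.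
by have := le_lt_trans h3 h4; rewrite ltxx.
Qed.

Lemma horner_mx_comp_Xn (F : comNzRingType) n (A : 'M[F]_n.+1) k (p : {poly F}) :
  horner_mx A (p \Po 'X^k) = horner_mx (A ^+ k) p.
Proof.
elim/poly_ind: p => [|p c IH]; first by rewrite comp_poly0 !rmorph0.
by rewrite comp_polyD comp_polyM comp_polyX comp_polyC !rmorphD !rmorphM /= !horner_mx_C IH
  rmorphXn /= !horner_mx_X.
Qed.

(* Over algC the monic polynomial splits and each factor divides 'X^e - 1; the
   quotient has integer coefficients since p is monic. *)
Lemma monic_dvd_power (p : {poly int}) e : p \is monic ->
  (forall a : algC, root (mapC p) a -> a ^+ e = 1) ->
  exists d q, ('X^e - 1) ^+ d = q * p.
Proof.
move=> mp hp.
have mpC : mapC p \is monic by rewrite monic_map.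
have [r pE] := closed_field_poly_normal (mapC p).
rewrite (monicP mpC) scale1r in pE.
exists (size r); pose Y : {poly int} := ('X^e - 1) ^+ size r.
exists (Pdiv.CommonRing.rdivp Y p).
have eqY := Pdiv.RingMonic.rdivp_eq mp Y.
rewrite -/Y {1}eqY; suff -> : Pdiv.CommonRing.rmodp Y p = 0 by rewrite addr0.
set m := Pdiv.CommonRing.rmodp Y p in eqY *.
have inj := @map_inj_poly _ _ (intr : int -> algC) (@intr_inj algC) (rmorph0 _).
apply: inj; rewrite rmorph0; apply: contrapT => /eqP m0.
have dY : mapC p %| mapC Y.
  rewrite /Y rmorphXn rmorphB rmorph1 /= map_polyXn pE.
  have : {in r, forall a, a ^+ e = 1}.
    by move=> a ar; apply: hp; rewrite pE root_prod_XsubC.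
  elim: (r) => [|a s IH] h; first by rewrite big_nil dvd1p.
  rewrite big_cons /= exprS dvdp_mul //; last by apply: IH => b bs; apply: h; rewrite inE bs orbT.
  by rewrite dvdp_XsubCl rootE !hornerE h ?subrr // inE eqxx.
have dm : mapC p %| mapC m.
  have -> : mapC m = mapC Y - mapC (Pdiv.CommonRing.rdivp Y p) * mapC p.
    by rewrite {1}eqY rmorphD rmorphM /= addrC addKr.
  by rewrite dvdp_sub // dvdp_mull.
have := dvdp_leq m0 dm; rewrite !size_map_inj_poly ?rmorph0 //; try exact: intr_inj.
by rewrite leqNgt Pdiv.CommonRing.ltn_rmodpN0 // monic_neq0.
Qed.

Section StableLattice.
Variables (n : nat) (A : 'M[int]_n.+1) (Lam : 'rV[int]_n.+1 -> Prop).
Hypotheses (L0 : Lam 0) (LB : forall v w, Lam v -> Lam w -> Lam (v - w)).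
(** [LAV] says that [A] acts injectively on the quotient by [Lam]; in the application this action is
    conjugation by [t]. *)
Hypotheses (LA : forall v, Lam v -> Lam (v *m A)) (LAV : forall v, Lam (v *m A) -> Lam v).

Let LN v : Lam v -> Lam (- v). Proof. by move=> h; rewrite -sub0r; apply: LB. Qed.
Let LD v w : Lam v -> Lam w -> Lam (v + w).
Proof. by move=> h h'; rewrite -[w]opprK; apply: LB => //; apply: LN. Qed.
Let LZ (c : int) v : Lam v -> Lam (c *: v).
Proof.
move=> h; have hn k : Lam (v *+ k) by elim: k => [|k IH]; rewrite ?mulr0n // mulrS; apply: LD.
case: c => k; first by rewrite -[Posz k]natz scaler_nat.
by rewrite NegzE scaleNr -[Posz _]natz scaler_nat; apply: LN.
Qed.

Let LH (g : {poly int}) v : Lam v -> Lam (v *m horner_mx A g).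
Proof.
move=> h; elim/poly_ind: g => [|g c IH]; first by rewrite rmorph0 mulmx0.
rewrite rmorphD rmorphM /= horner_mx_X horner_mx_C mulmxDr mulmxA.
by apply: LD; [exact: LA|rewrite mul_mx_scalar; exact: LZ].
Qed.

(** The ideal of polynomials in [A] that annihilate the quotient by [Lam] rationally; [N] absorbs
    the torsion of the quotient. *)
Let J (p : {poly int}) := exists2 N : int, N != 0 & forall v, Lam (N *: (v *m horner_mx A p)).

Let JB (p q : {poly int}) : J p -> J q -> J (p - q).
Proof.
move=> [N N0 hN] [M M0 hM]; exists (N * M); first by rewrite mulf_neq0.
move=> v; rewrite rmorphB mulmxBr scalerBr; apply: LB.
  by rewrite mulrC -scalerA; apply: LZ.
by rewrite -scalerA; apply: LZ.
Qed.

Let JM (p q : {poly int}) : J p -> J (q * p).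
Proof. by case=> N N0 h; exists N => // v; rewrite rmorphM -[_ * _]/(_ *m _) mulmxA; apply: h. Qed.

Let JZ (c : int) (p : {poly int}) : c != 0 -> J (c *: p) -> J p.
Proof.
move=> c0 [N N0 h]; exists (N * c); first by rewrite mulf_neq0.
by move=> v; have := h v; rewrite linearZ /= -scalemxAr scalerA.
Qed.

Let JX (p : {poly int}) : J (p * 'X) -> J p.
Proof.
case=> N N0 h; exists N => // v; apply: LAV.
by have := h v; rewrite rmorphM /= horner_mx_X -scalemxAl mulmxA.
Qed.

Hypothesis killed : forall k i, (0 < k)%N -> exists p : {poly int},
  [/\ p != 0, forall j, `|p`_j| <= 1 & Lam (delta_mx 0 i *m horner_mx (A ^+ k) p)].

(** Multiply, over the basis vectors, the annihilating polynomials evaluated at ['X^k]. Coefficients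
    of absolute value at most 1 force leading coefficients 1 or -1 and put the [k]-th powers of the
    roots inside the disc of radius 2. *)
Let small k : (0 < k)%N -> exists f, [/\ J f, f != 0, `|lead_coef f| = 1 &
  forall a : algC, root (mapC f) a -> `|a ^+ k| < 2].
Proof.
move=> k0; have [p hp] := choice (fun i => killed i k0).
exists (\prod_i (p i \Po 'X^k)).
have lc i : `|lead_coef (p i \Po 'X^k)| = 1.
  have [p0 hi _] := hp i.
  rewrite lead_coef_comp ?size_polyXn ?ltnS // lead_coefXn expr1n mulr1.
  have e (x : int) : `|x| <= 1 -> x != 0 -> `|x| = 1 by lia.
  by apply: e; rewrite ?lead_coef_eq0 // lead_coefE.
have lcP : `|lead_coef (\prod_i (p i \Po 'X^k))| = 1.
  by rewrite lead_coef_prod normr_prod big1.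
split => //.
- exists 1 => // v; rewrite scale1r (row_sum_delta v) mulmx_suml.
  apply: big_ind => [//|u w|i _]; first exact: LD.
  rewrite -scalemxAl; apply: LZ; rewrite (bigD1 i) //= rmorphM /= -[_ * _]/(_ *m _) mulmxA.
  by apply: LH; rewrite horner_mx_comp_Xn; case: (hp i).
- by rewrite -lead_coef_eq0 -normr_eq0 lcP.
move=> a; rewrite rmorph_prod /= rootE horner_prod => /prodf_eq0 [i _].
rewrite map_comp_poly /= map_polyXn horner_comp hornerXn -rootE.
by case: (hp i) => p0 hi _; apply: root_lt2.
Qed.

(** Reducing ['X^k] modulo the characteristic polynomial and its coefficients modulo [N] leaves
    finitely many residues, so two powers of [A] agree modulo [N]; [LAV] cancels the smaller one. *)
Let torsion (N : int) : N != 0 -> exists2 f, (0 < f)%N &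
  forall w, Lam (N *: w) -> Lam (w *m (A ^+ f - 1)).
Proof.
move=> N0; pose c := char_poly A; have mc : c \is monic by exact: char_poly_monic.
pose r k := Pdiv.CommonRing.rmodp 'X^k c.
have rE k : horner_mx A (r k) = A ^+ k.
  have := congr1 (horner_mx A) (Pdiv.RingMonic.rdivp_eq mc 'X^k).
  by rewrite rmorphD rmorphM /= Cayley_Hamilton mulr0 add0r rmorphXn /= horner_mx_X.
pose code k : {ffun 'I_n.+1 -> 'I_(absz N).+1} :=
  [ffun j : 'I_n.+1 => inord (absz ((r k)`_j %% N)%Z)].
have [k [l [_ kl ckl]]] := pigeonhole_nat code 0.
have dvd j : (N %| (r l - r k)`_j)%Z.
  have [jn|jn] := ltnP j n.+1; last first.
    have z q : (r q)`_j = 0.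
      rewrite nth_default //; apply: leq_trans jn.
      have := Pdiv.CommonRing.ltn_rmodpN0 'X^q (monic_neq0 mc).
      by rewrite size_char_poly ltnS.
    by rewrite coefB !z subrr dvdz0.
  rewrite coefB; have := congr1 (fun g : {ffun 'I_n.+1 -> 'I_(absz N).+1} => val (g (Ordinal jn))) ckl.
  rewrite !ffunE /=; have b (x : int) : (absz (x %% N)%Z < (absz N).+1)%N.
    have := ltz_mod x N0; have := modz_ge0 x N0; lia.
  rewrite !inordK // => e; rewrite -eqz_mod_dvd; apply/eqP.
  have := modz_ge0 (r l)`_j N0; have := modz_ge0 (r k)`_j N0; lia.
pose g := \poly_(j < size (r l - r k)) ((r l - r k)`_j %/ N)%Z.
have gE : r l - r k = N *: g.
  apply/polyP => j; rewrite coefZ coef_poly; case: ltnP => jn.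
    by rewrite mulrC divzK.
  by rewrite nth_default // mulr0.
exists (l - k)%N; first by rewrite subn_gt0.
move=> w hw.
have : Lam (w *m (A ^+ (l - k) - 1) *m A ^+ k).
  rewrite -mulmxA -[_ *m A ^+ k]/(_ * A ^+ k) mulrBl mul1r -exprD subnK ?(ltnW kl) //.
  rewrite -!rE -rmorphB gE /= linearZ /= -scalemxAr scalemxAl; exact: LH.
move: (w *m _) => u; elim: k {kl ckl dvd g gE} => [|q IH]; first by rewrite expr0 mulmx1.
by rewrite exprSr -[A ^+ q * A]/(A ^+ q *m A) mulmxA => /LAV.
Qed.

(** By Gauss' lemma the primitive part [m0] of an element of [J] of least degree divides all of [J],
    hence is monic by [small]. As [small] is available for each [k], its roots lie in the closed
    unit disc; 0 is excluded since [J] is closed under division by ['X]. Kronecker's theorem then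
    puts a power of ['X^e - 1] into [J], and [torsion] removes the multiplier [N]. *)
Lemma unipotent_mod : exists e m, (0 < e)%N /\ forall k v, Lam (v *m (A ^+ (e * k) - 1) ^+ m).
Proof.
have [f1 [J1 f10 _ _]] := small (ltn0Sn 0).
pose P s := `[< exists p, [/\ J p, p != 0 & size p = s] >].
have exP : exists s, P s by exists (size f1); apply/asboolP; exists f1.
case: (ex_minnP exP) => s /asboolP [p [Jp p0 ps]] smin.
have pmin q : J q -> q != 0 -> (size p <= size q)%N.
  by move=> Jq q0; rewrite ps; apply: smin; apply/asboolP; exists q.
have dvdJ f : J f -> exists g, f = zprimitive p * g.
  move=> Jf; suff /dvdpP_int [g ->] : p %| f by exists g.
  rewrite /dvdp; apply: contrapT => /negP nd.
  have := Pdiv.Idomain.divp_eq f p; set q := f %/ p; set m := f %% p => e.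
  have Jm : J m.
    have -> : m = (lead_coef p ^+ scalp f p)%:P * f - q * p by rewrite mul_polyC e addrC addKr.
    by apply: JB; apply: JM.
  have := pmin m Jm; rewrite leqNgt Pdiv.Idomain.ltn_modpN0 // => h.
  by have := h nd.
pose m0 := zprimitive p; have m00 : m0 != 0 by rewrite zprimitive_eq0.
have Jm0 : J m0.
  have := Jp; rewrite {1}[p]zpolyEprim; apply: JZ.
  by apply: contraNneq p0 => c; rewrite [p]zpolyEprim c scale0r.
have mm0 : m0 \is monic.
  have [f [Jf f0 lf _]] := small (ltn0Sn 0); have [g fE] := dvdJ f Jf.
  have := lf; rewrite fE lead_coefM normrM => e.
  have := sgz_lead_primitive p; rewrite p0 -/m0 => sg.
  have l0 : 0 < lead_coef m0 by rewrite -sgz_gt0 sg.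
  have aux (x z : int) : x * z = 1 -> 0 < x -> 0 <= z -> x = 1.
    move=> xz x0 z0; have z1 : 0 < z by rewrite lt_neqAle z0 andbT; apply: contra_eq_neq xz => <-; rewrite mulr0.
    have : x <= x * z by apply: ler_peMr; [exact: ltW|rewrite -gtz0_ge1].
    by rewrite xz; lia.
  rewrite -/m0 (gtr0_norm l0) in e.
  by rewrite monicE (aux _ _ e l0 (normr_ge0 _)).
have roots (a : algC) : root (mapC m0) a -> `|a| <= 1 /\ a != 0.
  move=> ra; split.
    apply: norm_le1_pow => k k0; have [f [Jf _ _ hf]] := small k0.
    have [g fE] := dvdJ f Jf; apply: hf.
    by rewrite fE rmorphM /= rootM ra.
  apply/eqP => a0; rewrite a0 in ra.
  have : root m0 0.
    move: ra; rewrite !rootE -[X in (mapC m0).[X]](rmorph0 intr) horner_map /=.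
    by rewrite intr_eq0.
  move=> /factor_theorem [q]; rewrite subr0 => qE.
  have q0 : q != 0 by apply: contraNneq m00 => q0; rewrite qE q0 mul0r.
  have Jq : J q by apply: JX; rewrite -qE.
  have := pmin q Jq q0; rewrite -(size_zprimitive p) -/m0 qE size_mulX //.
  by rewrite ltnn.
have [e e0 he] := kronecker mm0 roots.
have [d [q qE]] := monic_dvd_power mm0 he.
have [N N0 hN] : J (('X^e - 1) ^+ d) by rewrite qE; exact: JM.
have [f f0 hf] := torsion N0.
exists (e * f)%N, d.+1; split; first by rewrite muln_gt0 e0.
move=> k v; have kE : exists c, (A ^+ (e * f * k) - 1) ^+ d.+1 = (A ^+ (e * f) - 1) ^+ d.+1 *m horner_mx A c.
  exists ((\sum_(i < k) 'X^(e * f) ^+ i) ^+ d.+1).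
  transitivity (horner_mx A (('X^(e * f * k) - 1) ^+ d.+1)).
    by rewrite rmorphXn rmorphB rmorph1 rmorphXn /= horner_mx_X.
  rewrite (exprM 'X (e * f) k) subrX1 exprMn rmorphM /= -[_ *m _]/(_ * _); congr (_ * _).
  by rewrite rmorphXn rmorphB rmorph1 rmorphXn /= horner_mx_X.
have [c ->] := kE; rewrite mulmxA; apply: LH.
(* Of the [d.+1] factors, [d] supply [('X^e - 1) ^+ d] and the last one supplies ['X^f - 1]. *)
have [g gE] : exists g, ('X^(e * f) - 1 : {poly int}) ^+ d.+1 =
    ('X^e - 1) ^+ d * ('X^f - 1) * g.
  have h1 : ('X^(e * f) - 1 : {poly int}) = ('X^e - 1) * \sum_(i < f) 'X^e ^+ i.
    by rewrite exprM subrX1.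
  have h2 : ('X^(e * f) - 1 : {poly int}) = ('X^f - 1) * \sum_(i < e) 'X^f ^+ i.
    by rewrite mulnC exprM subrX1.
  exists ((\sum_(i < f) 'X^e ^+ i) ^+ d * \sum_(i < e) 'X^f ^+ i).
  by rewrite exprSr {1}h1 h2 exprMn mulrACA.
have -> : (A ^+ (e * f) - 1) ^+ d.+1 = horner_mx A (('X^(e * f) - 1) ^+ d.+1).
  by rewrite rmorphXn rmorphB rmorph1 rmorphXn /= horner_mx_X.
rewrite gE !rmorphM /= -![_ * _]/(_ *m _) !mulmxA; apply: LH.
have -> : horner_mx A ('X^f - 1) = A ^+ f - 1 by rewrite rmorphB rmorph1 rmorphXn /= horner_mx_X.
by apply: hf; exact: hN.
Qed.

End StableLattice.

End Lattices.

(** * Extensions by an infinite cyclic group *)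

Section CyclicExtensions.
Local Open Scope classical_set_scope.
Local Open Scope group_scope.

Lemma row_int_ind n (Q : 'rV[int]_n -> Prop) :
  (forall v w, Q v -> Q w -> Q (v - w)%R) -> (forall i, Q (delta_mx 0 i)%R) ->
  Q 0%R -> forall v, Q v.
Proof.
move=> QB Qe Q0.
have QN v : Q v -> Q (- v)%R by move=> h; rewrite -GRing.sub0r; apply: QB.
have QD v w : Q v -> Q w -> Q (v + w)%R.
  by move=> hv hw; rewrite -[w]GRing.opprK; apply: QB => //; apply: QN.
have Qn k v : Q v -> Q (v *+ k)%R.
  by move=> h; elim: k => [|k IH]; rewrite ?GRing.mulr0n // GRing.mulrS; apply: QD.
have QZ (c : int) v : Q v -> Q (c *: v)%R.
  move=> h; case: c => k; first by rewrite -[Posz k]natz GRing.scaler_nat; apply: Qn.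
  by rewrite NegzE GRing.scaleNr -[Posz _]natz GRing.scaler_nat; apply: QN; apply: Qn.
by move=> v; rewrite (row_sum_delta v); apply: big_ind => [//|u w|i _]; [exact: QD|exact: QZ].
Qed.

Section Layer.
Context {G : groupType}.
Variables (B B' : set G) (n : nat) (u : 'I_n.+1 -> G) (t : G).
Hypotheses (sB : is_subgroup B) (sB' : is_subgroup B') (BB : B' `<=` B).
Hypothesis (abB : forall x y, B x -> B y -> B' [~ x, y]).
Hypothesis (Bu : forall i, B (u i)).
Hypothesis (genu : forall H : set G, is_subgroup H -> (forall i, H (u i)) -> B `<=` H).
Hypotheses (nB : normalizes t B) (nB' : normalizes t B').

Let nBB x : B x -> normalizes x B'.
Proof.
move=> Bx y; split=> h.
  have -> : y ^ x = y * [~ y, x] by rewrite mulKVg.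
  by apply: sgM => //; apply: abB => //; exact: BB.
have By : B y by rewrite -[y](conjgK x); apply: sgJ (sgV sB Bx) => //; exact: BB.
by have := abB By Bx; rewrite commgEl sgMr // sgVE.
Qed.

Definition layer_prod (v : 'rV[int]_n.+1) : G := \prod_i expz (u i) (v 0%R i).
Local Notation phi := layer_prod.
(** The graph of the map from integer vectors to [B / B'], which is additive only modulo [B'];
    working with this relation avoids forming the quotient group. *)
Definition layer_rel (v : 'rV[int]_n.+1) x := B x /\ B' ((phi v)^-1 * x).
Local Notation R := layer_rel.

Let Bphi v : B (phi v).
Proof.
by rewrite /phi; elim/big_ind: _ => [|x y|i _]; [exact: sg1|exact: sgM|exact: sg_expz].
Qed.

Let phiD v w : B' ((phi (v + w)%R)^-1 * (phi v * phi w)).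
Proof.
suff [] : [/\ B (phi v), B (phi w) & B' ((phi (v + w)%R)^-1 * (phi v * phi w))] by [].
rewrite /phi; elim/big_rec3: _ => [|i z x y _ [By Bx h]].
  by rewrite invg1 !mul1g; split; exact: sg1.
split; try by apply: sgM => //; exact: sg_expz.
rewrite mxE expzD; set a := expz _ _; set b := expz _ _.
have Bb : B b by exact: sg_expz.
have -> : (a * b * z)^-1 * (a * y * (b * x)) = z^-1 * (y * x) * [~ y, b] ^ x.
  by rewrite commgEl !conjgE !invgM !mulgA; do !rewrite ?mulgKV ?mulgK.
apply: sgM => //; apply: (normalizes_mem (nBB _)) => //; exact: abB.
Qed.

Let RD v w x y : R v x -> R w y -> R (v + w)%R (x * y).
Proof.
move=> [Bx hx] [By hy]; split; first exact: sgM.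
have -> : (phi (v + w)%R)^-1 * (x * y) =
  (phi (v + w)%R)^-1 * (phi v * phi w) * (((phi v)^-1 * x) ^ (phi w) * ((phi w)^-1 * y)).
  by rewrite !conjgE !mulgA; do !rewrite ?mulgKV ?mulgK.
by apply: sgM => //; apply: sgM => //; apply: (normalizes_mem (nBB _)).
Qed.

Let phi0 : phi 0%R = 1.
Proof. by rewrite /phi big1 // => i _; rewrite mxE. Qed.

Let R0 x : B' x -> R 0%R x.
Proof. by move=> h; split; [exact: BB|rewrite phi0 invg1 mul1g]. Qed.

Let R0V x : R 0%R x -> B' x.
Proof. by case=> _; rewrite phi0 invg1 mul1g. Qed.

Let Rphi v : R v (phi v).
Proof. by split=> //; rewrite mulVg; exact: sg1. Qed.

Let RN v x : R v x -> R (- v)%R x^-1.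
Proof.
move=> h; have := RD h (Rphi (- v)%R); rewrite GRing.subrr => /R0V h2.
have [Bx _] := h; split; first exact: sgV.
by have := sgV sB' h2; rewrite invgM.
Qed.

Let RV v x : R v x -> R v 1 -> B' x.
Proof.
move=> h h1; have := RD h (RN h1); rewrite GRing.subrr invg1 mulg1; exact: R0V.
Qed.

Let RE v x : R v x -> B' x -> R v 1.
Proof.
move=> h /R0 /RN h2; have := RD h h2; rewrite mulgV GRing.oppr0 GRing.addr0; exact.
Qed.

Let Re i : R (delta_mx 0 i)%R (u i).
Proof.
suff e : phi (delta_mx 0 i)%R = u i by rewrite -e; exact: Rphi.
rewrite /phi (eq_bigr (fun j => if j == i then u j else 1)).
  by rewrite -big_mkcond big_pred1_eq.
by move=> j _; rewrite mxE /=; case: eqP.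
Qed.

Let Rex x : B x -> exists v, R v x.
Proof.
move=> Bx; suff : [set x | exists v, R v x] x by [].
apply: genu Bx; last by move=> i; exists (delta_mx 0 i)%R.
apply/is_subgroupP; split; first by exists 0%R; apply: R0; exact: sg1.
by move=> y z [v hv] [w hw]; exists (v - w)%R; apply: RD hv (RN hw).
Qed.

(** Conjugation by [t] acts on the layer through an integer matrix [A]. A bit string read as a
    polynomial, evaluated at [A ^+ k] on a basis vector, is the class of the corresponding [twist],
    so a collision yields a nonzero annihilator with coefficients -1, 0, 1. The free multiplier [k]
    in the conclusion lets several layers share one exponent. *)
Lemma layer_unipotent S d : growth S d -> B `<=` gen S -> gen S t ->
  exists e m, (0 < e)%N /\
    forall k x, B x -> B' (iter m (fun y => [~ y, t ^+ (e * k)]) x).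
Proof.
move=> gS BS St.
have exa i : exists v, R v (u i ^ t) by apply: Rex; exact: normalizes_mem (Bu i).
have [a ha] := choice exa.
pose A : 'M[int]_n.+1 := (\matrix_i a i)%R.
have RA v x : R v x -> R (v *m A)%R (x ^ t).
  have key w : R (w *m A)%R (phi w ^ t).
    elim/row_int_ind: w => [v1 v2 h1 h2|i|].
    - have [_ e] := RD (Rphi v1) (RN (Rphi v2)).
      have := RD (RD h1 (RN h2)) (RN (R0 (normalizes_mem nB' e))).
      rewrite -mulmxBl GRing.oppr0 GRing.addr0; congr R.
      by rewrite -!conjVg -!conjMg; congr (_ ^ t); rewrite invgM invgK mulKVg.
    - have [_ e] := Re i; have := RD (ha i) (RN (R0 (normalizes_mem nB' e))).
      rewrite GRing.oppr0 GRing.addr0 -rowE rowK; congr R.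
      by rewrite -conjVg -conjMg invgM invgK mulKVg.
    - by rewrite mul0mx phi0 conj1g; apply: R0; exact: sg1.
  move=> [Bx h]; have := RD (key v) (R0 (normalizes_mem nB' h)).
  by rewrite GRing.addr0 -conjMg mulKVg.
have RAk k v x : R v x -> R (v *m (A ^+ k))%R (x ^ (t ^+ k)).
  move=> h; elim: k => [|k IH]; first by rewrite GRing.expr0 mulmx1 conjg1.
  by rewrite GRing.exprSr expgSr conjgM -[(_ * A)%R]/(_ *m A)%R mulmxA; apply: RA.
pose Lam v := R v 1.
have L0 : Lam 0%R by apply: R0; exact: sg1.
have LB v w : Lam v -> Lam w -> Lam (v - w)%R.
  by move=> h1 h2; have := RD h1 (RN h2); rewrite mulgV.
have LA v : Lam v -> Lam (v *m A)%R by move=> /RA; rewrite conj1g.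
have LAV v : Lam (v *m A)%R -> Lam v.
  move=> h; have := RV (RA _ _ (Rphi v)) h => /(nB' (phi v)); exact: RE (Rphi v).
have killed k i : (0 < k)%N -> exists p : {poly int},
    [/\ p != 0%R, forall j, (`|p`_j| <= 1)%R &
      Lam (delta_mx 0 i *m horner_mx (A ^+ k) p)%R].
  move=> _; have [bs [bs' [ne es et]]] := twist_collision gS (BS _ (Bu i)) (sgX k (sg_gen S) St).
  pose pol (cs : seq bool) : {poly int} := Poly [seq Posz (nat_of_bool c) | c <- cs].
  have Rpol cs : R (delta_mx 0 i *m horner_mx (A ^+ k) (pol cs))%R (twist (u i) (t ^+ k) cs).
    elim: cs => [|c cs IH] /=; first by rewrite /pol /= GRing.rmorph0 mulmx0; apply: R0; exact: sg1.
    have -> : (pol (c :: cs) = pol cs * 'X + (Posz (nat_of_bool c))%:P)%R.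
      by rewrite /pol /= cons_poly_def.
    rewrite GRing.rmorphD GRing.rmorphM /= horner_mx_X horner_mx_C mulmxDr GRing.addrC.
    apply: RD; last by rewrite -[(_ * A ^+ k)%R]/(_ *m _)%R mulmxA; exact: RAk.
    rewrite mul_mx_scalar; case: c; first by rewrite GRing.scale1r; exact: Re.
    by rewrite GRing.scale0r; apply: R0; exact: sg1.
  exists (pol bs - pol bs')%R; split.
  - rewrite GRing.subr_eq0; apply: contra_neq ne => e.
    apply: (@eq_from_nth _ false) => // j jb.
    have := congr1 (fun q : {poly int} => q`_j)%R e.
    rewrite !coef_Poly !(nth_map false) -?es //.
    by case: (nth false bs j); case: (nth false bs' j).
  - move=> j; rewrite coefB !coef_Poly.
    have b01 cs : exists b : bool, ([seq Posz (nat_of_bool c) | c <- cs]`_j)%R = Posz (nat_of_bool b).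
      have [jc|jc] := ltnP j (size cs); first by rewrite (nth_map false) //; exists (nth false cs j).
      by exists false; rewrite nth_default ?size_map.
    by have [[] ->] := b01 bs; have [[] ->] := b01 bs'.
  - rewrite GRing.rmorphB mulmxBr; have := RD (Rpol bs) (RN (Rpol bs')).
    by rewrite et mulgV.
have [e [m [e0 hm]]] := unipotent_mod L0 LB LA LAV killed.
exists e, m; split=> // k x /Rex [v Rv].
suff Rj j : R (v *m ((A ^+ (e * k) - 1) ^+ j))%R
    (iter j (fun y => [~ y, t ^+ (e * k)]) x).
  exact: RV (Rj m) (hm k v).
elim: j => [|j IH]; first by rewrite GRing.expr0 mulmx1.
rewrite GRing.exprSr -[(_ * (_ - 1))%R]/(_ *m _)%R mulmxA mulmxBr mulmx1 GRing.addrC /=.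
by rewrite commgEl; apply: RD; [exact: RN|exact: RAk].
Qed.

End Layer.

Definition virtually_nilpotent_in (G : groupType) (H : set G) :=
  exists N, [/\ is_subgroup N, N `<=` H, fidx N H & nilpotent_subgroup N].

Section NilpotentExtension.
Context {G : groupType}.
Implicit Types (H K L P N : set G).

(** Two of the powers [x ^+ 0], ..., [x ^+ size r] lie in one coset; the difference of their
    exponents divides the factorial, which thus serves all [x] at once. *)
Lemma fidx_exponent N K : is_subgroup N -> is_subgroup K -> fidx N K ->
  exists2 q, (0 < q)%N & forall x, K x -> N (x ^+ q).
Proof.
move=> sN sK [r hr]; exists ((size r)`!); first exact: fact_gt0.
move=> x Kx; have hx i : exists2 y, y \in r & N (y^-1 * x ^+ i) by apply: hr; exact: sgX.
have [f hf] := choice (fun i => let: ex_intro2 y h1 h2 := hx i in ex_intro _ y (conj h1 h2)).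
suff [i [j [ij jr e]]] : exists i j, [/\ (i < j)%N, (j <= size r)%N & f i = f j].
  have : N (x ^+ (j - i)).
    have := sgM sN (sgV sN (hf i).2) (hf j).2.
    by rewrite e invgM invgK mulgA mulgK -[in x ^+ j](subnKC (ltnW ij)) expgD mulKg.
  have /dvdnP [c ->] : (j - i %| (size r)`!)%N by apply: dvdn_fact; lia.
  by rewrite mulnC expgM; exact: sgX.
apply: contrapT => hno.
have un : uniq [seq f i | i <- iota 0 (size r).+1].
  rewrite map_inj_in_uniq ?iota_uniq // => i j; rewrite !mem_iota !add0n => /= hi hj e.
  by case: (ltngtP i j) => // lt; case: hno; [exists i, j|exists j, i].
have : (size [seq f i | i <- iota 0 (size r).+1] <= size r)%N.
  by apply: uniq_leq_size => // _ /mapP [i _ ->]; exact: (hf i).1.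
by rewrite size_map size_iota ltnn.
Qed.

Lemma comm_normalizer L N : is_subgroup N ->
  is_subgroup [set h | normalizes h N /\ forall x, L x -> N [~ x, h]].
Proof.
move=> sN; apply/is_subgroupP; split.
  by split=> [|x _]; [exact: normalizes1|rewrite commg1; exact: sg1].
move=> h g [nh hh] [ng hg]; split; first by apply: normalizesM => //; exact: normalizesV.
have ngV := normalizesV ng.
move=> x Lx; rewrite commgMr; apply: sgM => //.
  by rewrite commgVr; apply: normalizes_mem ngV _; apply: sgV => //; exact: hg.
by apply: normalizes_mem ngV _; exact: hh.
Qed.

Lemma ext_derived P s : is_subgroup P -> normalizes s P ->
  lower_central (ext P s) 1 `<=` P.
Proof.
move=> sP ns; pose H := ext P s.
have sH : is_subgroup H by exact: sg_ext.
have hs : H `<=` [set x | normalizes x P /\ P [~ x, s]].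
  apply: ext_min.
  - apply/is_subgroupP; split; first by split; [exact: normalizes1|rewrite comm1g; exact: sg1].
    move=> x y [nx hx] [ny hy]; have nV := normalizesV ny; split; first exact: normalizesM.
    rewrite commgMl; apply: sgM => //; first exact: normalizes_mem nV hx.
    by rewrite commgVl; apply: normalizes_mem nV _; exact: sgV.
  - move=> x Px; split; first exact: sg_self_normalizes.
    by rewrite commgEl; apply: sgM => //; [exact: sgV|exact: (normalizes_mem _ Px)].
  - by split=> //; rewrite commgg; exact: sg1.
have hh : H `<=` [set h | normalizes h P /\ forall x, H x -> P [~ x, h]].
  apply: ext_min; first exact: comm_normalizer.
  - move=> p Pp; split=> [|x /hs [nx _]]; first exact: sg_self_normalizes.
    by rewrite commgEr; apply: sgM => //; apply: normalizes_mem nx _; exact: sgV.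
  - by split=> // x /hs [].
by apply: gen_subgroup_min => // _ [x [y [Hx Hy ->]]]; case: (hh y Hy) => _; apply.
Qed.

(** Each layer is refined by [W j], the elements carried into the next layer by [j] successive
    commutators with [s]. Commutators with [P] and with [s] map [W j.+1] into [W j], so the lower
    central series of the extension crosses the layer in [m] steps. *)
Lemma ext_nilpotent P s : is_subgroup P -> nilpotent_subgroup P -> normalizes s P ->
  (forall i, exists m, forall x, lower_central P i x ->
     lower_central P i.+1 (iter m (fun y => [~ y, s]) x)) ->
  nilpotent_subgroup (ext P s).
Proof.
move=> sP /(nilpotentP sP) [c hc] ns hm.
have sH := sg_ext sP ns; apply/(nilpotentP sH).
pose B i := lower_central P i.
have sB i : is_subgroup (B i) by exact: sg_lc.
have nB i : normalizes s (B i) by exact: lc_normalizes.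
suff key i : exists k, lower_central (ext P s) k `<=` B i.
  by have [k hk] := key c; exists k; exact: subset_trans hk hc.
elim: i => [|i [k hk]]; first by exists 1%N; exact: ext_derived.
pose fix W j := if j is j'.+1 then [set x | B i x /\ W j' [~ x, s]] else B i.+1.
have BW j : B i.+1 `<=` W j.
  elim: j => [//|j IH] x Bx; split; first exact: lc_subS Bx.
  by apply: IH; rewrite commgEl; apply: (sgM (sB i.+1)); [exact: sgV (sB i.+1) Bx|exact: normalizes_mem (nB i.+1) Bx].
have WB j : W j `<=` B i by case: j => [|j]; [exact: lc_subS|move=> x []].
have Wp j x p : is_subgroup (W j) -> P p -> W j x -> W j (x ^ p).
  move=> sW Pp Wx; have -> : x ^ p = x * [~ x, p] by rewrite mulKVg.
  by apply: sgM => //; apply: BW; apply: lc_comm => //; exact: WB Wx.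
have sW j : is_subgroup (W j).
  elim: j => [|j IH]; first exact: sB.
  apply/is_subgroupP; split; first by split; [exact: sg1|rewrite comm1g; exact: sg1].
  move=> x y [Bx hx] [By hy]; split; first by apply: sgM => //; exact: sgV.
  have PyV : P y^-1 by apply: sgV => //; exact: lc_sub By.
  rewrite commgMl; apply: sgM => //; first exact: Wp.
  by rewrite commgVl; apply: Wp => //; exact: sgV.
have nW j : normalizes s (W j).
  elim: j => [|j IH] x; first exact: nB.
  have e : [~ x ^ s, s] = [~ x, s] ^ s by rewrite conjRg (_ : s ^ s = s) // conjgE mulKg.
  by split=> -[h1 h2]; split; [exact: (nB i x).1|rewrite e; exact: (IH _).1|exact: (nB i x).2|apply: (IH _).2; rewrite -e].
have comW j x h : W j.+1 x -> ext P s h -> W j [~ x, h].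
  move=> Wx; have sub : ext P s `<=` [set h | normalizes h (W j) /\ forall x, W j.+1 x -> W j [~ x, h]].
    apply: ext_min; first exact: comm_normalizer.
    - move=> p Pp; split=> [y|y [By _]]; last by apply: BW; exact: lc_comm.
      split=> [|h0]; first exact: Wp.
      by rewrite -[y](conjgK p); apply: Wp => //; exact: sgV.
    - by split=> // y [].
  by case/sub => _; apply.
have [m hmi] := hm i; exists (k + m)%N.
have BWm : B i `<=` W m.
  suff gn j x : B i x -> B i.+1 (iter j (fun y => [~ y, s]) x) -> W j x.
    by move=> x Bx; apply: gn => //; exact: hmi.
  elim: j x => [|j IH] x Bx //; rewrite iterSr => h; split=> //; apply: IH => //.
  by rewrite commgEl; apply: (sgM (sB i)); [exact: sgV (sB i) Bx|exact: normalizes_mem (nB i) Bx].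
suff gn j : (j <= m)%N -> lower_central (ext P s) (k + j) `<=` W (m - j)%N.
  by have := gn m (leqnn m); rewrite subnn.
elim: j => [|j IH] jm; first by rewrite addn0 subn0; exact: subset_trans hk BWm.
rewrite addnS; apply: gen_subgroup_min => // _ [x [y [hx hy ->]]].
by apply: comW hy; rewrite subnSK //; apply: IH (ltnW jm) _ hx.
Qed.

Lemma ext_power_fidx P t e : is_subgroup P -> normalizes t P -> (0 < e)%N ->
  fidx (ext P (t ^+ e)) (ext P t).
Proof.
move=> sP nt e0; have nte := normalizesX e nt; have sL := sg_ext sP nte.
have nL : normalizes t (ext P (t ^+ e)).
  have eJ j : expz (t ^+ e) j ^ t = expz (t ^+ e) j by case: j => j /=; rewrite ?conjVg !conjXg conjgE mulKg.
  have eM x j : (x * expz (t ^+ e) j) ^ t = x ^ t * expz (t ^+ e) j by rewrite conjMg eJ.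
  by move=> x; split=> -[j h]; exists j; [rewrite -eM; exact: (nt _).1|apply: (nt _).2; rewrite eM].
apply: (@fidx_subr _ _ _ (ext (ext P (t ^+ e)) t)).
  by move=> x [j h]; exists j; exact: ext_sub.
by apply: ext_fidx e0 _ => //; exact: ext_mem.
Qed.

(** [N] may be moved by [t], so it is replaced by the power subgroup [P] of [K], which every
    automorphism of [K] preserves. [P] lies in [N] by the choice of [q], and it has finite index
    since it contains a power subgroup of the finitely generated nilpotent group [N]. *)
Lemma milnor_wolf S d K T t : growth S d -> K = gen T -> K `<=` gen S -> gen S t ->
  normalizes t K -> virtually_nilpotent_in K -> virtually_nilpotent_in (ext K t).
Proof.
move=> gS eK KS St nK [N [sN NK iN nilN]].
have sK : is_subgroup K by rewrite eK; exact: sg_gen.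
have [q q0 hq] := fidx_exponent sN sK iN.
pose P := power_subgroup K q; have sP : is_subgroup P by exact: sg_power.
have PN : P `<=` N by apply: gen_subgroup_min => // _ [x Kx <-]; exact: hq.
have PK : P `<=` K by exact: power_sub.
have nilP := nilpotent_sub sP sN PN nilN.
have nP : normalizes t P by exact: power_normalizes.
have iP : fidx P K.
  have [TN eN] : exists TN, N = gen TN by move: NK iN; rewrite eK; exact: fidx_fg.
  apply: (fidx_trans sN sK _ iN); apply: (fidx_subl (power_mono NK)).
  by rewrite eN; apply: nilpotent_power_fidx => //; rewrite -eN.
have [TP eP] : exists TP, P = gen TP by move: PK iP; rewrite eK; exact: fidx_fg.
have [c hc] := (nilpotentP sP).1 nilP.
have layer i : exists e m, (0 < e)%N /\ forall k x, lower_central P i x ->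
    lower_central P i.+1 (iter m (fun y => [~ y, t ^+ (e * k)]) x).
  have hc' : lower_central (gen TP) c `<=` [set 1] by rewrite -eP.
  (* The leading 1 makes the list nonempty, as matrices of size [n.+1] require. *)
  pose l := 1 :: comms_from TP c i.
  have lE : lower_central P i = gen l.
    rewrite eP (lc_gen hc'); apply/seteqP; split; first exact: gen_cons.
    apply: gen_min (sg_gen _) _ => x; rewrite inE => /orP [/eqP -> |]; last exact: gen_mem.
    exact: sg1 (sg_gen _).
  have sB j : is_subgroup (lower_central P j) by exact: sg_lc.
  apply: (@layer_unipotent _ (lower_central P i) (lower_central P i.+1) (size (comms_from TP c i))
    (fun j => nth 1 l j) t) gS _ St => //.
  - exact: lc_subS.
  - by move=> x y Bx /(lc_sub sP) Py; exact: lc_comm.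
  - by move=> j; rewrite lE; apply: gen_mem; rewrite mem_nth.
  - move=> H sH hH; rewrite lE; apply: gen_min => // x /(nthP 1) [j jl <-].
    exact: (hH (Ordinal jl)).
  - exact: lc_normalizes.
  - exact: lc_normalizes.
  - exact: subset_trans (lc_sub sP) (subset_trans PK KS).
have [e he] := choice layer.
(* A common multiple of the exponents makes [t ^+ E] act unipotently on all layers
   simultaneously. *)
pose E := (\prod_(i < c) e i)%N.
have E0 : (0 < E)%N by apply: prodn_gt0 => i; case: (he i) => m [].
have nE := normalizesX E nP.
exists (ext P (t ^+ E)); split.
- exact: sg_ext.
- apply: ext_min; [exact: sg_ext|exact: subset_trans PK (@ext_sub _ _ _)|].
  by apply: sgX; [exact: sg_ext|exact: ext_mem].
- have iPt : fidx (ext P t) (ext K t).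
    have [r hr] := iP; exists r => x [j /hr [y yr h]]; exists y => //; exists j.
    by rewrite -mulgA.
  apply: fidx_trans iPt; [exact: sg_ext|exact: sg_ext|exact: ext_power_fidx].
apply: ext_nilpotent => // i; have [ic|ci] := ltnP i c.
  have [m [_ hm]] := he i; exists m => x.
  have -> : E = (e i * (\prod_(j < c | j != Ordinal ic) e j))%N by rewrite /E (bigD1 (Ordinal ic)).
  exact: hm.
by exists 0%N => x /(lc_le sP ci) /hc -> /=; exact: sg1 (sg_lc i.+1 sP).
Qed.

End NilpotentExtension.

End CyclicExtensions.

(** * Virtual nilpotency of residually finite groups of polynomial growth *)

Section Gromov.
Local Open Scope classical_set_scope.
Local Open Scope group_scope.

Lemma growth_virtually_nilpotent (R : realType) (G : groupType) (S : seq G) d :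
  growth S d -> residually_finite G -> virtually_nilpotent_in (gen S).
Proof.
elim: d S => [|d IH] S gS rf;
  (have [fin|inf] := pselect (fidx [set (1 : G)] (gen S));
    [by exists [set 1]; split; [exact: sg_one|move=> _ ->; exact: sg1 (sg_gen S)| |
        exists 0%N] | ]).
  by case: inf; exact: growth0_finite gS.
have [L [t [sL LS St [inj nL iL]]]] := @virtually_Z R _ _ _ gS inf rf.
have sE := sg_ext sL nL.
have ES : ext L t `<=` gen S by apply: ext_min => //; exact: sg_gen.
have [S' eS'] := fidx_fg sE ES iL.
have gS' : growth S' d.+1.
  by apply: growth_sub gS => x xS'; apply: ES; rewrite eS'; exact: gen_mem.
have [T eT] := ext_kernel_fg gS' sL nL (esym eS') inj.
have gT := ext_kernel_growth gS' sL (esym eS') inj eT nL.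
have := IH T gT rf; rewrite -eT => vL.
have [N [sN NE iN nN]] := milnor_wolf gS eT LS St nL vL.
exists N; split => //; first exact: subset_trans NE ES.
exact: fidx_trans sE (sg_gen S) iN iL.
Qed.

End Gromov.

(** * Distortion in nilpotent groups *)

Section NilpotentDistortion.
Local Open Scope classical_set_scope.
Local Open Scope group_scope.

Lemma poly_mono C C' c c' n : (C <= C' -> c <= c' -> C * n.+1 ^ c <= C' * n.+1 ^ c')%N.
Proof. by move=> CC cc; apply: leq_mul => //; apply: leq_pexp2l. Qed.

Lemma poly_comp C c C' c' n :
  (C' * (C * n.+1 ^ c).+1 ^ c' <= (C' * C.+1 ^ c') * n.+1 ^ (c * c'))%N.
Proof.
rewrite -mulnA leq_mul2l expnM -expnMn leq_expn ?orbT //.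
have : (0 < n.+1 ^ c)%N by rewrite expn_gt0.
by rewrite mulSn; lia.
Qed.

Section Distortion.
Context {G : groupType}.
Implicit Types (H K W : set G) (l L : seq G).

(** The conjugate of [y] by [g ^+ j] is [y] times the conjugates of [[~ y, g]] by [g ^+ i] for
    [i < j]; these belong to the later entries, where polynomial distortion is known. *)
Lemma conj_distortion H l L g a : is_subgroup H -> central_list H l -> H g ->
  {subset l <= L} -> gen l a ->
  exists C c, forall j, wball L (C * j.+1 ^ c) (a ^ (g ^+ j)).
Proof.
move=> sH; elim: l a => [|y l IH] a cl Hg lL.
  have e : gen [::] `<=` [set (1 : G)] by apply: gen_min => //; exact: sg_one.
  by move=> /e ->; exists 0%N, 0%N => j; rewrite conj1g.
case: cl => cl /(_ g Hg) yg; move: a.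
have lL' : {subset l <= L} by move=> x xl; apply: lL; rewrite inE xl orbT.
pose A := [set a | exists C c, forall j, wball L (C * j.+1 ^ c) (a ^ (g ^+ j))].
suff : gen (y :: l) `<=` A by [].
have sA : is_subgroup A.
  apply/is_subgroupP; split; first by exists 0%N, 0%N => j; rewrite conj1g.
  move=> a b [C [c h]] [C' [c' h']]; exists (C + C')%N, (c + c')%N => j.
  rewrite conjMg conjVg mulnDl; apply: ballM; first by apply: ball_mono (h j); exact: poly_mono (leq_addr _ _).
  by apply: ballV; apply: ball_mono (h' j); exact: poly_mono (leq_addl _ _).
apply: gen_min => // x; rewrite inE => /orP [/eqP ->|xl]; last first.
  by apply: (IH x) => //; exact: gen_mem.
have [C [c h]] := IH _ cl Hg lL' yg.
have yL : wball L 1 y by apply: ball_letter; apply: mem_letters; apply: lL; exact: mem_head.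
exists C.+1, c.+1 => j.
suff hj : wball L (1 + j * (C * j.+1 ^ c)) (y ^ (g ^+ j)).
  apply: ball_mono hj; rewrite expnS; have : (0 < j.+1 ^ c)%N by rewrite expn_gt0.
  by move: (j.+1 ^ c)%N => p p0; nia.
have mono i : (i <= j)%N -> wball L (C * j.+1 ^ c) ([~ y, g] ^ (g ^+ i)).
  by move=> ij; apply: ball_mono (h i); rewrite leq_mul2l leq_expn ?orbT.
suff hi i : (i <= j)%N -> wball L (1 + i * (C * j.+1 ^ c)) (y ^ (g ^+ i)) by exact: hi.
elim: i => [|i IHi] ij; first by rewrite conjg1 addn0.
rewrite expgS conjgM (_ : y ^ g = y * [~ y, g]); last by rewrite mulKVg.
rewrite conjMg mulSn addnCA addnC.
by apply: ballM; [apply: IHi; exact: ltnW|apply: mono; exact: ltnW].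
Qed.

Lemma conj_distortion_letters H l t : is_subgroup H -> central_list H l -> H t ->
  exists C c, forall a (j : int), a \in letters l ->
    wball l (C * (absz j).+1 ^ c) (a ^ expz t j).
Proof.
move=> sH cl Ht.
have key (s : seq G) : {subset s <= letters l} -> exists C c, forall a (j : int), a \in s ->
    wball l (C * (absz j).+1 ^ c) (a ^ expz t j).
  elim: s => [|b s IH] sub; first by exists 0%N, 0%N.
  have [C [c h]] : exists C c, forall a (j : int), a \in s ->
      wball l (C * (absz j).+1 ^ c) (a ^ expz t j).
    by apply: IH => x xs; apply: sub; rewrite inE xs orbT.
  have gb : gen l b by apply: gen_letter; apply: sub; exact: mem_head.
  have [C1 [c1 h1]] := conj_distortion sH cl Ht (fun x xl => xl) gb.
  have [C2 [c2 h2]] := conj_distortion sH cl (sgV sH Ht) (fun x xl => xl) gb.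
  exists (C + C1 + C2)%N, (c + c1 + c2)%N => a j; rewrite inE => /orP [/eqP ->|aS].
    case: j => j /=.
      by apply: ball_mono (h1 j); apply: poly_mono; lia.
    by rewrite -expVgn; apply: ball_mono (h2 j.+1); apply: poly_mono; lia.
  by apply: ball_mono (h a j aS); apply: poly_mono; lia.
exact: key.
Qed.

(** Collect the letters [t] on the left: every other letter is conjugated by some [expz t j] with
    [j] bounded by the radius, at polynomial cost. *)
Lemma ball_normal_form H l t : is_subgroup H -> central_list H (t :: l) -> H t ->
  exists C c, forall n x, wball (t :: l) n x -> exists (j : int) k,
    [/\ x = expz t j * k, (absz j <= n)%N & wball l (C * n.+1 ^ c) k].
Proof.
move=> sH [cl _] Ht; have [C [c h]] := conj_distortion_letters sH cl Ht.
exists C, c.+1 => n x bx.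
suff key N m y : (m <= N)%N -> wball (t :: l) m y -> exists (j : int) k,
    [/\ y = expz t j * k, (absz j <= m)%N & wball l (m * (C * N.+1 ^ c)) k].
  have [j [k [-> jn bk]]] := key n n x (leqnn n) bx; exists j, k; split=> //.
  by apply: ball_mono bk; rewrite expnS mulnCA leq_mul // leq_mul // leqnSn.
elim: m y => [y _ ->|m IH y mN [a al by_]]; first by exists 0%R, 1; rewrite mulg1.
have [j [k [e jm bk]]] := IH _ (ltnW mN) by_.
have ey : y = a * expz t j * k by rewrite -mulgA -e mulKVg.
have step (i : int) : a = expz t i -> (absz i <= 1)%N -> exists (j : int) k,
    [/\ y = expz t j * k, (absz j <= m.+1)%N & wball l (m.+1 * (C * N.+1 ^ c)) k].
  move=> ai i1; exists (i + j)%R, k; split; first by rewrite ey expzD ai.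
    by lia.
  by apply: ball_mono bk; rewrite leq_mul2r leqnSn orbT.
have stepl : a \in letters l -> exists (j : int) k,
    [/\ y = expz t j * k, (absz j <= m.+1)%N & wball l (m.+1 * (C * N.+1 ^ c)) k].
  move=> al'; exists j, (a ^ expz t j * k); split; last 2 first.
  - exact: leqW.
  - rewrite mulSn; apply: ballM bk; apply: ball_mono (h a j al').
    by rewrite leq_mul2l leq_expn ?orbT //; lia.
  by rewrite ey conjgE !mulgA mulgV mul1g.
case/lettersP: al => [a1|at_|at_].
- by apply: stepl; rewrite a1 letters1.
- move: at_; rewrite inE => /orP [/eqP at_|al']; first by apply: (step 1%R); rewrite ?at_.
  by apply: stepl; exact: mem_letters.
- move: at_; rewrite inE => /orP [/eqP at_|al'].
    by apply: (step (-1)%R) => //; rewrite -at_ expzN /= invgK.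
  by apply: stepl; rewrite -lettersV; exact: mem_letters.
Qed.

End Distortion.

End NilpotentDistortion.

(** * Power subgroups avoiding balls *)

Section PowerSubgroups.
Local Open Scope classical_set_scope.
Local Open Scope group_scope.

Section Separation.
Context {G : groupType}.
Implicit Types (H K W : set G) (l S : seq G).

Lemma sg_comm_left W u : is_subgroup W -> is_subgroup [set a | normalizes a W /\ W [~ a, u]].
Proof.
move=> sW; apply/is_subgroupP; split; first by split; [exact: normalizes1|rewrite comm1g; exact: sg1].
move=> a b [na ha] [nb hb]; have nbV := normalizesV nb; split; first exact: normalizesM.
rewrite commgMl; apply: sgM => //; first exact: normalizes_mem nbV ha.
by rewrite commgVl; apply: normalizes_mem nbV _; exact: sgV.
Qed.

(* If [t] commutes modulo [W] with the lower terms of the list, then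
   [y ^ (t ^+ m)] equals [y * [~ y, t] ^+ m] modulo [W]. *)
Lemma power_centralizes H W l m t : is_subgroup H -> is_subgroup W -> central_list H l ->
  gen l `<=` H -> (forall h, H h -> normalizes h W) -> (forall z, gen l z -> W (z ^+ m)) ->
  H t -> forall a, gen l a -> W [~ a, t ^+ (m ^ size l)].
Proof.
move=> sH sW + + nW + Ht; elim: l => [|y l IH] cl lH lW.
  move=> a; have e : gen [::] `<=` [set (1 : G)] by apply: gen_min => //; exact: sg_one.
  by move=> /e ->; rewrite comm1g; exact: sg1.
case: (cl) => cl' cy; have lH' := subset_trans (@gen_cons _ y l) lH.
have lW' z : gen l z -> W (z ^+ m) by move=> /(@gen_cons _ y) /lW.
have {}IH := IH cl' lH' lW'.
pose u := t ^+ (m ^ size l); have Hu : H u by exact: sgX.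
have uE : t ^+ (m ^ size (y :: l)) = u ^+ m by rewrite -expgM -expnSr.
have uW z : gen l z -> W [~ z, u ^+ m].
  move=> lz; have [_ h] : [set h | normalizes h W /\ forall x, gen l x -> W [~ x, h]] (u ^+ m).
    by apply: sgX; [exact: comm_normalizer|split; [exact: nW|exact: IH]].
  exact: h.
have Hy : H y by apply: lH; exact: gen_head.
suff sub : gen (y :: l) `<=` [set a | normalizes a W /\ W [~ a, u ^+ m]].
  by move=> a /sub [_]; rewrite uE.
apply: gen_min; first exact: sg_comm_left.
move=> x; rewrite inE => /orP [/eqP ->|xl]; last first.
  by split; [apply: nW; apply: lH'; exact: gen_mem|apply: uW; exact: gen_mem].
split; first exact: nW.
set z := [~ y, u]; have zl : gen l z by exact: cy.
have Hz : H z by exact: lH'.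
suff h j : W ((z ^+ j)^-1 * [~ y, u ^+ j]).
  by rewrite -(sgMl _ sW (sgV sW (lW' z zl))); exact: h.
elim: j => [|j IHj]; first by rewrite commg1 invg1 mulg1; exact: sg1.
have zu i : W ((z ^+ i)^-1 * (z ^+ i) ^ u).
  by rewrite -commgEl; apply: IH; apply: sgX => //; exact: sg_gen.
rewrite [u ^+ _]expgSr commgMr -/z [z ^+ j.+1]expgS invgM -mulgA mulKg.
have -> : (z ^+ j)^-1 * [~ y, u ^+ j] ^ u = (z ^+ j)^-1 * (z ^+ j) ^ u * ((z ^+ j)^-1 * [~ y, u ^+ j]) ^ u.
  by move: [~ _, _] (z ^+ j) => X Z; rewrite !conjgE !mulgA; do !rewrite ?mulgKV ?mulgK.
by apply: (sgM sW) => //; apply: (normalizes_mem _ IHj); exact: nW.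
Qed.

Lemma expgM_normal K g k n : is_subgroup K -> normalizes g K -> K k ->
  exists2 k', K k' & (g * k) ^+ n = g ^+ n * k'.
Proof.
move=> sK ng Kk; elim: n => [|n [k' Kk' e]]; first by exists 1; rewrite ?mulg1 //; exact: sg1.
exists (k' ^ g * k); first by apply: sgM => //; exact: (normalizes_mem _ Kk').
by rewrite !expgSr e conjgE !mulgA mulgK.
Qed.

Lemma expgM_comm W g k n : is_subgroup W -> normalizes g W -> normalizes k W ->
  W [~ k, g] -> W ((g ^+ n * k ^+ n)^-1 * (g * k) ^+ n).
Proof.
move=> sW ng nk hk.
have kg j : W [~ k ^+ j, g].
  by have [] : [set a | normalizes a W /\ W [~ a, g]] (k ^+ j) by apply: sgX; [exact: sg_comm_left|].
elim: n => [|n IH]; first by rewrite !mulg1 invg1; exact: sg1.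
set w := (g ^+ n * k ^+ n)^-1 * (g * k) ^+ n in IH.
have e : (g * k) ^+ n = g ^+ n * k ^+ n * w by rewrite mulKVg.
have -> : (g ^+ n.+1 * k ^+ n.+1)^-1 * (g * k) ^+ n.+1 =
    ([~ k ^+ n, g] * w ^ g) ^ k.
  rewrite ![_ ^+ n.+1]expgSr e commgEl !conjgE !invgM -!mulgA.
  by do !rewrite ?mulKg ?mulKVg ?mulgA; do !rewrite ?mulgKV ?mulgK.
by apply: normalizes_mem nk _; apply: sgM => //; exact: normalizes_mem ng _.
Qed.

Lemma central_list_mono H K l : K `<=` H -> central_list H l -> central_list K l.
Proof. by move=> KH; elim: l => //= x l IH [/IH cl h]; split=> // k /KH; exact: h. Qed.

Lemma expz_expg (t : G) (j : int) q : expz t j ^+ q = expz (t ^+ q) j.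
Proof. by case: j => j /=; rewrite ?expVgn -!expgM mulnC. Qed.

Lemma ext_normal_form K t x : normalizes t K -> ext K t x ->
  exists (j : int) k, K k /\ x = expz t j * k.
Proof.
move=> nt [j Kx]; exists (- j)%R, ((x * expz t j) ^ expz t (- j)%R).
split; first by apply: normalizes_mem Kx; exact: normalizes_expz.
by rewrite conjgE mulVKg expzN mulgK.
Qed.

(** Divide the exponent by [q]: the quotient contributes powers of [t ^+ q], the remainder one of
    finitely many elements of [gen l]. *)
Lemma torsion_distortion l t q : gen l (t ^+ q) -> (0 < q)%N ->
  exists L, forall j : int, gen l (expz t j) -> wball l (L * (absz j).+1) (expz t j).
Proof.
move=> [a ha] q0.
pose s := [seq t ^+ r | r <- iota 0 q & `[< gen l (t ^+ r) >]].
have [L hL] : exists L, forall x, x \in s -> wball l L x.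
  by apply: ball_bound => x /mapP [r]; rewrite mem_filter => /andP [/asboolP h _] ->.
have key j : gen l (t ^+ j) -> wball l ((a + L) * j.+1) (t ^+ j).
  move=> gj; have e : t ^+ j = (t ^+ q) ^+ (j %/ q) * t ^+ (j %% q).
    by rewrite -expgM -expgD mulnC -divn_eq.
  have gr : gen l (t ^+ (j %% q)).
    have h1 : gen l ((t ^+ q) ^+ (j %/ q)) by apply: sgX; [exact: sg_gen|exists a].
    rewrite -(sgMl _ (sg_gen l) h1) -e. exact: gj.
  have hr : wball l L (t ^+ (j %% q)).
    apply: hL; apply/mapP; exists (j %% q)%N => //.
    by rewrite mem_filter mem_iota /= add0n ltn_mod q0 andbT; apply/asboolP.
  rewrite e; apply: ball_mono (ballM (ballX (j %/ q) ha) hr).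
  have : (j %/ q <= j)%N by exact: leq_div.
  by move: (j %/ q)%N => i; nia.
exists (a + L)%N => -[j|j] /= h; first exact: key.
apply: ballV; apply: ball_mono (key j.+1 _); first by [].
by rewrite -[X in gen l X]invgK; apply: sgV => //; exact: sg_gen.
Qed.

(** If some [t ^+ q] lies in [K], then [(q * M)]-th powers in [H] are [M]-th powers in [K] and
    induction applies directly. Otherwise [t] has infinite order modulo [K], and the powers taken in
    [H] are confined to the extension of [W] by [t ^+ e], in which a short element must have trivial
    [t]-exponent. *)
Lemma power_separation l : central_list (gen l) l -> exists C b, forall n,
  exists M, [/\ (0 < M)%N, (M <= C * n.+1 ^ b)%N &
    forall x, power_subgroup (gen l) M x -> wball l n x -> x = 1].
Proof.
elim: l => [_|t l IH clt].
  exists 1%N, 0%N => n; exists 1%N; split=> // x _ /ball_gen.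
  have e : gen [::] `<=` [set (1 : G)] by apply: gen_min => //; exact: sg_one.
  by move=> /e.
pose H := gen (t :: l); have sH : is_subgroup H := sg_gen _.
pose K := gen l; have sK : is_subgroup K := sg_gen _.
have KH : K `<=` H by exact: gen_cons.
have Ht : H t by exact: gen_head.
have [clH ct] := clt; have clK := central_list_mono KH clH.
have nK g : H g -> normalizes g K by exact: central_list_normal sH clH.
have EH : H = ext K t by exact: gen_cons_ext sH clt Ht.
have {IH} [C [b hC]] := IH clK.
have [D [c hD]] := ball_normal_form sH clt Ht.
have [[q q0 Kq]|notor] := pselect (exists2 q, (0 < q)%N & K (t ^+ q)).
  have [L hL] := torsion_distortion Kq q0.
  exists (q * (C * (L + D).+1 ^ b))%N, (c.+1 * b)%N => n.
  have [M [M0 MC hM]] := hC ((L + D) * n.+1 ^ c.+1)%N.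
  exists (q * M)%N; split; first by rewrite muln_gt0 q0.
    by rewrite -mulnA leq_mul2l; apply/orP; right; apply: leq_trans MC (poly_comp _ _ _ _ _).
  have powK : power_subgroup H (q * M) `<=` power_subgroup K M.
    apply: gen_subgroup_min; first exact: sg_power.
    move=> _ [h Hh <-]; rewrite expgM; apply: power_mem.
    move: Hh; rewrite EH => /(ext_normal_form (nK _ Ht)) [j [k [Kk ->]]].
    have [k' Kk' ->] := expgM_normal q sK (normalizes_expz j (nK _ Ht)) Kk.
    by apply: sgM => //; rewrite expz_expg; exact: sg_expz.
  move=> x /powK hx /hD [j [k [xE jn bk]]]; apply: hM => //.
  have Kx : K x by exact: power_sub hx.
  have Kj : K (expz t j) by move: Kx; rewrite xE sgMr //; exact: ball_gen bk.
  rewrite xE; apply: ball_mono (ballM (hL j Kj) bk).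
  have : (0 < n.+1 ^ c)%N by rewrite expn_gt0.
  by rewrite expnS; move: (n.+1 ^ c)%N (absz j) jn => p i; nia.
pose C1 := (C * D.+1 ^ b)%N; pose s := size l.
exists (C1 ^ s.+1)%N, (c * b * s.+1).+1 => n.
have [m [m0 mC hm]] := hC (D * n.+1 ^ c)%N.
have mC1 : (m <= C1 * n.+1 ^ (c * b))%N by apply: leq_trans mC (poly_comp _ _ _ _ _).
(* The factor [m ^ s] makes [t ^+ e] centralize [K] modulo [W]; the factor [n.+1] makes [e] exceed
   [n], so no nonzero multiple of [e] is the [t]-exponent of an element of the [n]-ball. *)
have [e eE] : {e | e = (m ^ s * n.+1)%N} by eexists.
have e0 : (0 < e)%N by rewrite eE muln_gt0 expn_gt0 m0.
exists (e * m)%N; split; first by rewrite muln_gt0 e0.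
  rewrite eE mulnAC -expnSr [(n.+1 ^ _)%N]expnSr mulnA leq_mul2r; apply/orP; right.
  by apply: leq_trans (leq_expn s.+1 mC1) _; rewrite expnMn -expnM.
pose W := power_subgroup K m; have sW : is_subgroup W by exact: sg_power.
have WK : W `<=` K by exact: power_sub.
have nW g : H g -> normalizes g W by move=> /nK; exact: power_normalizes.
have cW := power_centralizes sH sW clH KH nW (@power_mem _ K m) Ht.
have ce j k : K k -> W [~ k, expz (t ^+ e) j].
  move=> Kk; have [_] : [set h | normalizes h W /\ forall x, K x -> W [~ x, h]] (expz (t ^+ e) j).
    apply: sg_expz; first exact: comm_normalizer.
    rewrite eE expgM; apply: sgX; first exact: comm_normalizer.
    by split; [apply: nW; exact: sgX|exact: cW].
  exact.
have nte : normalizes (t ^+ e) W by apply: nW; exact: sgX.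
have powN : power_subgroup H (e * m) `<=` ext W (t ^+ e).
  have sN := sg_ext sW nte.
  apply: gen_subgroup_min => // _ [h Hh <-]; rewrite expgM.
  move: Hh; rewrite EH => /(ext_normal_form (nK _ Ht)) [j [k [Kk ->]]].
  have [k' Kk' ->] := expgM_normal e sK (normalizes_expz j (nK _ Ht)) Kk.
  rewrite expz_expg; set g := expz (t ^+ e) j.
  have Ng : ext W (t ^+ e) g by apply: sg_expz => //; exact: ext_mem.
  have Hg : H g by apply: sg_expz => //; exact: sgX.
  have hgk := expgM_comm m sW (nW _ Hg) (nW _ (KH _ Kk')) (ce j k' Kk').
  rewrite -[(g * k') ^+ m](mulVKg (g ^+ m * k' ^+ m)); apply: sgM => //; last exact: ext_sub hgk.
  by apply: sgM => //; [exact: sgX|apply: ext_sub; exact: power_mem].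
move=> x /powN [i Wx] /hD [j [k [xE jn bk]]].
have Kk : K k by exact: ball_gen bk.
have noK (z : int) : K (expz t z) -> z = 0%R.
  case: z => [[|z]|z] //= h; case: notor; first by exists z.+1.
  by exists z.+1 => //; rewrite -[t ^+ _]invgK; exact: sgV.
have etE : expz (t ^+ e) i = expz t (i * Posz e)%R by rewrite expz_mul expz_expg.
have ji : (j + i * Posz e)%R = 0%R.
  apply: noK; rewrite expzD -etE.
  have : K (expz t j * k * expz (t ^+ e) i) by apply: WK; rewrite -xE.
  have -> : expz t j * k * expz (t ^+ e) i =
      expz t j * expz (t ^+ e) i * k ^ expz (t ^+ e) i by rewrite conjgE !mulgA mulgK.
  by rewrite sgMr //; apply: normalizes_mem Kk; apply: nK; apply: sg_expz => //; exact: sgX.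
have en : (n < e)%N by rewrite eE leq_pmull // expn_gt0 m0.
have i0 : i = 0%R by nia.
have j0 : j = 0%R by rewrite -ji i0 GRing.mul0r GRing.addr0.
rewrite xE j0 mul1g; apply: hm => //.
by move: Wx; rewrite i0 mulg1 xE j0 mul1g.
Qed.

End Separation.

End PowerSubgroups.

(** * Finite quotients *)

Section Quotients.
Local Open Scope classical_set_scope.
Local Open Scope group_scope.

(** Schreier rewriting: each letter of a word over [S] is exchanged for one of the finitely many
    elements of [gen l] listed in [F]. *)
Lemma fidx_distortion (G : groupType) (S l : seq G) : gen l `<=` gen S ->
  fidx (gen l) (gen S) -> exists L, forall n x, wball S n x -> gen l x ->
  wball l (L * n.+1) x.
Proof.
move=> lS /(fidx_in (sg_gen l) (sg_gen S)) [r rS hr].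
pose F := [seq x <- r ++ [seq y^-1 | y <- r] ++
  [seq y^-1 * z | y <- r, z <- [seq a * y' | a <- letters S, y' <- r]] | `[< gen l x >]].
have [L hL] : exists L, forall x, x \in F -> wball l L x.
  by apply: ball_bound => x; rewrite mem_filter => /andP [/asboolP].
have FL x : gen l x -> x \in r ++ [seq y^-1 | y <- r] ++
  [seq y^-1 * z | y <- r, z <- [seq a * y' | a <- letters S, y' <- r]] -> wball l L x.
  by move=> gx xr; apply: hL; rewrite mem_filter xr andbT; apply/asboolP.
have key n x : wball S n x -> exists2 y, y \in r & wball l (L * n.+1) (y^-1 * x).
  elim: n x => [x ->|n IH x [a aS bx]].
    have [y yr gy] := hr 1 (sg1 (sg_gen S)); exists y => //.
    rewrite muln1; apply: FL => //; rewrite mulg1 !mem_cat (map_f _ yr) orbT //.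
  have [y yr by_] := IH _ bx.
  have [y' yr' gy'] := hr (a * y) (sgM (sg_gen S) (gen_letter aS) (rS y yr)).
  exists y' => //; have -> : y'^-1 * x = y'^-1 * (a * y) * (y^-1 * (a^-1 * x)).
    by rewrite !mulgA !mulgK.
  rewrite mulnS; apply: ballM by_; apply: FL => //.
  by rewrite !mem_cat; do 2 (apply/orP; right); apply: allpairs_f => //; exact: allpairs_f.
exists (2 * L)%N => n x /key [y yr bx] gx.
have gy : gen l y.
  have := sgM (sg_gen l) gx (sgV (sg_gen l) (ball_gen bx)).
  by rewrite invgM invgK mulVKg.
rewrite -[x](mulVKg y); apply: ball_mono (ballM (FL y gy _) bx); last by rewrite mem_cat yr.
by lia.
Qed.

(* The core of [N] is the intersection of the conjugates of [N] by
   representatives of the cosets of its normalizer, whence the exponent. *)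
Lemma coset_quotient (G : groupType) (N H : set G) (r q : seq G) : is_subgroup N ->
  (forall h, H h -> normalizes h N) ->
  (forall x, exists2 y, y \in r & N (y^-1 * x)) ->
  (forall x, exists2 y, y \in q & H (y^-1 * x)) ->
  exists (Q : finGroupType) (phi : {multiplicative G -> Q}),
    [/\ forall z : Q, exists x, phi x = z, (#|Q| <= size r ^ size q)%N &
        forall x, phi x = 1 -> N x].
Proof.
move=> sN nN hr hq.
pose code x := find (fun y => `[< N (y^-1 * x) >]) r.
have code_lt x : (code x < size r)%N.
  by rewrite -has_find; apply/hasP; have [y yr h] := hr x; exists y => //; exact/asboolP.
have codeN x : N ((nth 1 r (code x))^-1 * x).
  have hx : has (fun y => `[< N (y^-1 * x) >]) r by rewrite has_find; exact: code_lt.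
  by have /asboolP := nth_find 1 hx.
have code_eq x x' : code x = code x' <-> N (x^-1 * x').
  split=> [e|h].
    have := codeN x'; rewrite -e => h2; have := sgM sN (sgV sN (codeN x)) h2.
    by rewrite invgM invgK mulgA mulgK.
  apply: eq_find => y; apply/asboolP/asboolP => hy.
    by have := sgM sN hy h; rewrite mulgA mulgK.
  by have := sgM sN hy (sgV sN h); rewrite invgM invgK mulgA mulgK.
(* The finite type of left cosets of [N]: a coset is encoded by the least index in [r] of a
   representative, that is, by a fixed point of [code]. *)
pose T := {i : 'I_(size r) | code (nth 1 r i) == i}.
pose pt (i : T) := nth 1 r (val i).
have ptK (i : T) : code (pt i) = val i by apply/eqP; exact: valP i.
have cxP x : code (nth 1 r (Ordinal (code_lt x))) == Ordinal (code_lt x).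
  by apply/eqP => /=; apply/code_eq; exact: codeN.
pose cx x : T := exist _ (Ordinal (code_lt x)) (cxP x).
have cx_eq x x' : cx x = cx x' <-> N (x^-1 * x').
  rewrite -code_eq; split=> [e|e]; first by have := congr1 (fun i : T => nat_of_ord (val i)) e.
  by apply: val_inj; apply: val_inj.
have ptP x : N ((pt (cx x))^-1 * x) by exact: codeN.
have cxpt i : cx (pt i) = i by apply: val_inj; apply: val_inj; exact: ptK.
pose actf g (i : T) := cx (g^-1 * pt i).
have actI g : injective (actf g).
  move=> i j /cx_eq; rewrite invgM invgK !mulgA mulgK => /cx_eq.
  by rewrite !cxpt.
pose act g := perm (actI g).
have actE g x : act g (cx x) = cx (g^-1 * x).
  by rewrite permE; apply/cx_eq; rewrite invgM invgK !mulgA mulgK; exact: ptP.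
have actM : {morph act : g h / g * h}.
  move=> g h; apply/permP => i; rewrite -(cxpt i) permM !actE.
  by rewrite invgM mulgA.
pose A0 := finset.finset (fun s : {perm T} => `[< exists g, s = act g >]).
have A0P s : reflect (exists g, s = act g) (s \in A0).
  by rewrite finset.inE; exact: asboolP.
have gA : group_set A0.
  apply/group_setP; split.
    apply/A0P; exists 1; apply/permP => i.
    by rewrite -(cxpt i) actE invg1 mul1g perm1.
  by move=> s s' /A0P [g ->] /A0P [h ->]; apply/A0P; exists (g * h); rewrite actM.
pose A := Group gA.
have actA g : act g \in A by apply/A0P; exists g.
pose f g := subg A (act g).
have fM : {morph f : x y / x * y} by move=> x y; rewrite /f actM subgM.
pose mf := isMultiplicative.Build _ _ f fM.
pose phi : {multiplicative G -> subg_of A} := HB.pack f mf.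
exists (subg_of A), phi; split.
- move=> z; have /A0P [g e] := subgP z; exists g.
  by rewrite -[phi g]/(subg A (act g)) -e sgvalK.
- pose code2 (z : subg_of A) : {ffun 'I_(size q) -> T} :=
    [ffun i : 'I_(size q) => sgval z (cx (nth 1 q i))].
  have inj2 : injective code2.
    move=> z z' e; apply: subg_inj.
    have /A0P [g eg] := subgP z; have /A0P [g' eg'] := subgP z'.
    apply/permP => i; rewrite -(cxpt i) eg eg' !actE; apply/cx_eq.
    have [y yq Hy] := hq (pt i).
    have := congr1 (fun F : {ffun _ -> T} => F (Ordinal (etrans (index_mem y q) yq))) e.
    rewrite !ffunE /= nth_index // eg eg' !actE => /cx_eq.
    (* Conjugation by [y^-1 * pt i], an element of [H] and so a normalizer of [N], carries agreement
       at the coset of [y] to the coset of [pt i]. *)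
    move=> /(normalizes_mem (nN _ Hy)).
    by rewrite conjgE !invgM !invgK !mulgA; do !rewrite ?mulgKV ?mulgK.
  apply: leq_trans (leq_card _ inj2) _; rewrite card_ffun card_ord leq_expn //.
  by rewrite card_sig; apply: leq_trans (max_card _) _; rewrite card_ord.
move=> x e; have e1 : act x = 1.
  have := congr1 sgval e; rewrite -[phi x]/(subg A (act x)) subgK //.
have := congr1 (fun s : {perm T} => s (cx x)) e1.
by rewrite actE perm1 mulVg => /cx_eq; rewrite invg1 mul1g.
Qed.

End Quotients.

(** * Residual girth *)

Section Girth.
Import Order.TTheory GRing.Theory Num.Theory.
Local Open Scope classical_set_scope.
Local Open Scope ring_scope.

Lemma ball_wordP (R : realType) (G : groupType) (S : seq G) n x :
  ball_word R [set` S] n x <-> wball S n x.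
Proof.
rewrite /ball_word /word_length /= nat_inf_leP; split.
  move=> [k [w [hw ->] <-] kn]; apply: ball_mono kn _.
  elim: w hw => [|y w IH] hw; first by rewrite big_nil; exact: ball_one.
  rewrite big_cons; apply: ballS; last by apply: IH => z zw; apply: hw; rewrite inE zw orbT.
  by apply/lettersP; case: (hw y (mem_head _ _)) => h; [apply: Or32|apply: Or33].
move=> bx; suff [w hw wn] : exists2 w, word_value [set` S] w x & (size w <= n)%N.
  by exists (size w) => //; exists w.
elim: n x bx => [x ->|n IH x [a aS /IH [w [hw e] wn]]].
  by exists [::] => //; split=> //; rewrite big_nil.
have [a1|a1] := eqVneq a 1%g.
  by exists w; [split=> //; rewrite -e a1 invg1 mul1g|exact: leqW].
exists (a :: w) => //; split; last by rewrite big_cons -e mulKVg.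
move=> y; rewrite inE => /orP [/eqP ->|/hw //].
by case/lettersP: aS a1 => [->|aS _|aS _]; [rewrite eqxx|left|right].
Qed.

Lemma powR_nat_le (R : realType) (r : R) : exists D : nat, forall n : nat,
  (0 < n)%N -> (n%:R : R) `^ r <= (n ^ D)%N%:R.
Proof.
exists (Num.bound `|r|) => n n0; rewrite natrX -powR_mulrn ?ler0n //.
apply: ler_powR; first by rewrite ler1n.
by apply: (le_trans (ler_norm r)); apply: ltW; exact: archi_boundP.
Qed.

Section ResidualGirth.
Variables (R : realType) (G : groupType) (S : seq G).
Hypothesis genS : gen S = [set: G].

Lemma polynomial_girth_quotients (r : R) :
  growth_le (residual_girth R [set` S]) (fun n : nat => ((n%:R : R) `^ r)%:E) ->
  exists C D : nat, forall n, exists (Q : finGroupType) (phi : {multiplicative G -> Q}),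
    {in wball S n &, injective phi} /\ (#|Q| <= C * n.+1 ^ D)%N.
Proof.
move=> [C C0 hC]; have [D hD] := powR_nat_le r.
exists (C * C ^ D)%N, D => n.
(* Radius [n.+1], because [growth_le] asserts nothing at 0. *)
have : (residual_girth R [set` S] n.+1 <= (C * (C * n.+1) ^ D)%N%:R%:E)%E.
  apply: (le_trans (hC n.+1 (ltn0Sn n))); rewrite -EFinM lee_fin [leRHS]natrM ler_wpM2l ?ler0n //.
  by apply: hD; rewrite muln_gt0 C0.
rewrite nat_inf_leP => -[k [Q [phi [_ inj Qk]]] kn].
exists Q, phi; split; last by rewrite Qk -mulnA -expnMn.
move=> x y /set_mem bx /set_mem by_ e.
by apply: inj => //; rewrite inE; apply/ball_wordP; [move: bx|move: by_]; exact: ball_mono.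
Qed.

Lemma quotients_growth (C D : nat) :
  (forall n, exists (Q : finGroupType) (phi : {multiplicative G -> Q}),
    {in wball S n &, injective phi} /\ (#|Q| <= C * n.+1 ^ D)%N) ->
  growth S D /\ residually_finite G.
Proof.
move=> h; split.
  exists C => n s us hs; have [Q [phi [inj Qn]]] := h n.
  apply: leq_trans Qn; rewrite -(size_map phi) -(card_uniqP _) ?max_card //.
  by rewrite map_inj_in_uniq // => x y /hs /mem_set hx /hs /mem_set hy; exact: inj.
move=> s; have [n hn] : exists n, forall x, x \in s -> wball S n x.
  by apply: ball_bound => x _; rewrite genS.
have [Q [phi [inj _]]] := h n; exists Q, phi => x y /hn /mem_set hx /hn /mem_set hy.
exact: inj.
Qed.

Lemma nilpotent_quotients (H : set G) : is_subgroup H -> fidx H [set: G] ->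
  nilpotent_subgroup H -> exists C D : nat, forall n, (0 < n)%N ->
  exists (Q : finGroupType) (phi : {multiplicative G -> Q}),
    [/\ forall z : Q, exists x, phi x = z, {in wball S n &, injective phi} &
        (#|Q| <= C * n ^ D)%N].
Proof.
move=> sH iH nH; have HS : H `<=` gen S by rewrite genS.
have iHS : fidx H (gen S) by rewrite genS.
have [S0 eS0] := fidx_fg sH HS iHS.
have [l el cl] : exists2 l, gen S0 = gen l & central_list (gen S0) l.
  by apply: nilpotent_central_list; rewrite -eS0.
rewrite -eS0 in el cl; have cl' : central_list (gen l) l by rewrite -el.
have [C [b hC]] := power_separation cl'.
have [L hL] : exists L, forall n x, wball S n x -> gen l x -> wball l (L * n.+1) x.
  by apply: fidx_distortion; rewrite -el.
have [q hq] := iH.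
pose s := size l.
(* The index of the power subgroup is at most [size q * M ^ s], and [coset_quotient] raises it to
   [size q]. The number 3 comes from [(L * (n + n).+1).+1 <= (3 * L).+1 * n] for positive [n]. *)
exists ((size q * (C * (3 * L).+1 ^ b) ^ s) ^ size q)%N, (b * s * size q)%N => n n0.
have [M [M0 MC hM]] := hC (L * (n + n).+1)%N.
pose W := power_subgroup H M; have sW : is_subgroup W by exact: sg_power.
have nW h : H h -> normalizes h W.
  by move=> Hh; apply: power_normalizes; exact: sg_self_normalizes.
have lH x : x \in l -> H x by rewrite el; exact: gen_mem.
have [r rM hr] := power_index sH sW cl lH nW M0 (fun x xl => @power_mem _ H M x (lH x xl)).
have cover x : exists2 y, y \in [seq (y * z)%g | y <- q, z <- r] & W (y^-1 * x)%g.
  have [y yq Hy] := hq x I; rewrite el in Hy; have [z zr Wz] := hr _ Hy.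
  exists (y * z)%g; first exact: allpairs_f.
  by rewrite invgM -mulgA.
have [Q [phi [sur Qle ker]]] := coset_quotient sW nW cover (fun x => hq x I).
exists Q, phi; split=> //.
  move=> x y /set_mem bx /set_mem by_ e.
  have Wxy : W (x^-1 * y)%g by apply: ker; rewrite gmulfM multV e mulVg.
  have gxy : gen l (x^-1 * y)%g by rewrite -el; exact: power_sub Wxy.
  have /(hM _) h : power_subgroup (gen l) M (x^-1 * y)%g by rewrite -el.
  have : (x^-1 * y = 1)%g by apply: h; apply: hL => //; apply: ballM => //; exact: ballV.
  by move=> e1; rewrite -[y](mulKVg x) e1 mulg1.
apply: leq_trans Qle _; rewrite size_allpairs expnM -expnMn leq_expn //.
rewrite -mulnA leq_mul2l expnM -expnMn; apply/orP; right.
apply: leq_trans rM _; apply: leq_expn; apply: leq_trans MC _.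
rewrite -mulnA leq_mul2l -expnMn leq_expn ?orbT //.
by nia.
Qed.

Lemma quotients_polynomial_girth (C D : nat) :
  (forall n, (0 < n)%N -> exists (Q : finGroupType) (phi : {multiplicative G -> Q}),
    [/\ forall z : Q, exists x, phi x = z, {in wball S n &, injective phi} &
        (#|Q| <= C * n ^ D)%N]) ->
  growth_le (residual_girth R [set` S]) (fun n : nat => ((n%:R : R) `^ D%:R)%:E).
Proof.
(* [C] may be 0, while [growth_le] demands a positive constant. *)
move=> h; exists C.+1 => // n n0; have [Q [phi [sur inj Qn]]] := h n n0.
rewrite powR_mulrn ?ler0n // -natrX -EFinM -natrM nat_inf_leP; exists #|Q|.
  exists Q, phi; split=> //; first by move=> z _; have [x <-] := sur z; exists x.
  move=> x y; rewrite !inE => /ball_wordP bx /ball_wordP by_; apply: inj; exact: mem_set.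
apply: leq_trans Qn _; apply: leq_mul; first exact: leqnSn.
by apply: leq_expn; rewrite leq_pmull.
Qed.

End ResidualGirth.

End Girth.

(** * Equivalence of polynomial residual girth and virtual nilpotency *)

Local Open Scope classical_set_scope.
Local Open Scope ring_scope.

Theorem theorem1p3 (R : realType) (Gamma : groupType) (X : set Gamma)
    (finX : finite_set X) (genX : generates X) :
  (exists r : R,
     growth_le (residual_girth R X) (fun n : nat => ((n%:R : R) `^ r)%:E))
  <-> virtually_nilpotent Gamma.
Proof.
have [S XS] := (finite_seqP X).1 finX; rewrite {}XS in genX *.
have genS : gen S = [set: Gamma] by rewrite -gen_subgroup_seq.
split=> [[r /polynomial_girth_quotients [C [D /(quotients_growth genS) [gS rf]]]]|].
  have [N [sN _ iN nN]] := growth_virtually_nilpotent R gS rf.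
  by exists N; split=> //; apply/(finite_indexP sN); rewrite -genS.
move=> [H [sH /(finite_indexP sH) iH nH]].
have [C [D h]] := nilpotent_quotients genS sH iH nH.
by exists D%:R; exact: quotients_polynomial_girth h.
Qed.
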